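(* Let $M,N$ be $kQ$-modules, with dimension vectors $\underline m,\underline n$, such that $$\dim_{k}\mathrm{Ext}^{1}_{k\widetilde{Q}}(M,N)=\dim_{k}\mathrm{Hom}_{k\widetilde{Q}}(N,\tau M)=1 .$$ Let $$0\to N\to E\to M\to 0\qquad\text{and}\qquad 0\to D_{0}\to N\to \tau M\to \tau A\oplus I\to 0$$ be exact sequences of $k\widetilde Q$-modules giving bases of $\mathrm{Ext}^{1}_{k\widetilde{Q}}(M,N)$ and of $\mathrm{Hom}_{k\widetilde{Q}}(N,\tau M)$ respectively, where $I$ is an injective $k\widetilde Q$-module and $A$ is a $k\widetilde Q$-module without projective summands. Write $M=M'\oplus P_0$ with $P_0$ a projective $k\widetilde Q$-module and $M'$ without projective summands, and set $A_0=A\oplus P_0$. Assume that $$\mathrm{Hom}_{k\widetilde{Q}}(D_0,\tau A_0\oplus I)=\mathrm{Hom}_{k\widetilde{Q}}(A_0,I)=0 .$$ Then $$X_{N}X_M=q^{\frac{1}{2}\Lambda((\widetilde{I}-\widetilde{R})\underline{n},(\widetilde{I}-\widetilde{R})\underline{m})}X_E+q^{\frac{1}{2}\Lambda((\widetilde{I}-\widetilde{R})\underline{n},(\widetilde{I}-\widetilde{R})\underline{m})+\frac{1}{2}\langle M,N\rangle-\frac{1}{2}\langle A_0, D_0\rangle}X_{D_0\oplus A_0\oplus I[-1]} .$$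
   Context: Let $k$ be a finite field with $|k|=q$ (with a fixed square root $q^{1/2}$), let $m\ge n$ be positive integers, and let $\widetilde Q$ be an acyclic quiver with vertex set $\{1,\dots,m\}$; the vertices $n+1,\dots,m$ are called frozen, and $Q$ is the full subquiver on $\{1,\dots,n\}$. Modules are finite-dimensional, with the convention that $\dim_k\mathrm{Ext}^1_{k\widetilde Q}(S_i,S_j)$ is the number of arrows $j\to i$, where $S_i$ is the simple module at $i$. A $kQ$-module is viewed as a $k\widetilde Q$-module supported on $\{1,\dots,n\}$, and its dimension vector is regarded as a column vector in $\mathbb Z^n$. $\tau=\tau_{\widetilde Q}$ is the Auslander-Reiten translation of $k\widetilde Q$. Matrices ($m\times n$): $\widetilde B=(b_{ij})$ with $b_{ij}=\#\{i\to j\}-\#\{j\to i\}$; $\widetilde R=(\widetilde r_{ij})$ with $\widetilde r_{ij}=\dim_k\mathrm{Ext}^1_{k\widetilde Q}(S_i,S_j)$; $\widetilde I=\begin{bmatrix}I_n\\0\end{bmatrix}$. It is assumed that there is an antisymmetric integer $m\times m$ matrix $\Lambda$ with $\Lambda(-\widetilde B)=\widetilde I$, and such a $\Lambda$ is fixed; write $\Lambda(a,b)=a^{tr}\Lambda b$ for $a,b\in\mathbb Z^m$. $\mathcal T$ is the $\mathbb Z[q^{\pm1/2}]$-algebra with basis $\{X^e: e\in\mathbb Z^m\}$ and multiplication $X^eX^f=q^{\Lambda(e,f)/2}X^{e+f}$. $\langle M,N\rangle=\dim_k\mathrm{Hom}(M,N)-\dim_k\mathrm{Ext}^1(M,N)$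 is the Euler form, which depends only on dimension vectors and extends bilinearly to them. The cluster category $\mathcal C_{\widetilde Q}$ is the orbit category of $\mathcal D^b(k\widetilde Q)$ by $\tau\circ[-1]$; in it $I[-1]\cong P[1]$ whenever $I$ is injective, $P$ is projective and $\mathrm{soc}\,I\cong P/\mathrm{rad}\,P$. Quantum Caldero-Chapoton map: for a $kQ$-module $M$ with dimension vector $\underline m$ and a projective $k\widetilde Q$-module $P$, $$X_{M\oplus P[1]}=\sum_{\underline e}|\mathrm{Gr}_{\underline e}M|\,q^{-\frac12\langle\underline e,\underline m-\underline e\rangle}X^{\widetilde B\underline e-(\widetilde I-\widetilde R)\underline m+\underline{\dim}\,P/\mathrm{rad}P}\in\mathcal T,$$ where $\mathrm{Gr}_{\underline e}M$ is the set of submodules of $M$ of dimension vector $\underline e$. For $I$ injective, $X_{M\oplus I[-1]}:=X_{M\oplus P[1]}$, where $P$ is the projective module with $P/\mathrm{rad}P\cong\mathrm{soc}\,I$. *)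

(* Defs.v *)
From HB Require Import structures.
From mathcomp Require Import all_boot all_order all_algebra all_field finmap monalg ring.
From mathcomp Require boolp.
Set Implicit Arguments. Unset Strict Implicit. Unset Printing Implicit Defensive.
Import GRing.Theory Num.Theory.
Local Open Scope ring_scope.

(* A choice of q^{1/2}, where q = #|k|. *)
Record sqrt_card (k : finFieldType) := SqrtCard {
  sqrt_val :> algC;
  sqrt_valP : sqrt_val ^+ 2 = #|k|%:R }.

Section CoefficientRing.
Variables (k : finFieldType) (s : sqrt_card k).
Local Notation v := (sqrt_val s).

Lemma sqrt_card_neq0 : v != 0.
Proof.
apply/eqP => v0; have := sqrt_valP s; rewrite v0 expr0n /= => /esym/eqP.
by rewrite pnatr_eq0; apply/negP; rewrite -lt0n (cardD1 0) inE.
Qed.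

(* Z[q^{1/2}, q^{-1/2}], as a subring of the algebraic numbers. *)
Definition coef_pred : {pred algC} := fun x =>
  boolp.asbool (exists (p : {poly int}) (d : nat), x = (map_poly intr p).[v] / v ^+ d).

Lemma coef_predP (x : algC) : reflect
  (exists (p : {poly int}) (d : nat), x = (map_poly intr p).[v] / v ^+ d)
  (x \in coef_pred).
Proof. exact: boolp.asboolP. Qed.

Fact coef_subring : subring_closed coef_pred.
Proof.
have vn d : v ^+ d != 0 by rewrite expf_neq0 ?sqrt_card_neq0.
split.
- by apply/coef_predP; exists 1, 0%N; rewrite rmorph1 hornerC expr0 divr1.
- move=> _ _ /coef_predP[p [d ->]] /coef_predP[p' [d' ->]]; apply/coef_predP.
  exists (p * 'X^d' - p' * 'X^d), (d + d')%N.
  rewrite rmorphB !rmorphM /= !map_polyXn !hornerE exprD.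
  rewrite mulrBl -mulf_div divff // mulr1; congr (_ - _).
  by rewrite [v ^+ d * _]mulrC -mulf_div divff // mulr1.
- move=> _ _ /coef_predP[p [d ->]] /coef_predP[p' [d' ->]]; apply/coef_predP.
  by exists (p * p'), (d + d')%N; rewrite rmorphM /= hornerM exprD mulf_div.
Qed.
HB.instance Definition _ := GRing.isSubringClosed.Build algC coef_pred coef_subring.

Record coef := Coef { coef_val :> algC; coef_valP : coef_val \in coef_pred }.
HB.instance Definition _ := [isSub for coef_val].
HB.instance Definition _ := [Choice of coef by <:].
HB.instance Definition _ := [SubChoice_isSubComNzRing of coef by <:].

Fact qpow_subproof (z : int) : v ^ z \in coef_pred.
Proof.
apply/coef_predP; case: (intP z) => [|d|d].
- by exists 1, 0%N; rewrite expr0z expr0 rmorph1 hornerC divr1.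
- by exists 'X^(d.+1), 0%N; rewrite map_polyXn hornerXn expr0 divr1.
- by exists 1, d.+1; rewrite rmorph1 hornerC div1r -exprnN.
Qed.
(* qpow z = q^{z/2}. *)
Definition qpow (z : int) : coef := Coef (qpow_subproof z).

Lemma qpowD a b : qpow (a + b) = qpow a * qpow b.
Proof. by apply/val_inj; rewrite /= expfzDr // sqrt_card_neq0. Qed.
Lemma qpow0 : qpow 0 = 1.
Proof. exact/val_inj. Qed.
End CoefficientRing.


(* The algebra T: free over Z[q^{1/2}, q^{-1/2}] on the X^e, with
   X^e X^f = q^{L(e,f)/2} X^{e+f}; see XpowM. *)
Definition qtorus (k : finFieldType) (s : sqrt_card k) (m : nat)
  (L : 'M[int]_m) : Type := {malg (coef s)['cV[int]_m]}.
HB.instance Definition _ k (s : sqrt_card k) m (L : 'M[int]_m) :=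
  GRing.Lmodule.on (qtorus s L).

Section QuantumTorus.
Variables (k : finFieldType) (s : sqrt_card k) (m : nat) (L : 'M[int]_m).
Implicit Types e f : 'cV[int]_m.

Definition Lform e f : int := (e^T *m L *m f) 0 0.

Lemma LformDl e f g : Lform (e + f) g = Lform e g + Lform f g.
Proof. by rewrite /Lform linearD /= !mulmxDl mxE. Qed.
Lemma LformDr e f g : Lform e (f + g) = Lform e f + Lform e g.
Proof. by rewrite /Lform mulmxDr mxE. Qed.

Local Notation qtorus := (qtorus s L).
Implicit Types x y z : qtorus.

Definition Xpow e : qtorus := << e >>.

Definition qt_mul x y : qtorus :=
  \sum_(e <- msupp x) \sum_(f <- msupp y)
     << x@_e * y@_f * qpow s (Lform e f) *g e + f >>.

Local Notation term x y e f := << x@_e * y@_f * qpow s (Lform e f) *g e + f >>.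

Fact qt_mulw (d1 d2 : {fset 'cV[int]_m}) x y :
  (msupp x `<=` d1)%fset -> (msupp y `<=` d2)%fset ->
  qt_mul x y = \sum_(e <- d1) \sum_(f <- d2) term x y e f.
Proof.
move=> le1 le2; rewrite /qt_mul (big_fset_incl _ le1) /=.
  apply/eq_bigr=> e _; apply/big_fset_incl => // f _ /mcoeff_outdom ->.
  by rewrite mulr0 mul0r monalgU0.
move=> e _ /mcoeff_outdom xe.
by rewrite big1 // => f _; rewrite xe !mul0r monalgU0.
Qed.

Fact qt_mulDl : left_distributive qt_mul +%R.
Proof.
move=> x y z; pose d := (msupp x `|` msupp y)%fset.
have [dx dy] := (fsubsetUl (msupp x) (msupp y), fsubsetUr (msupp x) (msupp y)).
have dxy := msuppD_le x y; have dz := fsubset_refl (msupp z).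
rewrite (qt_mulw dx dz) (qt_mulw dy dz) (qt_mulw dxy dz) -big_split.
apply/eq_bigr=> e _; rewrite -big_split; apply/eq_bigr=> f _ /=.
by rewrite mcoeffD !mulrDl monalgUD.
Qed.

Fact qt_mulDr : right_distributive qt_mul +%R.
Proof.
move=> z x y; pose d := (msupp x `|` msupp y)%fset.
have [dx dy] := (fsubsetUl (msupp x) (msupp y), fsubsetUr (msupp x) (msupp y)).
have dxy := msuppD_le x y; have dz := fsubset_refl (msupp z).
rewrite (qt_mulw dz dx) (qt_mulw dz dy) (qt_mulw dz dxy) -big_split.
apply/eq_bigr=> e _; rewrite -big_split; apply/eq_bigr=> f _ /=.
by rewrite mcoeffD mulrDr mulrDl monalgUD.
Qed.

Fact qt_mul0l : left_zero 0 qt_mul.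
Proof. by move=> x; rewrite /qt_mul msupp0 big_seq_fset0. Qed.
Fact qt_mul0r : right_zero 0 qt_mul.
Proof. by move=> x; rewrite /qt_mul exchange_big msupp0 big_seq_fset0. Qed.

Lemma qt_mulUU c d e f :
  qt_mul << c *g e >> << d *g f >> = << c * d * qpow s (Lform e f) *g e + f >>.
Proof.
by rewrite (qt_mulw (msuppU_le (k:=e)) (msuppU_le (k:=f))) !big_seq_fset1 !mcoeffUU.
Qed.

Let suml I (r : seq I) (F : I -> qtorus) y :
  qt_mul (\sum_(i <- r) F i) y = \sum_(i <- r) qt_mul (F i) y.
Proof.
exact: (big_morph (qt_mul^~ y) (fun u v => qt_mulDl u v y) (qt_mul0l y)).
Qed.
Let sumr I (r : seq I) (F : I -> qtorus) y :
  qt_mul y (\sum_(i <- r) F i) = \sum_(i <- r) qt_mul y (F i).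
Proof. exact: (big_morph _ (qt_mulDr y) (qt_mul0r y)). Qed.

Let expand x : exists (r : seq 'cV[int]_m) (c : 'cV[int]_m -> coef s),
  x = \sum_(e <- r) << c e *g e >>.
Proof. by exists (msupp x), (fun e => x@_e); apply: monalgE. Qed.

Fact qt_mulA : associative qt_mul.
Proof.
move=> x y z; have [rx [cx ->]] := expand x; have [ry [cy ->]] := expand y.
have [rz [cz ->]] := expand z.
rewrite !(suml rx); apply/eq_bigr => e _.
rewrite (suml ry) !(sumr ry) (suml ry); apply/eq_bigr => f _.
rewrite !(sumr rz); apply/eq_bigr => g _.
rewrite !qt_mulUU addrA LformDl LformDr !qpowD; congr (<< _ *g _ >>).
ring.
Qed.

Fact qt_mul1l : left_id (Xpow 0) qt_mul.
Proof.
move=> x; have [r [c ->]] := expand x; rewrite sumr; apply/eq_bigr => e _.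
by rewrite qt_mulUU /Lform trmx0 !mul0mx mxE qpow0 add0r mul1r mulr1.
Qed.

Fact qt_mul1r : right_id (Xpow 0) qt_mul.
Proof.
move=> x; have [r [c ->]] := expand x; rewrite suml; apply/eq_bigr => e _.
by rewrite qt_mulUU /Lform mulmx0 mxE qpow0 addr0 !mulr1.
Qed.

Fact qt_oner_neq0 : Xpow 0 != 0.
Proof. by rewrite monalgU_eq0 oner_eq0. Qed.

HB.instance Definition _ := GRing.Zmodule_isNzRing.Build qtorus
  qt_mulA qt_mul1l qt_mul1r qt_mulDl qt_mulDr qt_oner_neq0.

Lemma XpowM e f : Xpow e * Xpow f = qpow s (Lform e f) *: Xpow (e + f).
Proof.
rewrite [LHS]qt_mulUU !mul1r; apply/malgP => g.
by rewrite mcoeffZ !mcoeffU mulrnAr mulr1.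
Qed.
End QuantumTorus.

Section FiniteSubspaces.
Import VectorInternalTheory.
Variables (F : finFieldType) (vT : vectType F).
HB.instance Definition _ := [Countable of {vspace vT} by <:].
HB.instance Definition _ := [Finite of {vspace vT} by <:].
End FiniteSubspaces.

Lemma linfun_ext (K : fieldType) (aT rT : vectType K) (f : aT -> rT) :
  linear f -> linfun f =1 f.
Proof.
move=> fL; pose fM := GRing.isLinear.Build K _ _ _ f fL.
pose g : {linear aT -> rT} := HB.pack f fM.
exact: (lfunE g).
Qed.

Record quiver (m : nat) := Quiver {
  arrow : finType;
  src : arrow -> 'I_m;
  tgt : arrow -> 'I_m }.
Arguments src {m q}.
Arguments tgt {m q}.

Definition acyclic m (Q : quiver m) : Prop :=
  forall p : seq 'I_m,
    cycle [rel i j | [exists a : arrow Q, (src a == i) && (tgt a == j)]] p ->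
    p = [::].

(* Generators of the path algebra: vertex idempotents e_i and arrows. *)
Definition gen m (Q : quiver m) : finType := ('I_m + arrow Q)%type.

(* Finite-dimensional left modules over kQ, given by the presentation of kQ:
   generators e_i and a, relations e_i e_j = [i = j] e_i, \sum_i e_i = 1 and
   a = e_(src a) a e_(tgt a).  So an arrow a : i -> j acts as a map from the
   e_j-component to the e_i-component, and Ext^1(S_i, S_j) has the arrows j -> i
   as a basis; see ext_dim_simple. *)
Record qmod (k : finFieldType) m (Q : quiver m) := Qmod {
  qsort :> vectType k;
  act : gen Q -> 'End(qsort);
  act_idem : forall i j,
    (act (inl i) \o act (inl j))%VF = if i == j then act (inl i) else 0;
  act_one : \sum_i act (inl i) = \1%VF;
  act_arrow : forall a : arrow Q,
    (act (inl (src a)) \o act (inr a) \o act (inl (tgt a)))%VF = act (inr a) }.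

Section Modules.
Variables (k : finFieldType) (m : nat) (Q : quiver m).
Local Notation mod := (qmod k Q).
Implicit Types (M N : mod) (x : gen Q).

Definition dimv M (i : 'I_m) : nat := \dim (limg (act M (inl i))).

Section Homs.
Variables M N : mod.

Definition commutator x (f : 'Hom(M, N)) : 'Hom(M, N) :=
  (f \o act M x)%VF - (act N x \o f)%VF.
Fact commutator_linear x : linear (commutator x).
Proof.
move=> c f g; rewrite /commutator comp_lfunDl comp_lfunDr -comp_lfunZl -comp_lfunZr.
by rewrite scalerBr opprD !addrA; congr (_ + _); rewrite addrAC.
Qed.
HB.instance Definition _ x := GRing.isLinear.Build k _ _ _ (commutator x) (commutator_linear x).

Definition homs : {vspace 'Hom(M, N)} :=
  (\bigcap_(x : gen Q) lker (linfun (commutator x)))%VS.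

(* Yoneda Ext^1(M, N) as cocycles modulo coboundaries.  A module extension of M
   by N splits over the subalgebra spanned by the e_i, so it is N (+) M with the
   arrow a acting by the block matrix (a_N, phi a; 0, a_M), where phi a belongs to
   e_(src a) Hom(M, N) e_(tgt a).  Two choices of phi give equivalent extensions
   iff they differ by a_N h - h a_M for a linear h commuting with all e_i. *)
Definition cochain := {ffun arrow Q -> 'Hom(M, N)}.

Definition trunc (phi : cochain) : cochain :=
  [ffun a => (act N (inl (src a)) \o phi a \o act M (inl (tgt a)))%VF].
Fact trunc_linear : linear trunc.
Proof.
move=> c f g; apply/ffunP=> a; rewrite !ffunE.
by rewrite comp_lfunDr comp_lfunDl -comp_lfunZr -comp_lfunZl.
Qed.
HB.instance Definition _ := GRing.isLinear.Build k _ _ _ trunc trunc_linear.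

Definition cocycles : {vspace cochain} := limg (linfun trunc).

Definition coboundary (h : 'Hom(M, N)) : cochain :=
  [ffun a => (act N (inr a) \o h)%VF - (h \o act M (inr a))%VF].
Fact coboundary_linear : linear coboundary.
Proof.
move=> c f g; apply/ffunP=> a; rewrite !ffunE.
rewrite comp_lfunDl comp_lfunDr -comp_lfunZl -comp_lfunZr.
by rewrite scalerBr opprD !addrA; congr (_ + _); rewrite addrAC.
Qed.
HB.instance Definition _ := GRing.isLinear.Build k _ _ _ coboundary coboundary_linear.

Definition graded_maps : {vspace 'Hom(M, N)} :=
  (\bigcap_i lker (linfun (commutator (inl i))))%VS.
Definition coboundaries : {vspace cochain} := (linfun coboundary @: graded_maps)%VS.

Definition ext_dim : nat := \dim cocycles - \dim coboundaries.

(* The class of phi is a basis of the quotient cocycles / coboundaries. *)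
Definition ext_basis (phi : cochain) : bool :=
  [&& phi \in cocycles, phi \notin coboundaries
    & (cocycles <= <[phi]> + coboundaries)%VS].
End Homs.

Definition is_hom (M N : mod) (f : 'Hom(M, N)) : bool := f \in homs M N.

Lemma is_homP (M N : mod) (f : 'Hom(M, N)) :
  reflect (forall x v, f (act M x v) = act N x (f v)) (is_hom f).
Proof.
apply: (iffP idP) => [fP x v|fP].
  have /subv_bigcapP/(_ x isT) : (<[f]> <= homs M N)%VS by [].
  rewrite -memvE memv_ker lfunE /= => /eqP/lfunP/(_ v).
  by rewrite !lfunE /= !lfunE /= !lfunE => /eqP; rewrite subr_eq0 => /eqP.
rewrite /is_hom memvE; apply/subv_bigcapP => x _; rewrite -memvE memv_ker lfunE /=.
apply/eqP/lfunP => v; rewrite !lfunE /= !lfunE /= !lfunE /=.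
by apply/eqP; rewrite subr_eq0 fP.
Qed.

Definition isomorphic (M N : mod) : Prop :=
  exists f : 'Hom(M, N), [/\ is_hom f, lker f = 0%VS & limg f = fullv].

Definition short_exact (N E M : mod) (i : 'Hom(N, E)) (p : 'Hom(E, M)) : Prop :=
  [/\ is_hom i, is_hom p, lker i = 0%VS, limg i = lker p & limg p = fullv].

(* phi represents the class of 0 -> N -> E -> M -> 0: it is read off from a
   section s of p that commutes with the e_i. *)
Definition extension_class (N E M : mod) (i : 'Hom(N, E)) (p : 'Hom(E, M))
    (phi : cochain M N) : Prop :=
  exists s : 'Hom(M, E),
    [/\ s \in graded_maps M E, (p \o s = \1)%VF &
        forall a, (i \o phi a)%VF = (act E (inr a) \o s)%VF - (s \o act M (inr a))%VF].

Definition exact4 (D N T C : mod) (f : 'Hom(D, N)) (g : 'Hom(N, T))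
    (h : 'Hom(T, C)) : Prop :=
  [/\ is_hom f, is_hom g & is_hom h] /\
  [/\ lker f = 0%VS, limg f = lker g, limg g = lker h & limg h = fullv].

Section DirectSum.
Variables M N : mod.
Definition dsum_act x : 'End(M * N)%type :=
  linfun (fun v : M * N => (act M x v.1, act N x v.2)).
Fact dsum_actE x v : dsum_act x v = (act M x v.1, act N x v.2).
Proof.
by apply: linfun_ext => c u w; rewrite /= !linearP.
Qed.
Fact dsum_idem i j : (dsum_act (inl i) \o dsum_act (inl j))%VF =
  if i == j then dsum_act (inl i) else 0.
Proof.
apply/lfunP => v; rewrite lfunE /= !dsum_actE /=.
rewrite -[act M _ (act M _ _)]comp_lfunE -[act N _ (act N _ _)]comp_lfunE !act_idem.
by case: eqP => _; rewrite ?dsum_actE // !lfunE.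
Qed.
Fact dsum_one : \sum_i dsum_act (inl i) = \1%VF.
Proof.
apply/lfunP => v; rewrite sum_lfunE lfunE /= (eq_bigr _ (fun i _ => dsum_actE _ v)).
rewrite [RHS]surjective_pairing -[v.1 in RHS](id_lfunE) -[v.2 in RHS](id_lfunE).
rewrite -(act_one M) -(act_one N) !sum_lfunE.
by elim/big_rec3: _ => // i y1 y2 y3 _ ->.
Qed.
Fact dsum_arrow a : (dsum_act (inl (src a)) \o dsum_act (inr a) \o
  dsum_act (inl (tgt a)))%VF = dsum_act (inr a).
Proof.
apply/lfunP => v; rewrite lfunE /= lfunE /= !dsum_actE /=.
by rewrite -[in RHS](act_arrow M) -[in RHS](act_arrow N) !lfunE /= !lfunE.
Qed.
Definition dsum : mod := Qmod dsum_idem dsum_one dsum_arrow.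
End DirectSum.


Section ZeroModule.
Fact zmod_idem (i j : 'I_m) : ((0 : 'End('rV[k]_0)) \o 0)%VF = if i == j then 0 else 0 :> 'End('rV[k]_0).
Proof. by rewrite comp_lfun0l if_same. Qed.
Fact zmod_one : \sum_(i < m) 0 = \1%VF :> 'End('rV[k]_0).
Proof. by apply/lfunP => v; rewrite (thinmx0 v) !linear0. Qed.
Fact zmod_arrow (a : arrow Q) : ((0 : 'End('rV[k]_0)) \o (0 : 'End('rV[k]_0)) \o (0 : 'End('rV[k]_0)))%VF = 0 :> 'End('rV[k]_0).
Proof. by rewrite !comp_lfun0l. Qed.
Definition zero_mod : mod :=
  @Qmod k m Q _ (fun=> 0) zmod_idem zmod_one zmod_arrow.
End ZeroModule.

Section SimpleModule.
Variable i0 : 'I_m.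
Definition simple_act (x : gen Q) : 'End(k^o) :=
  if x is inl i then (if i == i0 then \1%VF else 0) else 0.
Fact simple_idem i j : (simple_act (inl i) \o simple_act (inl j))%VF =
  if i == j then simple_act (inl i) else 0.
Proof.
rewrite /=; case: (eqVneq i j) => [->|]; first by case: eqP => _; rewrite ?comp_lfun1l ?comp_lfun0l.
case: (eqVneq i i0) => [->|_ _]; last by rewrite comp_lfun0l.
by rewrite eq_sym => /negPf->; rewrite comp_lfun0r.
Qed.
Fact simple_one : \sum_i simple_act (inl i) = \1%VF.
Proof. by rewrite /= -big_mkcond big_pred1_eq. Qed.
Fact simple_arrow a : (simple_act (inl (src a)) \o simple_act (inr a) \o
  simple_act (inl (tgt a)))%VF = simple_act (inr a).
Proof. by rewrite /= comp_lfun0r comp_lfun0l. Qed.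
Definition simple_mod : mod := Qmod simple_idem simple_one simple_arrow.
End SimpleModule.

Definition stable M (U : {vspace M}) : bool := [forall x, (act M x @: U <= U)%VS].

Fact stableP M (U : {vspace M}) :
  reflect (forall x v, v \in U -> act M x v \in U) (stable U).
Proof.
apply: (iffP forallP) => h x; first by move=> v vU; apply/(subvP (h x))/memv_img.
by apply/subvP => _ /memv_imgP[v vU ->]; apply: h.
Qed.

Section Submodule.
Variables (M : mod) (U : {vspace M}) (U_stable : stable U).
Definition sub_act x : 'End(subvs_of U) := linfun (fun v => vsproj U (act M x (vsval v))).
Fact sub_actE x v : vsval (sub_act x v) = act M x (vsval v).
Proof.
rewrite linfun_ext; last by move=> c u w; rewrite !linearP.
by rewrite vsprojK //; apply: (stableP _ U_stable); apply: subvsP.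
Qed.
Fact sub_idem i j : (sub_act (inl i) \o sub_act (inl j))%VF =
  if i == j then sub_act (inl i) else 0.
Proof.
apply/lfunP => v; apply/val_inj; rewrite /= lfunE /= !sub_actE -comp_lfunE act_idem.
by case: eqP => _; rewrite ?sub_actE // !lfunE.
Qed.
Fact sub_one : \sum_i sub_act (inl i) = \1%VF.
Proof.
apply/lfunP => v; apply/val_inj.
rewrite sum_lfunE lfunE /= linear_sum /= -[RHS]id_lfunE -(act_one M) sum_lfunE.
by apply: eq_bigr => i _; rewrite sub_actE.
Qed.
Fact sub_arrow a : (sub_act (inl (src a)) \o sub_act (inr a) \o
  sub_act (inl (tgt a)))%VF = sub_act (inr a).
Proof.
apply/lfunP => v; apply/val_inj; rewrite lfunE /= lfunE /= !sub_actE.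
by rewrite -[in RHS](act_arrow M) !lfunE /= !lfunE.
Qed.
Definition sub_mod : mod := Qmod sub_idem sub_one sub_arrow.
End Submodule.

(* M / U, carried by the complement U^C, identified with M / U by the projection
   along U. *)
Section Quotient.
Variables (M : mod) (U : {vspace M}) (U_stable : stable U).
Local Notation W := (U^C)%VS.
Definition quo_proj : 'Hom(M, subvs_of W) :=
  linfun (fun v => vsproj W (daddv_pi W U v)).
Definition quo_act x : 'End(subvs_of W) := linfun (fun v => quo_proj (act M x (vsval v))).
Fact WU0 : (W :&: U = 0)%VS. Proof. by rewrite capvC capv_compl. Qed.
Fact quo_projE v : vsval (quo_proj v) = daddv_pi W U v.
Proof.
rewrite linfun_ext ?vsprojK ?memv_pi //.
by move=> c u w; rewrite !linearP.
Qed.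
Fact quo_actE x v : quo_act x (quo_proj v) = quo_proj (act M x v).
Proof.
rewrite linfun_ext; last by move=> c u w; rewrite !linearP.
rewrite quo_projE; apply/val_inj; rewrite /= !quo_projE.
have Dv : daddv_pi W U v + daddv_pi U W v = v.
  by apply: daddv_pi_add WU0 _; rewrite addvC addv_complf memvf.
rewrite -[in RHS]Dv !linearD /=.
have Uv : act M x (daddv_pi U W v) \in U.
  exact/(stableP _ U_stable)/memv_pi.
have := daddv_pi_add WU0 (_ : act M x (daddv_pi U W v) \in (W + U)%VS).
rewrite addvC addv_complf memvf => /(_ isT).
rewrite (daddv_pi_id (capv_compl U) Uv) => /(canRL (addrK _)).
by rewrite subrr => ->; rewrite addr0.
Qed.
Fact quo_surj w : exists v, w = quo_proj v.
Proof.
exists (vsval w); apply/val_inj; rewrite /= quo_projE daddv_pi_id ?WU0 //.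
exact: subvsP.
Qed.
Fact quo_idem i j : (quo_act (inl i) \o quo_act (inl j))%VF =
  if i == j then quo_act (inl i) else 0.
Proof.
apply/lfunP => w; have [v ->] := quo_surj w.
rewrite lfunE /= !quo_actE -(comp_lfunE (act M _)) act_idem.
by case: eqP => _; rewrite ?quo_actE // !lfunE linear0.
Qed.
Fact quo_one : \sum_i quo_act (inl i) = \1%VF.
Proof.
apply/lfunP => w; have [v ->] := quo_surj w.
rewrite sum_lfunE [in RHS]lfunE /= -[v in RHS]id_lfunE -(act_one M) sum_lfunE.
by rewrite linear_sum; apply: eq_bigr => i _; rewrite quo_actE.
Qed.
Fact quo_arrow a : (quo_act (inl (src a)) \o quo_act (inr a) \o
  quo_act (inl (tgt a)))%VF = quo_act (inr a).
Proof.
apply/lfunP => w; have [v ->] := quo_surj w.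
rewrite lfunE /= lfunE /= !quo_actE.
by rewrite -[in RHS](act_arrow M) !lfunE /= !lfunE.
Qed.
Definition quo_mod : mod := Qmod quo_idem quo_one quo_arrow.
End Quotient.

Definition maximal_sub M (U : {vspace M}) : bool :=
  [&& stable U, U != fullv &
      [forall V : {vspace M}, stable V && (U <= V)%VS ==> (V == U) || (V == fullv)]].
Definition simple_sub M (U : {vspace M}) : bool :=
  [&& stable U, U != 0%VS &
      [forall V : {vspace M}, stable V && (V <= U)%VS ==> (V == 0%VS) || (V == U)]].

Definition rad M : {vspace M} := (\bigcap_(U : {vspace M} | maximal_sub U) U)%VS.
Definition soc M : {vspace M} := (\sum_(U : {vspace M} | simple_sub U) U)%VS.

Fact rad_stable M : stable (rad M).
Proof.
apply/stableP => x v vR; rewrite memvE; apply/subv_bigcapP => U maxU.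
rewrite -memvE; have /and3P[Us _ _] := maxU; apply: (stableP _ Us).
by apply/(subvP _ v vR); exact: (bigcapv_inf _ maxU (subvv U)).
Qed.
Fact soc_stable M : stable (soc M).
Proof.
apply/forallP => x; rewrite limg_sum; apply/subv_sumP => U simU.
have /and3P[/forallP/(_ x) Us _ _] := simU.
exact/(subv_trans Us)/(sumv_sup U).
Qed.

Definition top_mod M : mod := quo_mod (rad_stable M).
Definition soc_mod M : mod := sub_mod (soc_stable M).

Definition projective (P : mod) : Prop :=
  forall (X Y : mod) (p : 'Hom(X, Y)) (f : 'Hom(P, Y)),
    is_hom p -> limg p = fullv -> is_hom f ->
    exists2 g : 'Hom(P, X), is_hom g & (p \o g)%VF = f.
Definition injective_mod (I : mod) : Prop :=
  forall (X Y : mod) (i : 'Hom(X, Y)) (f : 'Hom(X, I)),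
    is_hom i -> lker i = 0%VS -> is_hom f ->
    exists2 g : 'Hom(Y, I), is_hom g & (g \o i)%VF = f.

Definition no_projective_summand (A : mod) : Prop :=
  forall X P : mod, isomorphic A (dsum X P) -> projective P -> \dim {:P} = 0%N.

End Modules.

Section PathAlgebra.
Variables (k : finFieldType) (m : nat) (Q : quiver m).
Implicit Types x y : gen Q.

(* The path algebra A = kQ itself, as functions on the set of paths.  A path is a
   start vertex together with a composable word of arrows, and the product pq is
   concatenation, defined when p ends where q starts.  For acyclic Q all paths
   have fewer than m arrows, so the length bound of qpath excludes none. *)
Fixpoint walk (i : 'I_m) (w : seq (arrow Q)) : bool :=
  if w is a :: w' then (src a == i) && walk (tgt a) w' else true.

Definition qpath := {p : 'I_m * m.-bseq (arrow Q) | walk p.1 p.2}.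
Implicit Types p r : qpath.

Definition psrc p : 'I_m := (val p).1.
Definition pword p : seq (arrow Q) := (val p).2.
Definition ptgt p : 'I_m := last (psrc p) (map tgt (pword p)).

(* lstep x p r : r = x p;  rstep x p r : r = p x. *)
Definition lstep x p r : bool :=
  match x with
  | inl i => (psrc p == i) && (r == p)
  | inr a => [&& tgt a == psrc p, psrc r == src a & pword r == a :: pword p]
  end.
Definition rstep x p r : bool :=
  match x with
  | inl i => (ptgt p == i) && (r == p)
  | inr a => [&& ptgt p == src a, psrc r == psrc p & pword r == rcons (pword p) a]
  end.

Definition path_space := {ffun qpath -> k^o}.
Implicit Types f g : path_space.
Definition lmul x f : path_space := [ffun r => \sum_(p | lstep x p r) f p].
Definition rmul x f : path_space := [ffun r => \sum_(p | rstep x p r) f p].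

Fact lmul_linear x : linear (lmul x).
Proof.
move=> c f g; apply/ffunP => r; rewrite !ffunE scaler_sumr -big_split.
by apply: eq_bigr => p _; rewrite !ffunE.
Qed.
Fact rmul_linear x : linear (rmul x).
Proof.
move=> c f g; apply/ffunP => r; rewrite !ffunE scaler_sumr -big_split.
by apply: eq_bigr => p _; rewrite !ffunE.
Qed.

Fact lmul_idemE i f r : lmul (inl i) f r = if psrc r == i then f r else 0.
Proof.
rewrite ffunE /=; case: ifP => ri.
  rewrite (big_pred1 r) // => p /=.
  by apply/andP/eqP => [[_ /eqP->]|->].
by rewrite big1 // => p /andP[pi /eqP rp]; rewrite rp (eqP pi) eqxx in ri.
Qed.
Fact rmul_idemE i f r : rmul (inl i) f r = if ptgt r == i then f r else 0.
Proof.
rewrite ffunE /=; case: ifP => ri.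
  rewrite (big_pred1 r) // => p /=.
  by apply/andP/eqP => [[_ /eqP->]|->].
by rewrite big1 // => p /andP[pi /eqP rp]; rewrite rp (eqP pi) eqxx in ri.
Qed.

Fact ptgt_rcons p r a : pword r = rcons (pword p) a -> ptgt r = tgt a.
Proof. by rewrite /ptgt => ->; rewrite map_rcons last_rcons. Qed.

Fact qpath_inj p r : psrc p = psrc r -> pword p = pword r -> p = r.
Proof.
rewrite /psrc /pword => e1 e2; apply/val_inj.
by rewrite [val p]surjective_pairing [val r]surjective_pairing e1; congr pair; apply/val_inj.
Qed.

Fact qpathP i w : walk i w -> (size w <= m)%N ->
  exists p, psrc p = i /\ pword p = w.
Proof.
move=> wk sz; have wk' : walk (i, Bseq sz).1 (i, Bseq sz).2 by [].
by exists (exist (fun p : 'I_m * m.-bseq (arrow Q) => walk p.1 p.2) _ wk').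
Qed.
Fact walkP p : walk (psrc p) (pword p). Proof. exact: valP p. Qed.
Fact size_pword p : (size (pword p) <= m)%N. Proof. exact: size_bseq. Qed.

Fact walk_rcons i w a : walk i (rcons w a) = walk i w && (last i (map tgt w) == src a).
Proof.
elim: w i => [|b w IH] i /=; first by rewrite andbT eq_sym.
by rewrite IH andbA.
Qed.

Fact lstep_ptgt x p r : lstep x p r -> ptgt r = ptgt p.
Proof.
case: x => [i|a] /=; first by case/andP => _ /eqP->.
by case/and3P => /eqP at_p _ /eqP wr; rewrite /ptgt wr /= at_p.
Qed.
Fact rstep_psrc x p r : rstep x p r -> psrc r = psrc p.
Proof.
case: x => [i|a] /=; first by case/andP => _ /eqP->.
by case/and3P => _ /eqP.
Qed.
Fact lstep_inj x p p' r : lstep x p r -> lstep x p' r -> p = p'.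
Proof.
case: x => [i|a] /=; first by case/andP=> _ /eqP <- /andP[_ /eqP].
case/and3P => /eqP e1 _ /eqP -> /and3P[/eqP e2 _ /eqP[]].
by apply: qpath_inj; rewrite -e1.
Qed.
Fact rstep_inj x p p' r : rstep x p r -> rstep x p' r -> p = p'.
Proof.
case: x => [i|a] /=; first by case/andP=> _ /eqP <- /andP[_ /eqP].
case/and3P => _ /eqP e1 /eqP -> /and3P[_ /eqP e2 /eqP/rcons_inj[]].
by apply: qpath_inj; rewrite -e1.
Qed.

Fact step_swap x y p r :
  [exists q, lstep x q r && rstep y p q] = [exists q, rstep y q r && lstep x p q].
Proof.
apply/existsP/existsP => [] [q /andP[]].
- case: x => [i|a].
    move=> /= /andP[qi /eqP->] pq; exists p; rewrite pq /= eqxx andbT.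
    by rewrite -(rstep_psrc pq).
  move=> aqr; case: y => [j|b].
    move=> /= /andP[pj /eqP qp]; exists r; rewrite eqxx andbT (lstep_ptgt aqr) qp pj.
    by move: aqr; rewrite qp.
  move=> /and3P[pb /eqP sq /eqP wq].
  move: aqr => /and3P[/eqP aq /eqP sr /eqP wr].
  have wk : walk (src a) (a :: pword p).
    by have := walkP r; rewrite sr wr wq -rcons_cons walk_rcons => /andP[].
  have sz : (size (a :: pword p) <= m)%N.
    by apply: leq_trans (size_pword r); rewrite wr wq /= size_rcons ltnW.
  have [q' [sq' wq']] := qpathP wk sz; exists q'.
  have apq : lstep (inr a) p q' by rewrite /= aq sq sq' wq' !eqxx.
  by rewrite apq andbT /= (lstep_ptgt apq) pb sq' sr wq' wr wq !eqxx.
- case: y => [j|b].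
    move=> /= /andP[qj /eqP->] pq; exists p; rewrite pq /= eqxx andbT.
    by rewrite -(lstep_ptgt pq).
  move=> qbr; case: x => [i|a].
    move=> /= /andP[pj /eqP qp]; exists r; apply/andP; split; last by rewrite -qp.
    by rewrite /= (rstep_psrc qbr) qp pj eqxx.
  move=> /and3P[/eqP ap /eqP sq /eqP wq].
  move: qbr => /and3P[qb /eqP sr /eqP wr].
  have tp : ptgt p == src b.
    by rewrite -(eqP qb) /ptgt wq /= ap.
  have wk : walk (psrc p) (rcons (pword p) b) by rewrite walk_rcons walkP.
  have sz : (size (rcons (pword p) b) <= m)%N.
    by apply: leq_trans (size_pword r); rewrite wr wq /= !size_rcons ltnW.
  have [q' [sq' wq']] := qpathP wk sz; exists q'.
  by rewrite /= ap sq' wq' tp sr sq wr wq !eqxx.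
Qed.

Fact lmul_rmulC x y f : lmul x (rmul y f) = rmul y (lmul x f).
Proof.
apply/ffunP => r; rewrite !ffunE.
under eq_bigr do rewrite ffunE.
under [RHS]eq_bigr do rewrite ffunE.
rewrite (exchange_big_dep xpredT) //= [RHS](exchange_big_dep xpredT) //=.
apply: eq_bigr => p _; rewrite !sumr_const; congr (_ *+ _).
have card01 (P : pred qpath) : (forall q q', P q -> P q' -> q = q') -> #|P| = [exists q, P q].
  move=> P1; case: existsP => [[q Pq]|nP]; last first.
    by apply: eq_card0 => q; apply/negP => Pq; apply: nP; exists q.
  by rewrite (@eq_card1 _ q) // => q'; rewrite !inE; apply/idP/eqP => [Pq'|->//]; apply: P1.
rewrite !card01 ?step_swap // => q q' /andP[h1 h2] /andP[h3 h4].
  exact: rstep_inj h1 h3.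
exact: lstep_inj h1 h3.
Qed.

Definition path_act x : 'End(path_space) := linfun (lmul x).
Fact path_actE x f : path_act x f = lmul x f.
Proof. exact/linfun_ext/lmul_linear. Qed.
Fact path_idem i j : (path_act (inl i) \o path_act (inl j))%VF =
  if i == j then path_act (inl i) else 0.
Proof.
apply/lfunP => f; rewrite lfunE /= !path_actE; apply/ffunP => r.
rewrite !lmul_idemE; case: (eqVneq i j) => [->|ij].
  by rewrite path_actE lmul_idemE; case: (psrc r == j).
by rewrite lfunE /= ffunE; case: eqP => // ->; rewrite (negPf ij).
Qed.
Fact path_one : \sum_i path_act (inl i) = \1%VF.
Proof.
apply/lfunP => f; rewrite sum_lfunE lfunE /=; apply/ffunP => r.
rewrite sum_ffunE; under eq_bigr do rewrite path_actE lmul_idemE.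
by rewrite -big_mkcond (big_pred1 (psrc r)).
Qed.
Fact path_arrow a : (path_act (inl (src a)) \o path_act (inr a) \o
  path_act (inl (tgt a)))%VF = path_act (inr a).
Proof.
apply/lfunP => f; rewrite lfunE /= lfunE /= !path_actE; apply/ffunP => r.
rewrite lmul_idemE !ffunE; case: eqP => [_|ra].
  by apply: eq_bigr => p /and3P[/eqP tp _ _]; rewrite lmul_idemE tp eqxx.
by rewrite big1 // => p /and3P[_ /eqP].
Qed.
Definition path_mod : qmod k Q := Qmod path_idem path_one path_arrow.

Definition path_ract x : 'End(path_mod) := linfun (rmul x).
Fact path_ractE x f : path_ract x f = rmul x f.
Proof. exact/linfun_ext/rmul_linear. Qed.
Fact path_act_ractC x y : (act path_mod x \o path_ract y = path_ract y \o act path_mod x)%VF.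
Proof.
apply/lfunP => f; rewrite !comp_lfunE /= !path_ractE !path_actE.
exact: lmul_rmulC.
Qed.
Fact path_ridem i j : (path_ract (inl i) \o path_ract (inl j))%VF =
  if i == j then path_ract (inl i) else 0.
Proof.
apply/lfunP => f; rewrite lfunE /= !path_ractE; apply/ffunP => r.
rewrite !rmul_idemE; case: (eqVneq i j) => [->|ij].
  by rewrite path_ractE rmul_idemE; case: (ptgt r == j).
by rewrite lfunE /= ffunE; case: eqP => // ->; rewrite (negPf ij).
Qed.
Fact path_rone : \sum_i path_ract (inl i) = \1%VF.
Proof.
apply/lfunP => f; rewrite sum_lfunE lfunE /=; apply/ffunP => r.
rewrite sum_ffunE; under eq_bigr do rewrite path_ractE rmul_idemE.
by rewrite -big_mkcond (big_pred1 (ptgt r)).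
Qed.
Fact path_rarrow a : (path_ract (inl (tgt a)) \o path_ract (inr a) \o
  path_ract (inl (src a)))%VF = path_ract (inr a).
Proof.
apply/lfunP => f; rewrite lfunE /= lfunE /= !path_ractE; apply/ffunP => r.
rewrite rmul_idemE !ffunE; case: eqP => [_|ra].
  by apply: eq_bigr => p /and3P[tp _ _]; rewrite rmul_idemE tp.
by rewrite big1 // => p /and3P[_ _ /eqP/ptgt_rcons].
Qed.
End PathAlgebra.

(* The Auslander-Reiten translate over the hereditary algebra A = kQ:
   tau M = D Tr M = D Ext^1(M, A), a left module via the right action of A on
   itself: (x f)(phi) = f(phi x). *)
Section Translate.
Variables (k : finFieldType) (m : nat) (Q : quiver m) (M : qmod k Q).
Local Notation A := (path_mod k Q).
Local Notation dual V := 'Hom(V, k^o).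

Definition annihilator (V : vectType k) (U : {vspace V}) : {vspace dual V} :=
  lker (linfun (fun f : dual V => (f \o projv U)%VF)).
Fact annihilatorP (V : vectType k) (U : {vspace V}) (f : dual V) :
  reflect {in U, forall v, f v = 0} (f \in annihilator U).
Proof.
rewrite memv_ker linfun_ext; last first.
  by move=> c g h; rewrite comp_lfunDl -comp_lfunZl.
apply: (iffP eqP) => [/lfunP h v vU|h].
  by have := h v; rewrite !lfunE /= projv_id.
by apply/lfunP => v; rewrite !lfunE /= h // memv_proj.
Qed.

Definition postcomp (r : 'End(A)) : 'End(cochain M A) :=
  linfun (fun phi : cochain M A => [ffun a => (r \o phi a)%VF] : cochain M A).
Fact postcompE r phi a : postcomp r phi a = (r \o phi a)%VF.
Proof.
rewrite linfun_ext ?ffunE // => c f g; apply/ffunP => b; rewrite !ffunE.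
by rewrite comp_lfunDr -comp_lfunZr.
Qed.

Definition dual_act (x : gen Q) : 'End(dual (cochain M A)) :=
  linfun (fun f : dual (cochain M A) => (f \o postcomp (path_ract k x))%VF).
Fact dual_actE x f phi : dual_act x f phi = f (postcomp (path_ract k x) phi).
Proof.
rewrite linfun_ext ?comp_lfunE // => c g h.
by rewrite comp_lfunDl -comp_lfunZl.
Qed.
Fact postcomp_comp r r' phi : postcomp r (postcomp r' phi) = postcomp (r \o r')%VF phi.
Proof. by apply/ffunP => a; rewrite !postcompE comp_lfunA. Qed.
Fact dual_idem i j : (dual_act (inl i) \o dual_act (inl j))%VF =
  if i == j then dual_act (inl i) else 0.
Proof.
apply/lfunP => f; apply/lfunP => phi; rewrite comp_lfunE !dual_actE postcomp_comp path_ridem.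
rewrite eq_sym; case: (eqVneq i j) => [->|_]; first by rewrite dual_actE.
rewrite !lfunE /= -[RHS](linear0 f); congr (f _).
by apply/ffunP => a; rewrite postcompE comp_lfun0l ffunE.
Qed.
Fact dual_one : \sum_i dual_act (inl i) = \1%VF.
Proof.
apply/lfunP => f; apply/lfunP => phi; rewrite !sum_lfunE id_lfunE.
under eq_bigr do rewrite dual_actE.
rewrite -linear_sum; congr (f _); apply/ffunP => a.
rewrite sum_ffunE; under eq_bigr do rewrite postcompE.
apply/lfunP => v; rewrite sum_lfunE -[RHS]id_lfunE -path_rone sum_lfunE.
by apply: eq_bigr => i _; rewrite comp_lfunE.
Qed.
Fact dual_arrow a : (dual_act (inl (src a)) \o dual_act (inr a) \o
  dual_act (inl (tgt a)))%VF = dual_act (inr a).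
Proof.
apply/lfunP => f; apply/lfunP => phi; rewrite !comp_lfunE !dual_actE !postcomp_comp.
by rewrite path_rarrow.
Qed.
Definition dual_cochain_mod : qmod k Q := Qmod dual_idem dual_one dual_arrow.

(* Ext^1(M, A) = cocycles / coboundaries, and cochain = cocycles (+) lker trunc;
   hence its dual is the space of functionals on cochains that vanish on
   coboundaries and on lker trunc. *)
Definition tau_space : {vspace dual_cochain_mod} :=
  annihilator (coboundaries M A + lker (linfun (@trunc k m Q M A)))%VS.

Fact tau_stable : stable tau_space.
Proof.
apply/stableP => x f /annihilatorP f0; apply/annihilatorP => _ /memv_addP[u uB [v vK ->]].
rewrite dual_actE f0 // linearD memv_add //.
  move: uB => /memv_imgP[h hG ->]; rewrite !lfunE /=.
  apply/memv_imgP; exists (path_ract k x \o h)%VF; last first.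
    rewrite lfunE /=; apply/ffunP => a; rewrite postcompE !ffunE.
    by rewrite comp_lfunDr comp_lfunNr !comp_lfunA path_act_ractC.
  rewrite memvE; apply/subv_bigcapP => i _; rewrite -memvE memv_ker lfunE /=.
  have := subv_bigcapP (_ : (<[h]> <= graded_maps M A)%VS) i isT.
  rewrite -memvE => /(_ hG); rewrite -memvE memv_ker lfunE /= /commutator => /eqP h0.
  by rewrite comp_lfunA path_act_ractC -!comp_lfunA -comp_lfunNr -comp_lfunDr h0 comp_lfun0r.
move: vK; rewrite !memv_ker !lfunE /= => /eqP/ffunP tv0.
apply/eqP/ffunP => a; rewrite ffunE postcompE comp_lfunA path_act_ractC.
have := tv0 a; rewrite !ffunE -!comp_lfunA => ->.
by rewrite comp_lfun0r.
Qed.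
Definition tau : qmod k Q := sub_mod tau_stable.
End Translate.

Section ExtOfSimples.
Variables (k : finFieldType) (m : nat) (Q : quiver m).

Lemma ext_dim_simple (i j : 'I_m) :
  ext_dim (simple_mod k Q i) (simple_mod k Q j) =
  #|[set a : arrow Q | (src a == j) && (tgt a == i)]|.
Proof.
set D := finset _; set M := simple_mod k Q i; set N := simple_mod k Q j.
have B0 : coboundaries M N = 0%VS.
  apply/eqP; rewrite -subv0; apply/subvP => _ /memv_imgP[h _ ->].
  rewrite lfunE /= memv0; apply/eqP/ffunP => a.
  by rewrite !ffunE comp_lfun0l comp_lfun0r subrr.
rewrite /ext_dim B0 dimv0 subn0.
pose ext (f : {ffun {a | a \in D} -> 'Hom(M, N)}) : cochain M N :=
  [ffun a => if insub a is Some b then f b else 0].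
have extL : linear ext.
  move=> c f g; apply/ffunP => a; rewrite !ffunE.
  by case: insub => [b|]; rewrite ?ffunE ?scaler0 ?addr0.
have -> : cocycles M N = limg (linfun ext).
  apply/vspaceP => phi; apply/memv_imgP/memv_imgP => [] [f _ ->].
    exists [ffun b => f (val b)]; rewrite ?memvf // (linfun_ext extL) lfunE /=.
    apply/ffunP => a; rewrite !ffunE /=; case: insubP => [b|].
      rewrite inE ffunE => /andP[/eqP-> /eqP->] ->.
      by rewrite !eqxx comp_lfun1l comp_lfun1r.
    rewrite inE; case: (src a == j) => /=; last by rewrite !comp_lfun0l.
    by move/negPf->; rewrite comp_lfun0r.
  exists (ext f); rewrite ?memvf // (linfun_ext extL) lfunE /=.
  apply/ffunP => a; rewrite !ffunE /=; case: insubP => [b|].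
    rewrite inE => /andP[/eqP-> /eqP->] _.
    by rewrite !eqxx comp_lfun1l comp_lfun1r.
  by rewrite comp_lfun0r comp_lfun0l.
rewrite limg_dim_eq; last first.
  apply/eqP; rewrite -subv0; apply/subvP => f; rewrite memv_cap memvf memv_ker memv0.
  rewrite (linfun_ext extL) => /eqP/ffunP f0; apply/eqP/ffunP => b.
  by have := f0 (val b); rewrite !ffunE valK.
by rewrite dimvf /dim /= muln1 card_sig; apply: eq_card => a; rewrite !inE.
Qed.
End ExtOfSimples.

Section ClusterCharacter.
Variables (k : finFieldType) (s : sqrt_card k) (m n : nat) (le_nm : (n <= m)%N).
Variables (Q : quiver m) (L : 'M[int]_m).
Local Notation mod := (qmod k Q).
Implicit Types M N P : mod.

(* Vertices are numbered from 0: those of Q are the i < n, the frozen ones are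
   n <= i < m. *)
Definition vtx (j : 'I_n) : 'I_m := widen_ord le_nm j.

Definition supported M : Prop := forall i : 'I_m, (n <= i)%N -> dimv M i = 0%N.

Definition dimvec M : 'cV[int]_m := \col_i (dimv M i)%:Z.
Definition dimvecQ M : 'cV[int]_n := \col_j (dimv M (vtx j))%:Z.

Definition Bmx : 'M[int]_(m, n) :=
  \matrix_(i, j) (#|[set a : arrow Q | (src a == i) && (tgt a == vtx j)]|%:Z
                - #|[set a : arrow Q | (src a == vtx j) && (tgt a == i)]|%:Z).
Definition Rmx : 'M[int]_(m, n) :=
  \matrix_(i, j) (ext_dim (simple_mod k Q i) (simple_mod k Q (vtx j)))%:Z.
Definition Imx : 'M[int]_(m, n) := \matrix_(i, j) (i == vtx j)%:R.

Definition euler M N : int := (\dim (homs M N))%:Z - (ext_dim M N)%:Z.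
(* Bilinear extension of the Euler form to dimension vectors, by its values on the
   dimension vectors of the simple modules. *)
Definition euler_form (u v : 'cV[int]_n) : int :=
  \sum_i \sum_j
    u i 0 * v j 0 * euler (simple_mod k Q (vtx i)) (simple_mod k Q (vtx j)).

Definition Gr M (e : 'cV[int]_n) : {set {vspace M}} :=
  [set U | stable U &&
    [forall j : 'I_n, (\dim (act M (inl (vtx j)) @: U))%:Z == e j 0]].

(* X_{M (+) P[1]}.  The sum runs over the e with 0 <= e <= dim M componentwise;
   Gr M e is empty for any other e.  M is meant to be supported on Q. *)
Definition CC M P : qtorus s L :=
  \sum_(d : {dffun forall j : 'I_n, 'I_(dimv M (vtx j)).+1})
    let e := \col_j (d j)%:Z in
    (#|Gr M e|%:R * qpow s (- euler_form e (dimvecQ M - e))) *: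
      Xpow s L (Bmx *m e - (Imx - Rmx) *m dimvecQ M + dimvec (top_mod P)).

Definition CC0 M : qtorus s L := CC M (zero_mod k Q).
End ClusterCharacter.

(* Main.v *)
From HB Require Import structures.
From mathcomp Require Import all_boot all_order all_algebra all_field finmap monalg zify.
Require Import Defs.
Set Implicit Arguments. Unset Strict Implicit. Unset Printing Implicit Defensive.
Import GRing.Theory Num.Theory.
Local Open Scope ring_scope.

(* Write D Ext^1(M, Y) as the space [dext Y M] of families theta_a : Y -> M, one for
   each arrow, which the trace form puts in duality with cocycles modulo
   coboundaries.  It is left exact in both variables, and [tau M] represents
   [dext - M].

   The product X_N X_M is a sum over pairs (V, U) of submodules of N and M, the pair
   carrying the weight q^<U, N/V>.  The Grassmannian of E lies over the same set of
   pairs, its fiber over (V, U) being either empty or a torsor under Hom(U, N/V).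
   Since Ext^1(M, N) is a line, Ext^1(U, N/V) is zero or a line; in the first case
   the fiber has q^<U, N/V> elements, in the second it is empty.  The second case
   means that the element psi of [dext N M] corresponding to g vanishes on V and
   takes its values in U.  This says that V lies in D0 and that U contains the
   kernel of a surjection M -> A0: applying tau^- to N -> tau M -> tau A (+) I -> 0
   identifies A0 with the quotient of M by the submodule generated by the values of
   psi.  So these pairs are the pairs of submodules of D0 and A0, and they index the
   strata of the Grassmannian of D0 (+) A0, which are affine spaces of the right
   dimension because Ext^1(A0, D0) = 0.

   If beta and gamma are the dimension vectors of ker (M -> A0) and im g, then
   <beta, X> + <X, gamma> = - <X, I> for every X.  With X simple this identifies the
   exponents of X^e, and with Hom(A0, I) = Hom(D0, I) = 0 the powers of q. *)

(** * Trace form and annihilators *)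

(** Two gaps have to be bridged. First, the extension gives a class phi in Ext^1(M, N), while g
    gives psi in the dual of that line. If Ext^1(U, N/V) is nonzero, its dual maps injectively into
    the line of psi, hence onto it; psi pairs nontrivially with phi, so the restriction of phi to
    (V, U) is nonzero as well and the fiber is empty. Second, tau M does not see the projective
    summand P0. Reconstructing a map out of a module from its composite with the universal family
    requires that the module have no nonzero map to a projective. So the argument with tau^- is
    carried out for M' and A, and P0 is added back afterwards; psi has no component in P0 because
    Ext^1(P0, N) = 0. The relation between beta, gamma and I comes from <X, tau Y> = - <Y, X> for Y
    without projective summands, applied to Y = M' and Y = A. The weight q^<U, N/V> is the excess,
    over the corresponding term of X_E, that is left once Lambda has been evaluated by the
    compatibility condition. *)

Section Trace.
Import VectorInternalTheory.
Variable K : fieldType.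
Implicit Types U V W : vectType K.

Lemma f2mx_comp U V W (g : 'Hom(V, W)) (f : 'Hom(U, V)) :
  f2mx (g \o f)%VF = f2mx f *m f2mx g.
Proof.
suff -> : (g \o f)%VF = Hom (f2mx f *m f2mx g) by [].
apply/lfunP => v; rewrite comp_lfunE.
by rewrite !unlock /= /fun_of_lfun_def /= r2vK mulmxA.
Qed.

Lemma f2mxD U V (f g : 'Hom(U, V)) : f2mx (f + g) = f2mx f + f2mx g.
Proof.
suff -> : f + g = Hom (f2mx f + f2mx g) by [].
apply/lfunP => v; rewrite add_lfunE.
by rewrite !unlock /= /fun_of_lfun_def /= mulmxDr linearD.
Qed.

Lemma f2mxZ U V c (f : 'Hom(U, V)) : f2mx (c *: f) = c *: f2mx f.
Proof.
suff -> : c *: f = Hom (c *: f2mx f) by [].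
apply/lfunP => v; rewrite scale_lfunE.
by rewrite !unlock /= /fun_of_lfun_def /= -scalemxAr linearZ.
Qed.

Definition lfun_trace V (f : 'End(V)) : K := \tr (f2mx f).

Lemma lfun_trace_is_linear V : linear (@lfun_trace V : 'End(V) -> K^o).
Proof. by move=> c f g; rewrite /lfun_trace f2mxD f2mxZ linearP. Qed.
HB.instance Definition _ V := GRing.isLinear.Build K _ _ _ (@lfun_trace V) (@lfun_trace_is_linear V).

Lemma lfun_traceC U V (f : 'Hom(U, V)) (g : 'Hom(V, U)) : lfun_trace (f \o g)%VF = lfun_trace (g \o f)%VF.
Proof. by rewrite /lfun_trace !f2mx_comp mxtrace_mulC. Qed.

Lemma lfun_trace_nondeg U V (f : 'Hom(U, V)) : (forall g : 'Hom(V, U), lfun_trace (g \o f)%VF = 0) -> f = 0.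
Proof.
move=> f0; suff f20 : f2mx f = 0.
  by apply/lfunP => v; rewrite zero_lfunE !unlock /= /fun_of_lfun_def /= f20 mulmx0 linear0.
(* The trace against the elementary matrix [delta_mx j i] is the entry of f at i, j. *)
apply/matrixP => i j; have := f0 (Hom (delta_mx j i)).
rewrite /lfun_trace f2mx_comp /= /mxtrace (bigD1 i) //= mxE (bigD1 j) //= !mxE !eqxx mulr1.
rewrite [X in _ + X + _]big1 => [|l nl]; last by rewrite mxE (negPf nl) mulr0.
rewrite [X in _ + X]big1 ?addr0 // => l nl.
by rewrite mxE big1 // => l' _; rewrite mxE (negPf nl) andbF mulr0.
Qed.
End Trace.

Section Duality.
Variable K : fieldType.
Implicit Types U V W : vectType K.
Local Notation dual V := 'Hom(V, K^o).

Definition precomp U V W (g : 'Hom(U, V)) : 'Hom('Hom(V, W), 'Hom(U, W)) :=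
  linfun (fun f : 'Hom(V, W) => (f \o g)%VF).
Lemma precompE U V W (g : 'Hom(U, V)) (f : 'Hom(V, W)) : precomp W g f = (f \o g)%VF.
Proof. by rewrite linfun_ext // => c f1 f2; rewrite comp_lfunDl -comp_lfunZl. Qed.

Lemma dim_Hom U V : \dim {:'Hom(U, V)} = (\dim {:U} * \dim {:V})%N.
Proof. by rewrite !dimvf. Qed.

Lemma dim_subvs V (U : {vspace V}) : \dim {:subvs_of U} = \dim U.
Proof. by rewrite dimvf. Qed.

End Duality.

Section Annihilator.
Variables (k : finFieldType) (V : vectType k) (U : {vspace V}).
Local Notation dual V := 'Hom(V, k^o).

(** Restriction to the complement of U maps the annihilator isomorphically onto the dual of the
    complement; the inverse is composition with the projection v - [projv U v]. *)
Lemma dim_annihilator : \dim (annihilator U) = (\dim {:V} - \dim U)%N.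
Proof.
pose r := precomp k^o (linfun (@vsval k V (U^C)%VS)).
have vsvE x : linfun (@vsval k V (U^C)%VS) x = vsval x by rewrite lfunE.
have [pr prE] : exists pr : 'Hom(V, subvs_of (U^C)%VS), forall x, pr x = vsproj (U^C)%VS (x - projv U x).
  exists (linfun (vsproj (U^C)%VS) \o (\1 - projv U))%VF => x.
  by rewrite comp_lfunE [LHS]lfunE add_lfunE opp_lfunE id_lfunE.
rewrite -(@limg_dim_eq _ _ _ r); last first.
  apply/eqP; rewrite -subv0; apply/subvP => f /memv_capP[/annihilatorP fU].
  rewrite memv_ker memv0 precompE => /eqP/lfunP fC; apply/eqP/lfunP => v.
  rewrite -(subrK (projv U v) v) linearD /= (fU (projv U v)) ?memv_proj // addr0 !zero_lfunE.
  have := fC (vsproj _ (v - projv U v)); rewrite comp_lfunE vsvE zero_lfunE vsprojK //.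
  exact: memv_projC.
suff -> : (r @: annihilator U)%VS = fullv by rewrite dim_Hom dim_subvs dimvf muln1 dimv_compl.
apply/vspaceP => g; rewrite memvf; apply/memv_imgP; exists (g \o pr)%VF.
  by apply/annihilatorP => u uU; rewrite comp_lfunE prE projv_id // subrr !linear0.
rewrite precompE; apply/lfunP => x; rewrite !comp_lfunE vsvE prE; congr (g _).
suff -> : projv U (vsval x) = 0 by rewrite subr0 vsvalK.
by apply/eqP; rewrite -memv_ker lker_proj subvsP.
Qed.
End Annihilator.

(** Otherwise U + <v> would be strictly larger than U with the same annihilator, against the
    dimension count. *)
Lemma annihilator_perp (k : finFieldType) (V : vectType k) (U : {vspace V}) v :
  (forall f, f \in annihilator U -> f v = 0) -> v \in U.
Proof.
move=> h; have sUv : (annihilator U <= annihilator (U + <[v]>))%VS.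
  apply/subvP => f fU; apply/annihilatorP => _ /memv_addP[u uU [_ /vlineP[c ->] ->]].
  by rewrite linearD linearZ /= h // scaler0 (annihilatorP _ _ fU) // addr0.
have := dimvS sUv; rewrite !dim_annihilator.
have le1 := dimvS (subvf U); have le2 := dimvS (subvf (U + <[v]>)%VS).
rewrite leq_sub2lE // => le3.
have : (U + <[v]> == U)%VS by rewrite eq_sym eqEdim addvSl le3.
by move/eqP => <-; rewrite memvE addvSr.
Qed.

Lemma comp_lfun_suml (K : fieldType) (U V W : vectType K) (I : finType)
  (f : I -> 'Hom(V, W)) (g : 'Hom(U, V)) :
  ((\sum_i f i) \o g = \sum_i (f i \o g))%VF.
Proof. exact: (big_morph (fun f => f \o g)%VF (fun f1 f2 => comp_lfunDl f1 f2 g) (comp_lfun0l _ g)). Qed.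

Lemma comp_lfun_sumr (K : fieldType) (U V W : vectType K) (I : finType)
  (f : 'Hom(V, W)) (g : I -> 'Hom(U, V)) :
  (f \o (\sum_i g i) = \sum_i (f \o g i))%VF.
Proof. exact: (big_morph (fun g => f \o g)%VF (comp_lfunDr f) (comp_lfun0r _ f)). Qed.

(** * A model of the dual of Ext^1 *)

Section Basics.
Variables (k : finFieldType) (m : nat) (Q : quiver m).
Local Notation mod := (qmod k Q).
Implicit Types (M N Y Z : mod).

Lemma act_ii M i j v :
  act M (inl i) (act M (inl j) v) = if i == j then act M (inl i) v else 0.
Proof. by rewrite -comp_lfunE act_idem; case: eqP => _ //; rewrite zero_lfunE. Qed.
Lemma act_sum M v : \sum_i act M (inl i) v = v.
Proof. by rewrite -[RHS](id_lfunE) -act_one sum_lfunE. Qed.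
Lemma act_la M (a : arrow Q) i v :
  act M (inl i) (act M (inr a) v) = if i == src a then act M (inr a) v else 0.
Proof.
by rewrite -[in LHS](act_arrow M a) !comp_lfunE act_ii; case: eqP => // ->;
   rewrite -[in RHS](act_arrow M a) !comp_lfunE.
Qed.
Lemma act_ar M (a : arrow Q) i v :
  act M (inr a) (act M (inl i) v) = if i == tgt a then act M (inr a) v else 0.
Proof.
rewrite -[in LHS](act_arrow M a) !comp_lfunE act_ii eq_sym; case: eqP => [_|]; last by rewrite !linear0.
by rewrite -[in RHS](act_arrow M a) !comp_lfunE.
Qed.

Lemma graded_mapsP M N (h : 'Hom(M, N)) :
  reflect (forall i v, h (act M (inl i) v) = act N (inl i) (h v)) (h \in graded_maps M N).
Proof.
apply: (iffP idP) => [hG i v|hG].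
  have /subv_bigcapP/(_ i isT) : (<[h]> <= graded_maps M N)%VS by [].
  rewrite -memvE memv_ker lfunE /= => /eqP/lfunP/(_ v).
  by rewrite zero_lfunE add_lfunE opp_lfunE !comp_lfunE => /eqP; rewrite subr_eq0 => /eqP.
rewrite memvE; apply/subv_bigcapP => i _; rewrite -memvE memv_ker lfunE /=.
apply/eqP/lfunP => v; rewrite add_lfunE opp_lfunE zero_lfunE !comp_lfunE.
by apply/eqP; rewrite subr_eq0 hG.
Qed.

Lemma is_hom_graded M N (h : 'Hom(M, N)) : is_hom h -> h \in graded_maps M N.
Proof. by move/is_homP => hP; apply/graded_mapsP. Qed.

Lemma is_hom_comp M N Y (g : 'Hom(N, Y)) (f : 'Hom(M, N)) :
  is_hom g -> is_hom f -> is_hom (g \o f)%VF.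
Proof. by move=> /is_homP gP /is_homP fP; apply/is_homP => x v; rewrite !comp_lfunE fP gP. Qed.

Lemma is_hom_id M : is_hom (\1%VF : 'Hom(M, M)).
Proof. by apply/is_homP => x v; rewrite !id_lfunE. Qed.

Lemma truncE M N (phi : cochain M N) a v :
  trunc phi a v = act N (inl (src a)) (phi a (act M (inl (tgt a)) v)).
Proof. by rewrite ffunE !comp_lfunE. Qed.

Lemma trunc_idem M N (phi : cochain M N) : trunc (trunc phi) = trunc phi.
Proof. by apply/ffunP => a; apply/lfunP => v; rewrite !truncE !act_ii !eqxx. Qed.

Lemma coboundaryE M N (h : 'Hom(M, N)) a v :
  coboundary h a v = act N (inr a) (h v) - h (act M (inr a) v).
Proof. by rewrite ffunE add_lfunE opp_lfunE !comp_lfunE. Qed.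

Lemma cocyclesP M N (phi : cochain M N) : reflect (trunc phi = phi) (phi \in cocycles M N).
Proof.
apply: (iffP idP) => [/memv_imgP[psi _ ->]|<-].
  by rewrite lfunE /= trunc_idem.
by apply/memv_imgP; exists phi; rewrite ?memvf // lfunE.
Qed.

Lemma coboundariesP M N (phi : cochain M N) :
  reflect (exists2 h, h \in graded_maps M N & phi = coboundary h) (phi \in coboundaries M N).
Proof.
apply: (iffP idP) => [/memv_imgP[h hG ->]|[h hG ->]]; first by exists h; rewrite ?lfunE.
by apply/memv_imgP; exists h; rewrite ?lfunE.
Qed.

Lemma coboundary_cocycle M N : (coboundaries M N <= cocycles M N)%VS.
Proof.
apply/subvP => phi /coboundariesP[h /graded_mapsP hG ->]; apply/cocyclesP.
apply/ffunP => a; apply/lfunP => v; rewrite truncE !coboundaryE linearB /= !act_la act_ar !eqxx.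
by rewrite hG act_ar -hG act_la !eqxx.
Qed.

Definition pairing Y M (theta : cochain Y M) (phi : cochain M Y) : k :=
  \sum_a lfun_trace (theta a \o phi a)%VF.

Lemma pairing_linear_r Y M (theta : cochain Y M) : linear (pairing theta : _ -> k^o).
Proof.
move=> c f g; rewrite /pairing scaler_sumr -big_split; apply: eq_bigr => a _ /=.
by rewrite !ffunE comp_lfunDr -comp_lfunZr linearP.
Qed.
HB.instance Definition _ Y M theta := GRing.isLinear.Build k _ _ _ _ (@pairing_linear_r Y M theta).

Definition pairing_functional Y M (theta : cochain Y M) : 'Hom(cochain M Y, k^o) :=
  linfun (pairing theta : _ -> k^o).
Lemma pairing_functional_linear Y M : linear (@pairing_functional Y M).
Proof.
move=> c f g; apply/lfunP => phi; rewrite add_lfunE scale_lfunE !lfunE /= /pairing scaler_sumr -big_split.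
apply: eq_bigr => a _ /=.
by rewrite !ffunE comp_lfunDl -comp_lfunZl linearP.
Qed.
HB.instance Definition _ Y M := GRing.isLinear.Build k _ _ _ _ (@pairing_functional_linear Y M).

Definition pairmap Y M : 'Hom(cochain Y M, 'Hom(cochain M Y, k^o)) := linfun (@pairing_functional Y M).

Lemma pairmapE Y M theta phi : pairmap Y M theta phi = pairing theta phi.
Proof. by rewrite /pairmap lfunE /= lfunE. Qed.

Lemma pairing_nondeg Y M (theta : cochain Y M) : (forall phi, pairing theta phi = 0) -> theta = 0.
Proof.
move=> h; apply/ffunP => a; rewrite ffunE; apply: lfun_trace_nondeg => g.
have := h [ffun b => if b == a then g else 0].
rewrite /pairing (bigD1 a) //= ffunE eqxx big1 ?addr0 => [<-|b ba].
  exact: lfun_traceC.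
by rewrite ffunE (negPf ba) comp_lfun0r linear0.
Qed.

Lemma pairmap_ker0 Y M : lker (pairmap Y M) == 0%VS.
Proof.
rewrite -subv0; apply/subvP => theta; rewrite memv_ker memv0 => /eqP/lfunP h.
by apply/eqP/pairing_nondeg => phi; rewrite -pairmapE h zero_lfunE.
Qed.

Lemma dim_cochain Y M : \dim {:cochain Y M} = (#|arrow Q| * (\dim {:Y} * \dim {:M}))%N.
Proof. by rewrite !dimvf. Qed.

Lemma pairmap_full Y M : limg (pairmap Y M) = fullv.
Proof.
apply/eqP; rewrite eqEdim subvf limg_dim_eq; last by rewrite (eqP (pairmap_ker0 Y M)) capv0.
by rewrite dim_Hom !dim_cochain [\dim {:k^o}]dimvf muln1 [(\dim {:Y} * _)%N]mulnC /=.
Qed.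

(** Taking the annihilator of the coboundaries and of the kernel of [trunc] makes this dual to
    Ext^1(M, Y) by construction; [dextP] turns membership into equations on theta. The argument
    order is that of the maps theta_a, opposite to that of Ext^1. *)
Definition dext Y M : {vspace cochain Y M} :=
  (pairmap Y M @^-1: annihilator (coboundaries M Y + lker (linfun (@trunc k m Q M Y))))%VS.

Lemma dim_dext Y M : \dim (dext Y M) = ext_dim M Y.
Proof.
have -> : \dim (dext Y M) = \dim (pairmap Y M @: dext Y M).
  by rewrite limg_dim_eq // (eqP (pairmap_ker0 Y M)) capv0.
rewrite lpreimK ?pairmap_full ?subvf // dim_annihilator /ext_dim.
have tE phi : linfun (@trunc k m Q M Y) phi = trunc phi by rewrite lfunE.
rewrite dimv_disjoint_sum; last first.
  apply/eqP; rewrite -subv0; apply/subvP => phi /memv_capP[/(subvP (@coboundary_cocycle M Y))/cocyclesP <-].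
  by rewrite memv_ker tE trunc_idem memv0.
have := limg_ker_dim (linfun (@trunc k m Q M Y)) fullv; rewrite capfv -/(cocycles M Y) => <-.
by rewrite [(\dim (coboundaries _ _) + _)%N]addnC subnDl.
Qed.

(** The adjoint of [coboundary] under the trace form. For Y = M, its vanishing is the defining
    relation of the preprojective algebra. *)
Definition dcob Y M (theta : cochain Y M) : 'Hom(Y, M) :=
  \sum_a ((theta a \o act Y (inr a)) - (act M (inr a) \o theta a))%VF.

Lemma pairing_coboundary Y M (theta : cochain Y M) h :
  pairing theta (coboundary h) = lfun_trace (dcob theta \o h)%VF.
Proof.
rewrite /pairing /dcob comp_lfun_suml linear_sum; apply: eq_bigr => a _ /=.
rewrite ffunE comp_lfunDl comp_lfunDr comp_lfunNl comp_lfunNr !linearB /= !comp_lfunA; congr (_ - _).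
by rewrite [LHS]lfun_traceC comp_lfunA.
Qed.

Lemma pairing_trunc Y M (theta : cochain Y M) phi :
  pairing theta (trunc phi) =
  pairing [ffun a => (act M (inl (tgt a)) \o theta a \o act Y (inl (src a)))%VF] phi.
Proof.
apply: eq_bigr => a _; rewrite !ffunE.
by rewrite -!comp_lfunA [RHS]lfun_traceC -!comp_lfunA.
Qed.

Definition truncated Y M (theta : cochain Y M) : Prop :=
  forall a, (act M (inl (tgt a)) \o theta a \o act Y (inl (src a)))%VF = theta a.

Lemma truncated_l Y M (theta : cochain Y M) a i v : truncated theta ->
  act M (inl i) (theta a v) = if i == tgt a then theta a v else 0.
Proof.
move/(_ a) => h; rewrite -[in LHS]h !comp_lfunE act_ii; case: eqP => // ->.
by rewrite -[in RHS]h !comp_lfunE.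
Qed.
Lemma truncated_r Y M (theta : cochain Y M) a i v : truncated theta ->
  theta a (act Y (inl i) v) = if i == src a then theta a v else 0.
Proof.
move/(_ a) => h; rewrite -[in LHS]h !comp_lfunE act_ii eq_sym; case: eqP => _; last by rewrite !linear0.
by rewrite -[in RHS]h !comp_lfunE.
Qed.

Lemma dcob_graded Y M (theta : cochain Y M) i v : truncated theta ->
  dcob theta (act Y (inl i) v) = act M (inl i) (dcob theta v).
Proof.
move=> tr; rewrite !sum_lfunE linear_sum; apply: eq_bigr => a _ /=.
rewrite !add_lfunE !opp_lfunE !comp_lfunE linearB /= act_ar truncated_r // truncated_l // act_la.
by do 2!case: eqP => _; rewrite ?linear0.
Qed.

Lemma dextP Y M (theta : cochain Y M) :
  reflect (truncated theta /\ dcob theta = 0) (theta \in dext Y M).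
Proof.
apply: (iffP idP) => [|[tr0 d0]]; rewrite -memv_preim; last first.
  apply/annihilatorP => x /memv_addP[c /coboundariesP[h hG cE] [v]].
  rewrite memv_ker lfunE /= => /eqP tv ->; rewrite {x c}cE.
  rewrite pairmapE linearD /= pairing_coboundary d0 comp_lfun0l linear0 add0r.
  have -> : theta = [ffun a => (act M (inl (tgt a)) \o theta a \o act Y (inl (src a)))%VF].
    by apply/ffunP => a; rewrite ffunE tr0.
  by rewrite -pairing_trunc tv linear0.
move/annihilatorP => h0.
have tr0 : truncated theta.
  set th' := [ffun a => (act M (inl (tgt a)) \o theta a \o act Y (inl (src a)))%VF] : cochain Y M.
  suff /eqP : theta - th' = 0 by rewrite subr_eq0 => /eqP E a; rewrite {2}E ffunE.
  apply: pairing_nondeg => phi; rewrite -pairmapE linearB add_lfunE opp_lfunE !pairmapE -pairing_trunc.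
  have kT : phi - trunc phi \in (coboundaries M Y + lker (linfun (@trunc k m Q M Y)))%VS.
    apply: (subvP (addvSr _ _)); rewrite memv_ker lfunE /=.
    rewrite (raddfB (@trunc k m Q M Y)) /= trunc_idem subrr; exact: eqxx.
  rewrite -[RHS](h0 _ kT) pairmapE (raddfB (pairing theta)); reflexivity.
split=> //; apply: lfun_trace_nondeg => h.
(* Only graded maps give coboundaries, so an arbitrary test map h is replaced by its graded part h'.
   Since [dcob theta] is graded, its trace against h and against h' is the same. *)
pose h' := \sum_i (act Y (inl i) \o h \o act M (inl i))%VF.
have h'G : h' \in graded_maps M Y.
  apply/graded_mapsP => i v; rewrite /h' !sum_lfunE linear_sum; apply: eq_bigr => j _.
  by rewrite /= !comp_lfunE !act_ii [i == j]eq_sym; case: eqP => [->|_]; rewrite ?linear0.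
have := h0 (coboundary h'); rewrite pairmapE pairing_coboundary -[coboundary _]addr0 memv_add ?mem0v //; last first.
  by apply/coboundariesP; exists h'.
have E : dcob theta = \sum_i (act M (inl i) \o dcob theta \o act Y (inl i))%VF.
  apply/lfunP => v; rewrite sum_lfunE -[LHS]act_sum; apply: eq_bigr => i _.
  by rewrite !comp_lfunE dcob_graded // act_ii eqxx.
move=> <- //; rewrite lfun_traceC {1}E comp_lfun_suml comp_lfun_sumr !linear_sum; apply: eq_bigr => i _ /=.
by rewrite -!comp_lfunA [LHS]lfun_traceC -!comp_lfunA.
Qed.

(** By the double annihilator, phi is a coboundary plus an element of the kernel of [trunc], because
    every functional is a pairing with some theta. Applying [trunc] removes the second summand. *)
Lemma coboundary_perp M Y (phi : cochain M Y) : phi \in cocycles M Y ->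
  (forall theta, theta \in dext Y M -> pairing theta phi = 0) -> phi \in coboundaries M Y.
Proof.
move=> /cocyclesP pc h.
have /memv_addP[c cB [v]] : phi \in (coboundaries M Y + lker (linfun (@trunc k m Q M Y)))%VS.
  apply: annihilator_perp => f fA; have /memv_imgP[theta _ fE] : f \in limg (pairmap Y M).
    by rewrite pairmap_full memvf.
  by rewrite fE pairmapE h // -memv_preim -fE.
rewrite memv_ker lfunE /= => /eqP tv E; suff -> : phi = c by [].
have /cocyclesP cc := subvP (@coboundary_cocycle M Y) _ cB.
by rewrite -pc E linearD /= tv addr0 cc.
Qed.

Lemma pairing_dext M Y theta h : theta \in dext Y M -> pairing theta (coboundary h) = 0.
Proof. by move=> /dextP[_ d0]; rewrite pairing_coboundary d0 comp_lfun0l linear0. Qed.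
End Basics.

(** * The Euler form *)

Lemma dim_orthogonal_idempotents (K : fieldType) (V : vectType K) (I : finType) (e : I -> 'End(V)) :
  (forall a b v, e a (e b v) = if a == b then e a v else 0) ->
  \dim (limg (\sum_a e a)) = (\sum_a \dim (limg (e a)))%N.
Proof.
move=> eP; have -> : limg (\sum_a e a) = (\sum_a limg (e a))%VS.
  apply/eqP; rewrite eqEsubv; apply/andP; split.
    apply/subvP => _ /memv_imgP[v _ ->]; rewrite sum_lfunE.
    by apply: memv_sumr => a _; apply: memv_img; apply: memvf.
  apply/subv_sumP => a _; apply/subvP => _ /memv_imgP[v _ ->].
  apply/memv_imgP; exists (e a v); rewrite ?memvf // sum_lfunE (bigD1 a) //= eP eqxx.
  by rewrite big1 ?addr0 // => b ba; rewrite eP (negPf ba).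
suff /directvP -> : directv (\sum_a limg (e a)) by [].
apply/directv_sum_independent => us us_in s0 a _.
have /memv_imgP[v _ uE] := us_in a isT.
have := congr1 (e a) s0; rewrite linear0 linear_sum (bigD1 a) //= big1 ?addr0 => [|b ba].
  by rewrite {1}uE eP eqxx -uE.
by have /memv_imgP[w _ ->] := us_in b isT; rewrite eP eq_sym (negPf ba).
Qed.

Section Euler.
Variables (k : finFieldType) (m : nat) (Q : quiver m).
Local Notation mod := (qmod k Q).
Implicit Types (M N Y Z : mod).

Definition block M N (i j : 'I_m) : 'End('Hom(M, N)) :=
  linfun (fun f : 'Hom(M, N) => (act N (inl i) \o f \o act M (inl j))%VF).
Lemma blockE M N i j (f : 'Hom(M, N)) : block M N i j f = (act N (inl i) \o f \o act M (inl j))%VF.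
Proof.
by rewrite linfun_ext // => c f1 f2; rewrite comp_lfunDr comp_lfunDl -comp_lfunZr -comp_lfunZl.
Qed.

Lemma block_block M N i j i' j' (f : 'Hom(M, N)) :
  block M N i j (block M N i' j' f) = if (i == i') && (j == j') then block M N i j f else 0.
Proof.
apply/lfunP => v; rewrite !blockE !comp_lfunE !act_ii [j == j']eq_sym.
case: (i == i') => /=; last by rewrite zero_lfunE.
by case: eqP => [->|_]; rewrite ?blockE ?comp_lfunE // zero_lfunE !linear0.
Qed.

Lemma dim_block M N i j : \dim (limg (block M N i j)) = (dimv M j * dimv N i)%N.
Proof.
pose U := limg (act M (inl j)); pose W := limg (act N (inl i)).
have [inW inWE] : exists f : 'Hom(subvs_of W, N), forall x, f x = vsval x.
  by exists (linfun (@vsval k N W)) => x; rewrite lfunE.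
have [prU prUE] : exists f : 'Hom(M, subvs_of U), forall x, f x = vsproj U (act M (inl j) x).
  by exists (linfun (vsproj U) \o act M (inl j))%VF => x; rewrite comp_lfunE [LHS]lfunE.
have [F FE] : exists F : 'Hom('Hom(subvs_of U, subvs_of W), 'Hom(M, N)), forall f v, F f v = inW (f (prU v)).
  exists (linfun (fun f => inW \o f \o prU)%VF) => f v.
  rewrite linfun_ext ?comp_lfunE // => c f1 f2.
  by rewrite comp_lfunDr comp_lfunDl -comp_lfunZr -comp_lfunZl.
have prU_val x : prU (vsval x) = x.
  apply/val_inj; have /memv_imgP[y _ xE] := subvsP x.
  by rewrite prUE /= vsprojK ?memv_img ?memvf // xE act_ii eqxx.
have e_inW x : act N (inl i) (inW x) = inW x.
  by rewrite inWE; have /memv_imgP[y _ ->] := subvsP x; rewrite act_ii eqxx.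
have -> : limg (block M N i j) = limg F.
  apply/vspaceP => f; apply/memv_imgP/memv_imgP => [] [h _ ->].
    exists (linfun (vsproj W) \o (act N (inl i) \o h) \o linfun (@vsval k M U))%VF; first exact: memvf.
    apply/lfunP => v; rewrite blockE FE !comp_lfunE !inWE [in RHS]lfunE /= vsprojK ?memv_img ?memvf //.
    by rewrite [in RHS]lfunE /= prUE vsprojK ?memv_img ?memvf.
  exists (F h); rewrite ?memvf //; apply/lfunP => v.
  by rewrite blockE !comp_lfunE !FE e_inW !prUE act_ii eqxx.
rewrite limg_dim_eq ?dim_Hom ?dim_subvs //; apply/eqP; rewrite -subv0; apply/subvP => f.
rewrite capfv memv_ker memv0 => /eqP/lfunP F0; apply/eqP/lfunP => x; rewrite zero_lfunE.
by apply/val_inj; have := F0 (vsval x); rewrite FE prU_val inWE zero_lfunE.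
Qed.

Lemma dim_graded_maps M N : \dim (graded_maps M N) = (\sum_i dimv M i * dimv N i)%N.
Proof.
rewrite -(eq_bigr _ (fun i _ => dim_block M N i i)) -dim_orthogonal_idempotents; last first.
  by move=> i j f; rewrite block_block; case: eqP.
congr (\dim _); apply/vspaceP => h; apply/graded_mapsP/memv_imgP => [hG|[f _ ->] i v].
  exists h; rewrite ?memvf //; apply/lfunP => v; rewrite !sum_lfunE -[v in LHS](act_sum v) linear_sum.
  by apply: eq_bigr => i _; rewrite /= blockE !comp_lfunE -hG act_ii eqxx.
rewrite !sum_lfunE linear_sum; apply: eq_bigr => j _ /=.
by rewrite blockE !comp_lfunE !act_ii [i == j]eq_sym; case: eqP => [->|_]; rewrite ?linear0.
Qed.

Lemma dim_cocycles M N : \dim (cocycles M N) = (\sum_(a : arrow Q) dimv M (tgt a) * dimv N (src a))%N.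
Proof.
(* [e a] truncates the component at a and discards the others, so [trunc] is the sum of these
   orthogonal idempotents. *)
have [e eE] : exists e : arrow Q -> 'End(cochain M N), forall a phi b,
    e a phi b = if a == b then block M N (src a) (tgt a) (phi a) else 0.
  exists (fun a => linfun (fun phi : cochain M N =>
    [ffun b => if a == b then block M N (src a) (tgt a) (phi a) else 0] : cochain M N)).
  move=> a phi b; rewrite linfun_ext ?ffunE // => c f g; apply/ffunP => b'; rewrite !ffunE.
  by case: eqP => _; rewrite ?linearP // scaler0 addr0.
have tE : linfun (@trunc k m Q M N) = \sum_a e a.
  apply/lfunP => phi; rewrite lfunE sum_lfunE; apply/ffunP => b.
  rewrite ffunE sum_ffunE (bigD1 b) //= eE eqxx big1 ?addr0 => [|a ab]; last by rewrite eE (negPf ab).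
  by rewrite blockE.
rewrite /cocycles tE dim_orthogonal_idempotents; last first.
  move=> a b phi; apply/ffunP => c; rewrite eE eE [b == a]eq_sym.
  case: (eqVneq a b) => [<-|_]; first by rewrite eE block_block !eqxx.
  by rewrite linear0 if_same ffunE.
apply: eq_bigr => a _; rewrite -dim_block.
have [J JE] : exists J : 'Hom('Hom(M, N), cochain M N), forall f b, J f b = if a == b then f else 0.
  exists (linfun (fun f : 'Hom(M, N) => [ffun b => if a == b then f else 0] : cochain M N)) => f b.
  rewrite linfun_ext ?ffunE // => c f1 f2; apply/ffunP => b'; rewrite !ffunE.
  by case: eqP => _ //; rewrite scaler0 addr0.
have -> : limg (e a) = (J @: limg (block M N (src a) (tgt a)))%VS.
  apply/vspaceP => phi; apply/memv_imgP/memv_imgP => [[psi _ ->]|[_ /memv_imgP[f _ ->] ->]].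
    exists (block M N (src a) (tgt a) (psi a)); first by rewrite memv_img ?memvf.
    by apply/ffunP => b; rewrite JE eE.
  exists (J f); rewrite ?memvf //; apply/ffunP => b; rewrite JE eE JE eqxx //.
rewrite (@limg_dim_eq _ _ _ J) //; apply/eqP; rewrite -subv0; apply/subvP => f /memv_capP[_].
by rewrite memv_ker memv0 => /eqP/ffunP/(_ a); rewrite JE eqxx ffunE => ->.
Qed.

(** The map [coboundary] on graded maps has kernel Hom(M, N) and cokernel Ext^1(M, N) inside the
    cocycles, so the alternating count needs only the dimensions of graded maps and of cocycles. *)
Lemma euler_dims M N : euler M N =
  \sum_i (dimv M i)%:Z * (dimv N i)%:Z - \sum_(a : arrow Q) (dimv M (tgt a))%:Z * (dimv N (src a))%:Z.
Proof.
have h1 := limg_ker_dim (linfun (@coboundary k m Q M N)) (graded_maps M N).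
have hh : (graded_maps M N :&: lker (linfun (@coboundary k m Q M N)))%VS = homs M N.
  apply/vspaceP => h; rewrite memv_cap memv_ker lfunE /=; apply/andP/idP => [[/graded_mapsP hG /eqP/ffunP c0]|hH].
    apply/is_homP => [[i|a]] v; first exact: hG.
    have := c0 a => /lfunP/(_ v); rewrite coboundaryE ffunE zero_lfunE => /eqP.
    by rewrite subr_eq0 => /eqP.
  split; first exact: is_hom_graded.
  apply/eqP/ffunP => a; apply/lfunP => v; rewrite coboundaryE ffunE zero_lfunE.
  by rewrite (is_homP _ hH) subrr.
have h2 := dimvS (@coboundary_cocycle k m Q M N).
move: h1; rewrite hh -/(coboundaries M N) dim_graded_maps => h1.
have sumE (I : finType) (F G : I -> nat) : \sum_i (F i)%:Z * (G i)%:Z = (\sum_i F i * G i)%N%:Z.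
  by rewrite (big_morph Posz PoszD (erefl _)); apply: eq_bigr => i _; rewrite PoszM.
rewrite /euler /ext_dim -subzn // dim_cocycles !sumE -h1 PoszD.
by rewrite opprB addrA -addrA addrA.
Qed.
End Euler.

(** * Lifting, projectives and injectives *)

Section Functoriality.
Variables (k : finFieldType) (m : nat) (Q : quiver m).
Local Notation mod := (qmod k Q).
Implicit Types (C M N X Y Z : mod).

Lemma limg_fullP (K : fieldType) (U V : vectType K) (f : 'Hom(U, V)) :
  limg f = fullv -> forall v, exists u, v = f u.
Proof.
move=> fS v; have /memv_imgP[u _ ->] : v \in limg f by rewrite fS memvf.
by exists u.
Qed.

Lemma lker0_inj (K : fieldType) (U V : vectType K) (f : 'Hom(U, V)) :
  lker f = 0%VS -> injective f.
Proof. by move=> f0; apply/lker0P; rewrite f0. Qed.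

Lemma limg_full (K : fieldType) (U V : vectType K) (f : 'Hom(U, V)) :
  (forall v, exists u, v = f u) -> limg f = fullv.
Proof.
by move=> fS; apply/vspaceP => v; rewrite memvf; have [u ->] := fS v; rewrite memv_img ?memvf.
Qed.

Lemma lker0_eq (K : fieldType) (U V : vectType K) (f : 'Hom(U, V)) :
  (forall u, f u = 0 -> u = 0) -> lker f = 0%VS.
Proof.
move=> f0; apply/eqP; rewrite -subv0; apply/subvP => u; rewrite memv_ker memv0.
by move/eqP/f0 ->.
Qed.

Definition dmap Y M Y' M' (f : 'Hom(M, M')) (g : 'Hom(Y', Y)) (theta : cochain Y M) :
  cochain Y' M' := [ffun a => (f \o theta a \o g)%VF].

Lemma dmapE Y M Y' M' (f : 'Hom(M, M')) (g : 'Hom(Y', Y)) theta a v :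
  dmap f g theta a v = f (theta a (g v)).
Proof. by rewrite ffunE !comp_lfunE. Qed.

Lemma dcobE Y M (theta : cochain Y M) v :
  dcob theta v = \sum_a (theta a (act Y (inr a) v) - act M (inr a) (theta a v)).
Proof. by rewrite sum_lfunE; apply: eq_bigr => a _; rewrite add_lfunE opp_lfunE !comp_lfunE. Qed.

Lemma dcob_dmap Y M Y' M' (f : 'Hom(M, M')) (g : 'Hom(Y', Y)) theta v :
  is_hom f -> is_hom g -> dcob (dmap f g theta) v = f (dcob theta (g v)).
Proof.
move=> /is_homP fP /is_homP gP; rewrite !dcobE linear_sum; apply: eq_bigr => a _ /=.
by rewrite !dmapE linearB /= gP fP.
Qed.

Lemma dmap_dext Y M Y' M' (f : 'Hom(M, M')) (g : 'Hom(Y', Y)) theta :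
  is_hom f -> is_hom g -> theta \in dext Y M -> dmap f g theta \in dext Y' M'.
Proof.
move=> fH gH /dextP[tr0 d0]; apply/dextP; split.
  move=> a; apply/lfunP => v; rewrite !comp_lfunE !dmapE (is_homP _ gH) -(is_homP _ fH).
  by rewrite truncated_l // truncated_r // !eqxx.
by apply/lfunP => v; rewrite dcob_dmap // d0 !zero_lfunE linear0.
Qed.

(** An injective f on the left and a surjective g on the right cancel from both equations defining
    [dext]. This is how a family that factors through a subquotient is recognized as an element of
    [dext] there. *)
Lemma dmap_dextI Y M Y' M' (f : 'Hom(M, M')) (g : 'Hom(Y', Y)) theta :
  is_hom f -> is_hom g -> lker f = 0%VS -> limg g = fullv ->
  dmap f g theta \in dext Y' M' -> theta \in dext Y M.
Proof.
move=> fH gH /lker0_inj fI /limg_fullP gS /dextP[tr0 d0]; apply/dextP; split.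
  move=> a; apply/lfunP => v; have [w ->] := gS v; apply: fI.
  have := tr0 a => /lfunP/(_ w); rewrite !comp_lfunE !dmapE.
  by rewrite (is_homP _ gH) -(is_homP _ fH).
apply/lfunP => v; have [w ->] := gS v; apply: fI.
by rewrite -dcob_dmap // d0 !zero_lfunE linear0.
Qed.

Lemma dmap_inj Y M Y' M' (f : 'Hom(M, M')) (g : 'Hom(Y', Y)) :
  lker f = 0%VS -> limg g = fullv -> injective (@dmap Y M Y' M' f g).
Proof.
move=> /lker0_inj fI /limg_fullP gS th1 th2 /ffunP E; apply/ffunP => a; apply/lfunP => v.
have [w ->] := gS v; apply: fI; rewrite -!dmapE.
by have := E a => /lfunP/(_ w).
Qed.

Lemma dmap_linear Y M Y' M' (f : 'Hom(M, M')) (g : 'Hom(Y', Y)) :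
  linear (@dmap Y M Y' M' f g).
Proof.
move=> c t1 t2; apply/ffunP => a; rewrite !ffunE.
by rewrite comp_lfunDr comp_lfunDl -comp_lfunZr -comp_lfunZl.
Qed.
HB.instance Definition _ Y M Y' M' f g := GRing.isLinear.Build k _ _ _ _ (@dmap_linear Y M Y' M' f g).

Lemma dmap0 Y M Y' M' (f : 'Hom(M, M')) (g : 'Hom(Y', Y)) : dmap f g (0 : cochain Y M) = 0.
Proof. by apply/ffunP => a; rewrite !ffunE comp_lfun0r comp_lfun0l. Qed.

(** Over a hereditary algebra Ext^1 is right exact, so it cannot grow when M' is replaced by a
    submodule and Y' by a quotient; dually, [dmap f g] is injective. *)
Lemma ext_dim_leq Y M Y' M' (f : 'Hom(M, M')) (g : 'Hom(Y', Y)) :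
  is_hom f -> is_hom g -> lker f = 0%VS -> limg g = fullv ->
  (ext_dim M Y <= ext_dim M' Y')%N.
Proof.
move=> fH gH f0 gS; rewrite -!dim_dext -(@limg_dim_eq _ _ _ (linfun (dmap f g))); last first.
  apply/eqP; rewrite -subv0; apply/subvP => th /memv_capP[_]; rewrite memv_ker lfunE /= memv0.
  by move/eqP => E; apply/eqP/(dmap_inj f0 gS); rewrite E dmap0.
apply: dimvS; apply/subvP => _ /memv_imgP[th thD ->]; rewrite lfunE /=.
exact: dmap_dext.
Qed.

Lemma ext_dim0P M Y : reflect (dext Y M = 0%VS) (ext_dim M Y == 0%N).
Proof. by rewrite -dim_dext dimv_eq0; apply: eqP. Qed.

Lemma stable_lker M N (f : 'Hom(M, N)) : is_hom f -> stable (lker f).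
Proof.
move=> /is_homP fH; apply/stableP => x v; rewrite !memv_ker fH => /eqP->.
by rewrite linear0.
Qed.

Lemma stable_limg M N (f : 'Hom(M, N)) (U : {vspace M}) : is_hom f -> stable U -> stable (f @: U)%VS.
Proof.
move=> /is_homP fH /stableP US; apply/stableP => x _ /memv_imgP[v vU ->].
by rewrite -fH memv_img // US.
Qed.

Lemma stable_preim M N (f : 'Hom(M, N)) (U : {vspace N}) : is_hom f -> stable U -> stable (f @^-1: U)%VS.
Proof.
move=> /is_homP fH /stableP US; apply/stableP => x v; rewrite -!memv_preim fH.
exact: US.
Qed.

Lemma stable_full M : stable (fullv : {vspace M}).
Proof. by apply/stableP => x v _; apply: memvf. Qed.

Section SubQuo.
Variables (M : mod) (U : {vspace M}) (US : stable U).

Definition incl : 'Hom(sub_mod US, M) := linfun (@vsval k M U).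
Lemma inclE v : incl v = vsval v. Proof. by rewrite lfunE. Qed.
Lemma incl_hom : is_hom incl.
Proof. by apply/is_homP => x v; rewrite !inclE sub_actE. Qed.
Lemma incl_inj : lker incl = 0%VS.
Proof. by apply: lker0_eq => u; rewrite inclE => u0; apply/val_inj. Qed.
Lemma limg_incl : limg incl = U.
Proof.
apply/vspaceP => v; apply/memv_imgP/idP => [[u _ ->]|vU]; first by rewrite inclE subvsP.
by exists (vsproj U v); rewrite ?memvf // inclE vsprojK.
Qed.

Lemma incl_mem v : incl v \in U.
Proof. by rewrite inclE subvsP. Qed.
Lemma incl_act x v : incl (act (sub_mod US) x v) = act M x (incl v).
Proof. exact: (is_homP _ incl_hom). Qed.
Lemma incl_injective : injective incl.
Proof. exact: lker0_inj incl_inj. Qed.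

Definition corestr X (f : 'Hom(X, M)) : 'Hom(X, sub_mod US) := (linfun (vsproj U) \o f)%VF.
Lemma corestrE X (f : 'Hom(X, M)) v : f v \in U -> incl (corestr f v) = f v.
Proof. by move=> fU; rewrite inclE comp_lfunE lfunE /= vsprojK. Qed.
Lemma corestr_hom X (f : 'Hom(X, M)) : (forall v, f v \in U) -> is_hom f -> is_hom (corestr f).
Proof.
move=> fU /is_homP fH; apply/is_homP => x v; apply/incl_injective.
by rewrite incl_act !corestrE // fH.
Qed.

Lemma quo_proj_hom : is_hom (quo_proj U : 'Hom(M, quo_mod US)).
Proof. by apply/is_homP => x v; rewrite /= (quo_actE US). Qed.
Lemma limg_quo_proj : limg (quo_proj U : 'Hom(M, quo_mod US)) = fullv.
Proof. by apply: limg_full => w; have [v ->] := quo_surj w; exists v. Qed.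
Lemma lker_quo_proj : lker (quo_proj U : 'Hom(M, quo_mod US)) = U.
Proof.
apply/vspaceP => v; rewrite memv_ker.
have Dv : daddv_pi (U^C)%VS U v + daddv_pi U (U^C)%VS v = v.
  by apply: daddv_pi_add (WU0 _) _; rewrite addvC addv_complf memvf.
apply/eqP/idP => [/(congr1 val)|vU].
  by rewrite /= quo_projE => p0; rewrite -Dv p0 add0r memv_pi.
apply/val_inj; rewrite /= quo_projE; apply: (addIr v); rewrite add0r -{3}Dv; congr (_ + _).
by rewrite daddv_pi_id ?capv_compl.
Qed.
End SubQuo.

Lemma factor_surj M C X (q : 'Hom(M, C)) (z : 'Hom(M, X)) :
  is_hom q -> limg q = fullv -> is_hom z -> (lker q <= lker z)%VS ->
  exists2 y : 'Hom(C, X), is_hom y & (y \o q)%VF = z.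
Proof.
move=> /is_homP qH qS /is_homP zH /subvP qz; exists (z \o q^-1)%VF; last first.
  apply/lfunP => v; rewrite !comp_lfunE; apply/eqP; rewrite -subr_eq0 -linearB -memv_ker qz //.
  by rewrite memv_ker linearB /= limg_lfunVK ?memv_img ?memvf // subrr.
have qV w : q (q^-1%VF w) = w by rewrite limg_lfunVK // qS memvf.
apply/is_homP => x w; rewrite !comp_lfunE -zH; apply/eqP; rewrite -subr_eq0 -linearB -memv_ker qz //.
by rewrite memv_ker linearB /= qH !qV subrr.
Qed.

(** Any linear section becomes graded when it is sandwiched between the idempotents e_i and summed;
    it stays a section because p commutes with them. *)
Lemma graded_section X Z (p : 'Hom(X, Z)) : is_hom p -> limg p = fullv ->
  exists2 s : 'Hom(Z, X), s \in graded_maps Z X & (p \o s = \1)%VF.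
Proof.
move=> /is_homP pH pS; exists (\sum_i (act X (inl i) \o p^-1 \o act Z (inl i))%VF).
  apply/graded_mapsP => i v; rewrite !sum_lfunE linear_sum; apply: eq_bigr => j _ /=.
  rewrite !comp_lfunE !act_ii [i == j]eq_sym.
  by case: eqP => [->|_]; rewrite ?linear0.
apply/lfunP => v; rewrite comp_lfunE sum_lfunE linear_sum id_lfunE -[RHS]act_sum.
apply: eq_bigr => i _ /=; rewrite !comp_lfunE pH limg_lfunVK ?pS ?memvf //.
by rewrite act_ii eqxx.
Qed.

(* The obstruction to lifting z pairs with dext through the composites z o theta. *)
Lemma lift_hom X Z M (p : 'Hom(X, Z)) (z : 'Hom(M, Z)) :
  is_hom p -> limg p = fullv -> is_hom z ->
  (forall Y (theta : cochain Y M), theta \in dext Y M -> forall a, (z \o theta a)%VF = 0) ->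
  exists2 g : 'Hom(M, X), is_hom g & (p \o g)%VF = z.
Proof.
move=> pH pS zH z0; have [s sG ps] := graded_section pH pS.
have psE v : p (s v) = v by rewrite -comp_lfunE ps id_lfunE.
have KS := stable_lker pH; pose K := sub_mod KS.
(* [kap a] is the failure of s to commute with the arrow a, with values in the kernel of p. Composed
   with z it is the obstruction cocycle c; once c is the coboundary of h, subtracting h from s o z
   repairs the lift. *)
pose kap a := corestr KS ((act X (inr a) \o s) - (s \o act Z (inr a)))%VF.
have kapE a v : incl KS (kap a v) = act X (inr a) (s v) - s (act Z (inr a) v).
  rewrite corestrE add_lfunE opp_lfunE !comp_lfunE // memv_ker linearB /=.
  by rewrite (is_homP _ pH) !psE subrr.
pose c : cochain M K := [ffun a => (kap a \o z)%VF].
have cE a v : incl KS (c a v) = act X (inr a) (s (z v)) - s (act Z (inr a) (z v)).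
  by rewrite ffunE comp_lfunE kapE.
have cC : c \in cocycles M K.
  apply/cocyclesP/ffunP => a; apply/lfunP => v; rewrite truncE; apply: (incl_injective (US := KS)).
  rewrite incl_act !cE linearB /= act_la eqxx (is_homP _ zH) (graded_mapsP _ sG).
  by rewrite !act_ar -(graded_mapsP _ sG) eqxx act_la eqxx.
have /coboundariesP[h hG E] : c \in coboundaries M K.
  apply: coboundary_perp => // th thD; apply: big1 => a _.
  by rewrite ffunE comp_lfunA lfun_traceC comp_lfunA z0 // comp_lfun0l linear0.
exists ((s \o z) - (incl KS \o h))%VF; last first.
  apply/lfunP => v; rewrite !comp_lfunE add_lfunE opp_lfunE !comp_lfunE linearB /= psE.
  by have := incl_mem (h v); rewrite memv_ker => /eqP->; rewrite subr0.
apply/is_homP => [[i|a]] v; rewrite !add_lfunE !opp_lfunE !comp_lfunE linearB /=.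
  by rewrite (is_homP _ zH) (graded_mapsP _ sG) (graded_mapsP _ hG) incl_act.
have := cE a v; rewrite E coboundaryE /= linearB /= incl_act (is_homP _ zH) => /eqP.
rewrite subr_eq => /eqP ->; rewrite opprD opprB.
by rewrite addrA subrKC.
Qed.

End Functoriality.

(** * Extensions built from cocycles *)

Section Extension.
Variables (k : finFieldType) (m : nat) (Q : quiver m) (M N : qmod k Q) (phi : cochain M N).
Hypothesis phiC : phi \in cocycles M N.
Implicit Type v : (N * M)%type.

(** The block triangular action on N (+) M: its extension class, read off from the section w |-> (0,
    w), is phi. It lets the lifting properties of projectives and injectives be translated into the
    vanishing of Ext^1. *)
Definition twist_fun (x : gen Q) v : (N * M)%type :=
  (act N x v.1 + (if x is inr a then phi a v.2 else 0), act M x v.2).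
Definition twist_act x : 'End((N * M)%type) := linfun (twist_fun x).
Lemma twist_actE x v : twist_act x v = twist_fun x v.
Proof.
apply: linfun_ext => c u w; rewrite /twist_fun /=; congr (_, _); last by rewrite linearP.
case: x => [i|a]; rewrite !linearP /= ?addr0 //.
by rewrite scalerDr addrACA.
Qed.
Lemma cocycle_actl a i w : act N (inl i) (phi a w) = if i == src a then phi a w else 0.
Proof.
have /cocyclesP pc := phiC; rewrite -[in LHS]pc -[in RHS]pc !truncE act_ii.
by case: eqP => // ->.
Qed.
Lemma cocycle_actr a i w : phi a (act M (inl i) w) = if i == tgt a then phi a w else 0.
Proof.
have /cocyclesP pc := phiC; rewrite -[in LHS]pc -[in RHS]pc !truncE act_ii eq_sym.
by case: eqP => // _; rewrite !linear0.
Qed.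
Lemma twist_idem i j : (twist_act (inl i) \o twist_act (inl j))%VF =
  if i == j then twist_act (inl i) else 0.
Proof.
apply/lfunP => v; rewrite comp_lfunE !twist_actE /twist_fun /= !addr0 !act_ii.
by case: eqP => _; rewrite ?twist_actE ?zero_lfunE // /twist_fun addr0.
Qed.
Lemma twist_one : \sum_i twist_act (inl i) = \1%VF.
Proof.
apply/lfunP => v; rewrite sum_lfunE id_lfunE.
under eq_bigr do rewrite twist_actE /twist_fun addr0.
rewrite [RHS]surjective_pairing -[in RHS](act_sum v.1) -[in RHS](act_sum v.2).
by elim/big_rec3: _ => // i y1 y2 y3 _ ->.
Qed.
Lemma twist_arrow a : (twist_act (inl (src a)) \o twist_act (inr a) \o
  twist_act (inl (tgt a)))%VF = twist_act (inr a).
Proof.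
apply/lfunP => v; rewrite !comp_lfunE !twist_actE /twist_fun /= !addr0.
by rewrite linearD /= act_la cocycle_actl act_ar cocycle_actr act_la act_ar !eqxx.
Qed.
Definition twist : qmod k Q := Qmod twist_idem twist_one twist_arrow.

Lemma twist_inl : exists2 j : 'Hom(N, twist), is_hom j & forall w, j w = (w, 0).
Proof.
have E w : linfun (fun w => (w, 0) : twist) w = (w, 0).
  apply: linfun_ext => c u u'.
  by congr (_, _); rewrite -[LHS]addr0 -[X in X + _](scaler0 _ c).
exists (linfun (fun w => (w, 0) : twist)) => //.
apply/is_homP => x w; rewrite !E /= twist_actE /twist_fun /= linear0.
by case: x => *; rewrite ?linear0 addr0.
Qed.

Lemma twist_snd : exists2 p : 'Hom(twist, M), is_hom p & forall v, p v = v.2.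
Proof.
have E v : linfun (fun v : twist => v.2 : M) v = v.2 by apply: linfun_ext.
exists (linfun (fun v : twist => v.2 : M)) => //.
by apply/is_homP => x v; rewrite !E /= twist_actE.
Qed.

Lemma twist_inr : exists j : 'Hom(M, twist), forall w, j w = (0, w).
Proof.
exists (linfun (fun w => (0, w) : twist)) => w; apply: linfun_ext => c u u'.
by congr (_, _); rewrite -[LHS]addr0 -[X in X + _](scaler0 _ c).
Qed.
End Extension.

Section ProjInj.
Variables (k : finFieldType) (m : nat) (Q : quiver m).
Local Notation mod := (qmod k Q).
Implicit Types (C M N X Y Z P I A : mod).

Lemma dsum_actP M N x (v : dsum M N) : act (dsum M N) x v = (act M x v.1, act N x v.2).
Proof. exact: dsum_actE. Qed.

Lemma dsum_pair X M N (r : 'Hom(X, M)) (q : 'Hom(X, N)) : is_hom r -> is_hom q ->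
  exists2 F : 'Hom(X, dsum M N), is_hom F & forall v, F v = (r v, q v).
Proof.
move=> rH qH; exists (linfun (fun v => (r v, q v) : dsum M N)); last first.
  by move=> v; apply: linfun_ext => c u w; rewrite !linearP.
have FE v : linfun (fun v => (r v, q v) : dsum M N) v = (r v, q v).
  by apply: linfun_ext => c u w; rewrite !linearP.
by apply/is_homP => x v; rewrite !FE dsum_actP (is_homP _ rH) (is_homP _ qH).
Qed.

Lemma dsum_copair X M N (r : 'Hom(M, X)) (q : 'Hom(N, X)) : is_hom r -> is_hom q ->
  exists2 F : 'Hom(dsum M N, X), is_hom F & forall v, F v = r v.1 + q v.2.
Proof.
move=> rH qH; have FE v : linfun (fun v : dsum M N => r v.1 + q v.2) v = r v.1 + q v.2.
  by apply: linfun_ext => c u w; rewrite /= !linearP /= scalerDr addrACA.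
exists (linfun (fun v : dsum M N => r v.1 + q v.2)) => //.
by apply/is_homP => x v; rewrite !FE dsum_actP linearD /= (is_homP _ rH) (is_homP _ qH).
Qed.

Lemma is_hom0 M N : is_hom (0 : 'Hom(M, N)).
Proof. by apply/is_homP => x v; rewrite !zero_lfunE linear0. Qed.

Lemma dsum_fst M N : exists2 F : 'Hom(dsum M N, M), is_hom F & forall v, F v = v.1.
Proof.
have [F FH FE] := dsum_copair (is_hom_id M) (is_hom0 N M); exists F => // v.
by rewrite FE id_lfunE zero_lfunE addr0.
Qed.
Lemma dsum_snd M N : exists2 F : 'Hom(dsum M N, N), is_hom F & forall v, F v = v.2.
Proof.
have [F FH FE] := dsum_copair (is_hom0 M N) (is_hom_id N); exists F => // v.
by rewrite FE id_lfunE zero_lfunE add0r.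
Qed.
Lemma dsum_inl M N : exists2 F : 'Hom(M, dsum M N), is_hom F & forall v, F v = (v, 0).
Proof.
have [F FH FE] := dsum_pair (is_hom_id M) (is_hom0 M N); exists F => // v.
by rewrite FE id_lfunE zero_lfunE.
Qed.
Lemma dsum_inr M N : exists2 F : 'Hom(N, dsum M N), is_hom F & forall v, F v = (0, v).
Proof.
have [F FH FE] := dsum_pair (is_hom0 N M) (is_hom_id N); exists F => // v.
by rewrite FE id_lfunE zero_lfunE.
Qed.

Lemma ext_dim0_sub M N : (cocycles M N <= coboundaries M N)%VS -> ext_dim M N = 0%N.
Proof. by move/dimvS; rewrite /ext_dim -subn_eq0 => /eqP. Qed.

Lemma projective_ext0 P Y : projective P -> ext_dim P Y = 0%N.
Proof.
move=> Pproj; apply/ext_dim0_sub/subvP => phi phiC.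
have [p pH pE] := twist_snd phiC.
have pS : limg p = fullv by apply: limg_full => v; exists ((0, v) : twist phiC); rewrite pE.
have [g gH pg] := Pproj _ _ p _ pH pS (is_hom_id P).
have g2 v : (g v).2 = v by rewrite -pE -comp_lfunE pg id_lfunE.
(* The lift has the form v |-> (- h v, v), and its compatibility with the arrows says that phi is
   the coboundary of h. *)
pose h := linfun (fun v => - (g v).1) : 'Hom(P, Y).
have hE v : h v = - (g v).1.
  by rewrite linfun_ext // => c u w; rewrite /= linearP /= opprD scalerN.
apply/coboundariesP; exists h; last first.
  apply/ffunP => a; apply/lfunP => v; rewrite coboundaryE !hE (is_homP _ gH) /= twist_actE /=.
  by rewrite g2 linearN /= opprK addKr.
apply/graded_mapsP => i v; rewrite !hE (is_homP _ gH) /= twist_actE /= addr0.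
by rewrite linearN.
Qed.

Lemma injective_ext0 Z I : injective_mod I -> ext_dim Z I = 0%N.
Proof.
move=> Iinj; apply/ext_dim0_sub/subvP => phi phiC.
have [j jH jE] := twist_inl phiC.
have j0 : lker j = 0%VS by apply: lker0_eq => v; rewrite jE => -[].
have [g gH gj] := Iinj _ _ j _ jH j0 (is_hom_id I).
have g1 v : g (v, 0) = v by rewrite -jE -comp_lfunE gj id_lfunE.
have [l lE] := twist_inr phiC; pose h := (g \o l)%VF.
have hE v : h v = g (0, v) by rewrite comp_lfunE lE.
apply/coboundariesP; exists h; last first.
  apply/ffunP => a; apply/lfunP => v; rewrite coboundaryE !hE.
  rewrite -(is_homP _ gH) /= twist_actE /twist_fun /= linear0 add0r.
  have -> : (phi a v, act Z (inr a) v) = (phi a v, 0) + (0, act Z (inr a) v) :> twist phiC.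
    by congr (_, _); rewrite ?addr0 ?add0r.
  by rewrite linearD /= g1 addrK.
apply/graded_mapsP => i v; rewrite !hE -(is_homP _ gH) /= twist_actE /twist_fun /= addr0.
by rewrite linear0.
Qed.

Lemma ext0_projective P : (forall Y, ext_dim P Y = 0%N) -> projective P.
Proof.
move=> P0 X Y p f pH pS fH; apply: lift_hom => // Z th; have /eqP/ext_dim0P -> := P0 Z.
by rewrite memv0 => /eqP -> a; rewrite ffunE comp_lfun0r.
Qed.

(** This is the hereditary property: Ext^1(M, Y) has dimension at most that of Ext^1(P, Y) = 0, for
    every Y. *)
Lemma projective_sub M P (j : 'Hom(M, P)) : is_hom j -> lker j = 0%VS -> projective P -> projective M.
Proof.
move=> jH j0 PP; apply: ext0_projective => Y; apply/eqP; rewrite -leqn0 -(projective_ext0 Y PP).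
apply: (ext_dim_leq jH (is_hom_id Y) j0).
by apply: limg_full => v; exists v; rewrite id_lfunE.
Qed.

(** The image of f is projective, being a submodule of P, so M splits as the kernel plus the image,
    and the image must vanish. *)
Lemma no_projective_summand_hom0 M P (f : 'Hom(M, P)) :
  no_projective_summand M -> projective P -> is_hom f -> f = 0.
Proof.
move=> nps Pproj fH; have JS : stable (limg f) by apply: stable_limg => //; apply: stable_full.
pose J := sub_mod JS.
have Jproj : projective J := projective_sub (incl_hom JS) (incl_inj JS) Pproj.
have fI v : f v \in limg f by rewrite memv_img ?memvf.
have qH := corestr_hom JS fI fH; set q := corestr JS f in qH.
have qE v : incl JS (q v) = f v by rewrite corestrE.
clearbody q.
have qS : limg q = fullv.
  apply: limg_full => v; have := incl_mem v => /memv_imgP[u _ uE]; exists u.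
  by apply: (incl_injective (US := JS)); rewrite qE.
have [s sH qs] := Jproj _ _ q _ qH qS (is_hom_id J).
have qsE v : q (s v) = v by rewrite -comp_lfunE qs id_lfunE.
have KS := stable_lker qH; pose K := sub_mod KS.
have rK v : (\1 - (s \o q))%VF v \in lker q.
  by rewrite memv_ker add_lfunE opp_lfunE id_lfunE comp_lfunE linearB /= qsE subrr.
have rH : is_hom (\1%VF - (s \o q)%VF : 'Hom(M, M)).
  apply/is_homP => x v; rewrite !add_lfunE !opp_lfunE !id_lfunE !comp_lfunE linearB /=.
  by rewrite (is_homP _ qH) (is_homP _ sH).
have rhom := corestr_hom KS rK rH; set r := corestr KS _ in rhom.
have rE v : incl KS (r v) = v - s (q v).
  by rewrite corestrE // add_lfunE opp_lfunE id_lfunE comp_lfunE.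
clearbody r; suff iso : isomorphic M (dsum K J).
  have /eqP := nps _ _ iso Jproj; rewrite dimv_eq0 => /eqP J0.
  apply/lfunP => v; rewrite -qE zero_lfunE; have : q v \in fullv by apply: memvf.
  by rewrite J0 memv0 => /eqP ->; rewrite linear0.
have [F FH FE] := dsum_pair rhom qH.
exists F; split => //.
  apply: lker0_eq => v; rewrite FE => -[r0 q0].
  by have := rE v; rewrite r0 q0 !linear0 addr0.
apply: limg_full => -[u w]; exists (incl KS u + s w); rewrite FE.
have qu : q (incl KS u) = 0 by apply/eqP; rewrite -memv_ker incl_mem.
have qE' : q (incl KS u + s w) = w by rewrite linearD /= qu add0r qsE.
congr (_, _) => //; apply: (incl_injective (US := KS)).
by rewrite rE qE' addrK.
Qed.
End ProjInj.

(** * The path algebra *)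

Section Walks.
Variables (m : nat) (Q : quiver m).
Hypothesis Q_acyclic : acyclic Q.

Lemma walk_uniq i (w : seq (arrow Q)) : walk i w -> uniq (i :: map tgt w).
Proof.
elim: w i => // a w IH i /andP[/eqP ai wk]; rewrite map_cons cons_uniq IH // andbT.
apply/negP => iw; set e := [rel i j | [exists a : arrow Q, (src a == i) && (tgt a == j)]].
have pP j (u : seq (arrow Q)) : walk j u -> path e j (map tgt u).
  elim: u j => // b u IHu j /andP[/eqP bj wu]; rewrite /= IHu // andbT.
  by apply/existsP; exists b; rewrite bj !eqxx.
have : path e i (tgt a :: map tgt w) by apply: (pP i (a :: w)); rewrite /= ai eqxx.
case/splitPr: iw => p1 p2; rewrite cat_path /= => /andP[h1 /andP[h2 _]].
have /Q_acyclic // : cycle e (i :: p1) by rewrite /= rcons_path h1.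
Qed.

(** The m.-bounded words in [qpath] thus contain every walk, and extending a path by an arrow always
    stays inside [qpath]. *)
Lemma walk_size i (w : seq (arrow Q)) : walk i w -> (size w < m)%N.
Proof.
move=> /walk_uniq/card_uniqP E; have := max_card [in i :: map tgt w].
by rewrite E card_ord /= size_map.
Qed.
End Walks.

Section PathModule.
Variables (k : finFieldType) (m : nat) (Q : quiver m).
Hypothesis Q_acyclic : acyclic Q.
Local Notation A := (path_mod k Q).
Implicit Types (Y : qmod k Q) (p r : qpath Q) (x : gen Q).

Definition wact Y (w : seq (arrow Q)) (v : Y) : Y := foldr (fun a => act Y (inr a)) v w.
Definition pact Y p (y : Y) : Y := wact (pword p) (act Y (inl (ptgt p)) y).

Lemma wactP Y w c (u v : Y) : wact w (c *: u + v) = c *: wact w u + wact w v.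
Proof. by elim: w => //= a w ->; rewrite linearP. Qed.
Lemma wact0 Y w : wact w 0 = 0 :> Y.
Proof. by elim: w => //= a w ->; rewrite linear0. Qed.

Lemma pactP Y p c (u v : Y) : pact p (c *: u + v) = c *: pact p u + pact p v.
Proof. by rewrite /pact linearP wactP. Qed.

Lemma act_pact_idem Y i p y : act Y (inl i) (pact p y) = if psrc p == i then pact p y else 0.
Proof.
rewrite /pact /ptgt; have := walkP p; case: (pword p) => [_|a w /andP[/eqP ap _]] /=.
  by rewrite act_ii eq_sym; case: eqP => // ->.
by rewrite act_la ap eq_sym.
Qed.

Lemma pact_idem Y i p y : pact p (act Y (inl i) y) = if ptgt p == i then pact p y else 0.
Proof. by rewrite /pact act_ii; case: eqP => // _; rewrite wact0. Qed.

Lemma sum_lstep Y x p (y : Y) : \sum_(r | lstep x p r) pact r y = act Y x (pact p y).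
Proof.
case: x => [i|a] /=.
  rewrite act_pact_idem; case: eqP => _ /=; last by rewrite big_pred0.
  by rewrite (big_pred1 p).
case: (eqVneq (tgt a) (psrc p)) => [ap|ap] /=; last first.
  rewrite big_pred0 // -[y in RHS]act_sum.
  have -> : pact p (\sum_i act Y (inl i) y) = pact p y by rewrite act_sum.
  have := act_pact_idem (psrc p) p y; rewrite eqxx => <-.
  by rewrite act_ar eq_sym (negPf ap).
have wk : walk (src a) (a :: pword p) by rewrite /= eqxx ap walkP.
have [r [rs rw]] := qpathP wk (ltnW (walk_size Q_acyclic wk)).
have pr : lstep (inr a) p r by rewrite /= ap rs rw !eqxx.
rewrite (big_pred1 r) => [|r']; first by rewrite /pact (lstep_ptgt pr) rw.
apply/andP/eqP => [[/eqP rs' /eqP rw']|->]; first by apply: qpath_inj; rewrite ?rs ?rw.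
by rewrite rs rw.
Qed.

Lemma sum_rstep Y x p (y : Y) : \sum_(r | rstep x p r) pact r y = pact p (act Y x y).
Proof.
case: x => [i|a] /=.
  rewrite pact_idem; case: eqP => _ /=; last by rewrite big_pred0.
  by rewrite (big_pred1 p).
rewrite /pact act_la; case: eqP => [pa|_] /=; last by rewrite big_pred0 ?wact0.
have wk : walk (psrc p) (rcons (pword p) a) by rewrite walk_rcons walkP -/(ptgt p) pa eqxx.
have [r [rs rw]] := qpathP wk (ltnW (walk_size Q_acyclic wk)).
rewrite (big_pred1 r) => [|r'].
  by rewrite (ptgt_rcons rw) rw -cats1 /wact foldr_cat /= act_ar eqxx.
apply/andP/eqP => [[/eqP rs' /eqP rw']|->]; first by apply: qpath_inj; rewrite ?rs ?rw.
by rewrite rs rw.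
Qed.

(* The homomorphism A -> Y sending 1 to y; see evalm_one. *)
Definition evalm Y (y : Y) : 'Hom(A, Y) := linfun (fun f : A => \sum_p f p *: pact p y).
Lemma evalmE Y (y : Y) (f : A) : evalm y f = \sum_p f p *: pact p y.
Proof.
rewrite linfun_ext // => c f1 f2; rewrite scaler_sumr -big_split; apply: eq_bigr => p _ /=.
by rewrite !ffunE scalerDl scalerA.
Qed.

Lemma evalm_hom Y (y : Y) : is_hom (evalm y).
Proof.
apply/is_homP => x f; rewrite !evalmE linear_sum.
under eq_bigr do rewrite path_actE ffunE scaler_suml.
rewrite (exchange_big_dep xpredT) //=; apply: eq_bigr => p _.
by rewrite -scaler_sumr sum_lstep linearZ.
Qed.

Lemma evalm_ract Y (y : Y) x (f : A) : evalm y (path_ract k x f) = evalm (act Y x y) f.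
Proof.
rewrite !evalmE; under eq_bigr do rewrite path_ractE ffunE scaler_suml.
rewrite (exchange_big_dep xpredT) //=; apply: eq_bigr => p _.
by rewrite -scaler_sumr sum_rstep.
Qed.

Lemma evalm_linear Y : linear (@evalm Y).
Proof.
move=> c u v; apply/lfunP => f; rewrite add_lfunE scale_lfunE !evalmE scaler_sumr -big_split.
by apply: eq_bigr => p _ /=; rewrite pactP scalerDr !scalerA mulrC.
Qed.

Definition pone : A := [ffun p => (pword p == [::])%:R].
Definition triv (i : 'I_m) : qpath Q := exist (fun u : 'I_m * m.-bseq (arrow Q) => walk u.1 u.2) (i, [bseq]) isT.
Definition pdelta r : A := [ffun p => (p == r)%:R].

Lemma trivP p : (pword p == [::]) = (p == triv (psrc p)).
Proof.
by apply/eqP/eqP => [w0|->] //; apply: qpath_inj.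
Qed.

Lemma evalm_one Y (y : Y) : evalm y pone = y.
Proof.
rewrite evalmE (bigID (fun p => pword p == [::])) /= [X in _ + X]big1 ?addr0; last first.
  by move=> p /negPf p0; rewrite ffunE p0 scale0r.
rewrite (reindex triv) /=; last first.
  by exists (@psrc m Q) => [i _|p]; rewrite // inE trivP => /eqP <-.
under eq_bigr do rewrite ffunE eqxx scale1r.
exact: act_sum.
Qed.

Lemma pone_comm x : act A x pone = path_ract k x pone.
Proof.
rewrite path_actE path_ractE; apply/ffunP => r; case: x => [i|a].
  rewrite lmul_idemE rmul_idemE ffunE.
  by have [r0|_] := eqVneq (pword r) [::]; [rewrite /ptgt r0 | rewrite !if_same].
rewrite !ffunE; case: (eqVneq (pword r) [:: a]) => ra; last first.
  rewrite !big1 // => p /and3P[_ _ /eqP rp]; rewrite ffunE; case: eqP => // p0; case/eqP: ra.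
    by rewrite rp p0.
  by rewrite rp p0.
have rs : psrc r = src a by have := walkP r; rewrite ra /= => /andP[/eqP].
have ls : lstep (inr a) (triv (tgt a)) r by rewrite /= rs ra !eqxx.
have rst : rstep (inr a) (triv (src a)) r by rewrite /= rs ra !eqxx.
rewrite (big_pred1 (triv (tgt a))) => [|p]; last first.
  by apply/idP/eqP => [h|->] //; apply: lstep_inj h ls.
rewrite (big_pred1 (triv (src a))) => [|p]; last first.
  by apply/idP/eqP => [h|->] //; apply: rstep_inj h rst.
by rewrite !ffunE.
Qed.

Lemma pdelta_triv i : pdelta (triv i) = path_ract k (inl i) pone.
Proof.
rewrite path_ractE; apply/ffunP => r; rewrite rmul_idemE !ffunE trivP.
case: (eqVneq r (triv i)) => [->|ri]; first by rewrite /ptgt /= !eqxx.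
case: eqP => // ir; case: eqP => // r0; case/eqP: ri.
by rewrite r0; congr triv; rewrite -ir r0.
Qed.

Lemma sum_pdelta (S : pred (qpath Q)) p : \sum_(q | S q) pdelta p q = (S p)%:R :> k.
Proof.
rewrite big_mkcond (bigD1 p) //= big1 ?addr0 => [|q qp]; last first.
  by rewrite ffunE (negPf qp) if_same.
by rewrite ffunE eqxx; case: (S p).
Qed.

Lemma rstep_fun x p r r' : rstep x p r -> rstep x p r' -> r' = r.
Proof.
case: x => [i|a] /=; first by move=> /andP[_ /eqP ->] /andP[_ /eqP ->].
by move=> /and3P[_ /eqP s1 /eqP w1] /and3P[_ /eqP s2 /eqP w2]; apply: qpath_inj; rewrite ?s1 ?s2 ?w1 ?w2.
Qed.
Lemma lstep_fun x p r r' : lstep x p r -> lstep x p r' -> r' = r.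
Proof.
case: x => [i|a] /=; first by move=> /andP[_ /eqP ->] /andP[_ /eqP ->].
by move=> /and3P[_ /eqP s1 /eqP w1] /and3P[_ /eqP s2 /eqP w2]; apply: qpath_inj; rewrite ?s1 ?s2 ?w1 ?w2.
Qed.

Lemma pdelta_rstep x p r : rstep x p r -> path_ract k x (pdelta p) = pdelta r.
Proof.
move=> pr; rewrite path_ractE; apply/ffunP => r'; rewrite !ffunE.
rewrite sum_pdelta; congr (_%:R : k); congr nat_of_bool.
apply/idP/eqP => [|-> //]; apply: rstep_fun pr.
Qed.

Lemma pdelta_lstep x p r : lstep x p r -> act A x (pdelta p) = pdelta r.
Proof.
move=> pr; rewrite path_actE; apply/ffunP => r'; rewrite !ffunE.
rewrite sum_pdelta; congr (_%:R : k); congr nat_of_bool.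
apply/idP/eqP => [|-> //]; apply: lstep_fun pr.
Qed.

Lemma path_expand (f : A) : f = \sum_p f p *: pdelta p.
Proof.
apply/ffunP => r; rewrite sum_ffunE (bigD1 r) //= big1 => [|p pr].
  by rewrite !ffunE eqxx addr0 [RHS]mulr1.
by rewrite !ffunE eq_sym (negPf pr) scaler0.
Qed.

Lemma path_span (P : A -> Prop) : P 0 -> (forall c f g, P f -> P g -> P (c *: f + g)) ->
  (forall p, P (pdelta p)) -> forall f, P f.
Proof.
move=> P0 PD Pd f; rewrite (path_expand f); elim/big_rec: _ => // p g _; exact: PD.
Qed.

Lemma path_ind_r (P : A -> Prop) : P 0 -> (forall c f g, P f -> P g -> P (c *: f + g)) ->
  P pone -> (forall x f, P f -> P (path_ract k x f)) -> forall f, P f.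
Proof.
move=> P0 PD P1 Px; apply: path_span => // r.
have [w rw] : exists w, pword r = w by exists (pword r).
elim/last_ind: w r rw => [|w a IH] r rw.
  by move/eqP: rw; rewrite trivP => /eqP ->; rewrite pdelta_triv; apply: Px.
have := walkP r; rewrite rw walk_rcons => /andP[wk ra].
have [p [ps pw]] := qpathP wk (ltnW (walk_size Q_acyclic wk)).
rewrite -(@pdelta_rstep (inr a) p); first exact/Px/IH.
by rewrite /= ps pw rw !eqxx /ptgt ps pw ra.
Qed.

Lemma path_hom_eq Y (f g : 'Hom(A, Y)) : is_hom f -> is_hom g -> f pone = g pone -> f = g.
Proof.
move=> /is_homP fH /is_homP gH e1; apply/lfunP; apply: path_span => [|c u v fu fv|r].
- by rewrite !linear0.
- by rewrite !linearP /= fu fv.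
have [w rw] : exists w, pword r = w by exists (pword r).
elim: w r rw => [|a w IH] r rw.
  move/eqP: rw; rewrite trivP => /eqP ->; rewrite pdelta_triv -pone_comm fH gH e1 //.
have := walkP r; rewrite rw /= => /andP[/eqP ra wk].
have [p [ps pw]] := qpathP wk (ltnW (walk_size Q_acyclic wk)).
have pr : lstep (inr a) p r by rewrite /= ps ra pw rw !eqxx.
by rewrite -(pdelta_lstep pr) fH gH (IH p pw).
Qed.

Lemma path_mod_projective : projective A.
Proof.
move=> X Y p f pH pS fH; have [x xE] := limg_fullP pS (f pone).
exists (evalm x); first exact: evalm_hom.
apply: path_hom_eq; rewrite ?comp_lfunE ?evalm_one //.
by apply: is_hom_comp => //; apply: evalm_hom.
Qed.

Lemma projective_dsum (P P' : qmod k Q) : projective P -> projective P' -> projective (dsum P P').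
Proof.
move=> PP PP' X Y p f pH pS fH.
have [i iH iE] := dsum_inl P P'; have [j jH jE] := dsum_inr P P'.
have [g gH gE] := PP _ _ p (f \o i)%VF pH pS (is_hom_comp fH iH).
have [g' gH' gE'] := PP' _ _ p (f \o j)%VF pH pS (is_hom_comp fH jH).
have [F FH FE] := dsum_copair gH gH'; exists F => //; apply/lfunP => -[u v].
rewrite comp_lfunE FE linearD /= -!comp_lfunE gE gE' !comp_lfunE iE jE -linearD; congr (f _).
by congr (_, _); rewrite ?addr0 ?add0r.
Qed.

(** The cover is not minimal: it has one copy of A for each vector of a basis of Z, and a last copy
    mapped to 0 that starts the induction. *)
Lemma projective_cover (Z : qmod k Q) : exists (F : qmod k Q) (p : 'Hom(F, Z)),
  [/\ projective F, is_hom p & limg p = fullv].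
Proof.
suff gen (ys : seq Z) : exists (F : qmod k Q) (p : 'Hom(F, Z)),
    [/\ projective F, is_hom p & {subset ys <= limg p}].
  have [F [p [FP pH pS]]] := gen (vbasis {:Z}); exists F, p; split=> //; apply/eqP; rewrite eqEsubv subvf -(span_basis (vbasisP {:Z})).
  exact/span_subvP.
elim: ys => [|y ys [F [p [FP pH pS]]]].
  by exists A, (evalm 0); split=> //; [exact: path_mod_projective | exact: evalm_hom].
have [G GH GE] := dsum_copair (evalm_hom y) pH.
exists (dsum A F), G; split=> //; first by apply: projective_dsum => //; apply: path_mod_projective.
move=> z; rewrite inE => /orP[/eqP ->|/pS/memv_imgP[v _ ->]].
  by apply/memv_imgP; exists (pone, 0); rewrite ?memvf // GE evalm_one linear0 addr0.
by apply/memv_imgP; exists (0, v); rewrite ?memvf // GE linear0 add0r.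
Qed.

End PathModule.

(** * Modules representing dext, and tau *)

Section Representing.
Variables (k : finFieldType) (m : nat) (Q : quiver m).
Local Notation mod := (qmod k Q).
Implicit Types (M N T X Y Z : mod).

(** The Yoneda form of the Auslander-Reiten formula: phi |-> u o phi is a bijection from Hom(Y, T)
    to D Ext^1(M, Y), and u is the image of the identity of T. *)
Definition represents T M (u : cochain T M) : Prop :=
  [/\ u \in dext T M,
      forall Y (psi : cochain Y M), psi \in dext Y M ->
        exists2 phi : 'Hom(Y, T), is_hom phi & forall a, (u a \o phi)%VF = psi a
    & forall Y (phi : 'Hom(Y, T)), is_hom phi -> (forall a, (u a \o phi)%VF = 0) -> phi = 0].

Section Tau.
Hypothesis Q_acyclic : acyclic Q.
Local Notation A := (path_mod k Q).
Variable M : mod.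

Let tincl := incl (tau_stable M).
(** Elements of [tau M] are functionals on cochains; inverting the trace form rewrites them as
    families of maps A -> M, on which the action is composition with right multiplication. *)
Definition tau_dext : 'Hom(tau M, cochain A M) := ((pairmap A M)^-1 \o tincl)%VF.

Lemma pairmap_theta x : pairmap A M (tau_dext x) = tincl x.
Proof. by rewrite comp_lfunE limg_lfunVK // pairmap_full memvf. Qed.

Lemma pairmap_inj : injective (pairmap A M).
Proof. exact/lker0P/pairmap_ker0. Qed.

Lemma tau_dext_inj : injective tau_dext.
Proof. by move=> x y e; apply: (incl_injective (US := tau_stable M)); rewrite -/tincl -!pairmap_theta e. Qed.

Lemma tau_dextP x : tau_dext x \in dext A M.
Proof. by rewrite -memv_preim pairmap_theta; apply: (incl_mem (US := tau_stable M)). Qed.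

Lemma tau_dext_act b x : tau_dext (act (tau M) b x) = dmap \1%VF (path_ract k b) (tau_dext x).
Proof.
apply: pairmap_inj; rewrite pairmap_theta /tincl incl_act; apply/lfunP => c.
rewrite dual_actE -/tincl -pairmap_theta !pairmapE; apply: eq_bigr => a _.
by rewrite postcompE ffunE comp_lfun1l comp_lfunA.
Qed.

Definition tau_univ : cochain (tau M) M :=
  [ffun a => linfun (fun x => tau_dext x a (pone k Q) : M)].
Lemma tau_univE a x : tau_univ a x = tau_dext x a (pone k Q).
Proof. by rewrite ffunE linfun_ext // => c u v; rewrite linearP !ffunE add_lfunE scale_lfunE. Qed.

Lemma dmap_evalm_mem Y (psi : cochain Y M) y : psi \in dext Y M ->
  pairmap A M (dmap \1%VF (evalm y) psi) \in tau_space M.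
Proof.
move=> pD; suff : dmap \1%VF (evalm y) psi \in dext A M by rewrite -memv_preim.
by apply: dmap_dext => //; [apply: is_hom_id | apply: evalm_hom].
Qed.

(* As a space tau M is dext A M, with the action coming from right multiplication on
   A; tau_univ evaluates at 1, and psi in dext Y M comes from the map sending y to the
   composite of psi with A -> Y, 1 |-> y. *)
Lemma tau_represents : represents tau_univ.
Proof.
split.
- apply/dextP; split=> [a|].
    apply/lfunP => x; rewrite !comp_lfunE !tau_univE tau_dext_act dmapE id_lfunE -pone_comm.
    have /dextP[tr0 _] := tau_dextP x.
    by rewrite truncated_l // truncated_r // !eqxx.
  apply/lfunP => x; have /dextP[_ d0] := tau_dextP x.
  rewrite zero_lfunE -[RHS](zero_lfunE _ (pone k Q)) -d0 !dcobE; apply: eq_bigr => a _.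
  by rewrite !tau_univE tau_dext_act dmapE id_lfunE -pone_comm.
- move=> Y psi pD.
  have [L LE] : exists L : 'Hom(Y, dual_cochain_mod M), forall y, L y = pairmap A M (dmap \1%VF (evalm y) psi).
    exists (linfun (fun y => pairmap A M (dmap \1%VF (evalm y) psi) : dual_cochain_mod M)) => y.
    rewrite linfun_ext // => c u v; rewrite -linearP; congr (pairmap A M _).
    by apply/ffunP => a; rewrite !ffunE evalm_linear comp_lfunDr -comp_lfunZr.
  have LU y : L y \in tau_space M by rewrite LE dmap_evalm_mem.
  pose phi := corestr (tau_stable M) L.
  have tphi y : tau_dext (phi y) = dmap \1%VF (evalm y) psi.
    by apply: pairmap_inj; rewrite pairmap_theta -LE /tincl corestrE.
  exists phi.
    apply/is_homP => x y; apply: tau_dext_inj; rewrite tau_dext_act !tphi.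
    apply/ffunP => a; apply/lfunP => f.
    by rewrite !dmapE !id_lfunE evalm_ract.
  by move=> a; apply/lfunP => y; rewrite comp_lfunE tau_univE tphi dmapE id_lfunE evalm_one.
move=> Y phi phiH u0; apply/lfunP => y; rewrite zero_lfunE.
apply: tau_dext_inj; rewrite linear0; apply/ffunP => a; rewrite ffunE; apply/lfunP => f.
(* Here y has to vary in the induction, since right multiplication by x on the path algebra becomes
   the action of x on y. *)
rewrite zero_lfunE; move: f y; apply: path_ind_r => // [y|c f g fE gE y|y|x f fE y].
- by rewrite linear0.
- by rewrite linearP /= fE gE scaler0 addr0.
- by rewrite -tau_univE -comp_lfunE u0 zero_lfunE.
by have := fE (act Y x y); rewrite (is_homP _ phiH) tau_dext_act dmapE id_lfunE.
Qed.
End Tau.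
End Representing.

(** * Dimension vectors and the matrix of the Euler form *)

Section Dimensions.
Variables (k : finFieldType) (m : nat) (Q : quiver m).
Local Notation mod := (qmod k Q).
Implicit Types (C M N T X Y Z : mod).

(** Attached to subspaces, so that the terms of sums over submodules carry no proof of stability;
    [dimvec_sub] gives the meaning for stable U. *)
Definition dvs M (U : {vspace M}) : 'cV[int]_m := \col_i (\dim (act M (inl i) @: U))%:Z.

Lemma dvs_full M : dvs (fullv : {vspace M}) = dimvec M.
Proof. by []. Qed.

Lemma dvs_limg M N (f : 'Hom(M, N)) (U : {vspace M}) : is_hom f -> stable U ->
  dvs U = dvs (U :&: lker f)%VS + dvs (f @: U)%VS.
Proof.
move=> /is_homP fH /stableP US; apply/colP => i; rewrite !mxE.
have -> : (act N (inl i) @: (f @: U) = f @: (act M (inl i) @: U))%VS.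
  by rewrite -!limg_comp; apply: eq_in_limg => v _; rewrite !comp_lfunE fH.
have -> : (act M (inl i) @: (U :&: lker f) = act M (inl i) @: U :&: lker f)%VS.
  apply/vspaceP => v; rewrite memv_cap memv_ker; apply/memv_imgP/andP => [[u]|[/memv_imgP[u uU ->] fu]].
    by rewrite memv_cap memv_ker => /andP[uU /eqP fu] ->; rewrite memv_img // fH fu linear0.
  by exists (act M (inl i) u); rewrite ?act_ii ?eqxx // memv_cap memv_ker fu US.
by rewrite -PoszD limg_ker_dim.
Qed.

Lemma dvs0 M : dvs (0%VS : {vspace M}) = 0.
Proof. by apply/colP => i; rewrite !mxE limg0 dimv0. Qed.

Lemma dvs_inj M N (f : 'Hom(M, N)) (U : {vspace M}) : is_hom f -> stable U -> lker f = 0%VS ->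
  dvs (f @: U)%VS = dvs U.
Proof. by move=> fH US f0; rewrite (dvs_limg fH US) f0 capv0 dvs0 add0r. Qed.

Lemma dimvec_surj M N (f : 'Hom(M, N)) : is_hom f -> limg f = fullv ->
  dimvec M = dvs (lker f) + dimvec N.
Proof. by move=> fH fS; rewrite -!dvs_full (dvs_limg fH (stable_full M)) capfv fS. Qed.

Lemma dimvec_sub M (U : {vspace M}) (US : stable U) : dimvec (sub_mod US) = dvs U.
Proof.
by rewrite -dvs_full -[in RHS](limg_incl US) (dvs_inj (incl_hom US)) ?incl_inj ?stable_full.
Qed.

Lemma dimvec_quo M (U : {vspace M}) (US : stable U) : dimvec (quo_mod US) = dimvec M - dvs U.
Proof.
rewrite (dimvec_surj (quo_proj_hom US) (limg_quo_proj US)) lker_quo_proj.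
by rewrite addrAC subrr add0r.
Qed.

Lemma dimvec_iso M N : isomorphic M N -> dimvec M = dimvec N.
Proof. by case=> f [fH f0 fS]; rewrite (dimvec_surj fH fS) f0 dvs0 add0r. Qed.

Lemma dimvec_dsum M N : dimvec (dsum M N) = dimvec M + dimvec N.
Proof.
have [p pH pE] := dsum_snd M N; have [j jH jE] := dsum_inl M N.
rewrite (dimvec_surj pH); last by apply: limg_full => v; exists (0, v); rewrite pE.
congr (_ + _); rewrite -[in RHS]dvs_full -(dvs_inj jH (stable_full M)); last first.
  by apply: lker0_eq => v; rewrite jE => -[].
congr dvs; apply/vspaceP => v; rewrite memv_ker pE; apply/eqP/memv_imgP => [v0|[u _ ->]].
  by exists v.1; rewrite ?memvf // jE -v0; case: (v).
by rewrite jE.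
Qed.

Definition Rfull : 'M[int]_m := \matrix_(i, j) #|[set a : arrow Q | (src a == j) && (tgt a == i)]|%:Z.
(** The Euler form on all of Z^m, frozen vertices included. Its matrix 1 - R is also the one that
    multiplies dimension vectors in the exponents of the cluster characters. *)
Definition eform : 'cV[int]_m -> 'cV[int]_m -> int := Lform (1%:M - Rfull).

Lemma eformDl u v w : eform (u + v) w = eform u w + eform v w.
Proof. exact: LformDl. Qed.
Lemma eformDr u v w : eform u (v + w) = eform u v + eform u w.
Proof. exact: LformDr. Qed.
Lemma eformNl u v : eform (- u) v = - eform u v.
Proof. by rewrite /eform /Lform linearN /= !mulNmx mxE. Qed.
Lemma eformNr u v : eform u (- v) = - eform u v.
Proof. by rewrite /eform /Lform mulmxN mxE. Qed.
Lemma eform0r u : eform u 0 = 0.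
Proof. by rewrite /eform /Lform mulmx0 mxE. Qed.
Lemma eform0l u : eform 0 u = 0.
Proof. by rewrite /eform /Lform linear0 !mul0mx mxE. Qed.

Lemma eulerE M N : euler M N = eform (dimvec M) (dimvec N).
Proof.
rewrite euler_dims /eform /Lform mulmxBr mulmx1 mulmxBl !mxE; congr (_ - _).
  by apply: eq_bigr => i _; rewrite !mxE.
pose F (a : arrow Q) := (dimv M (tgt a))%:Z * (dimv N (src a))%:Z.
have -> : \sum_(a : arrow Q) F a = \sum_j \sum_i \sum_(a | (src a == j) && (tgt a == i)) F a.
  rewrite (partition_big (@src m Q) xpredT) //=; apply: eq_bigr => j _.
  by rewrite (partition_big (@tgt m Q) xpredT).
apply: eq_bigr => j _; rewrite !mxE mulr_suml; apply: eq_bigr => i _; rewrite !mxE.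
rewrite (eq_bigr (fun=> (dimv M i)%:Z * (dimv N j)%:Z)) => [|a /andP[/eqP <- /eqP <-] //].
rewrite sumr_const -mulr_natr cardsE natz -!mulrA; congr (_ * _); exact: mulrC.
Qed.
End Dimensions.

(** * Recovering maps out of M from a module representing its dual Ext^1 *)

Section RepresentingTheory.
Variables (k : finFieldType) (m : nat) (Q : quiver m).
Local Notation mod := (qmod k Q).
Implicit Types (M N T X Y Z P I : mod).

Lemma dext_compl M N X Y (f : 'Hom(M, N)) (theta : cochain Y M) : is_hom f -> theta \in dext Y M ->
  [ffun a => (f \o theta a)%VF] \in dext Y N.
Proof.
move=> fH tD; suff -> : [ffun a => (f \o theta a)%VF] = dmap f \1%VF theta :> cochain Y N.
  exact: dmap_dext fH (is_hom_id Y) tD.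
by apply/ffunP => a; rewrite !ffunE comp_lfun1r.
Qed.
Lemma dext_compr M X Y (f : 'Hom(X, Y)) (theta : cochain Y M) : is_hom f -> theta \in dext Y M ->
  [ffun a => (theta a \o f)%VF] \in dext X M.
Proof.
move=> fH tD; suff -> : [ffun a => (theta a \o f)%VF] = dmap \1%VF f theta :> cochain X M.
  exact: dmap_dext (is_hom_id M) fH tD.
by apply/ffunP => a; rewrite !ffunE comp_lfun1l.
Qed.

Lemma dext_eq0 M Y (theta : cochain Y M) : ext_dim M Y = 0%N -> theta \in dext Y M ->
  forall a, theta a = 0.
Proof.
by move/eqP/ext_dim0P => ->; rewrite memv0 => /eqP -> a; rewrite ffunE.
Qed.

Definition comp_univ T M Y (u : cochain T M) (phi : 'Hom(Y, T)) : cochain Y M :=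
  [ffun a => (u a \o phi)%VF].
Lemma comp_univ_linear T M Y (u : cochain T M) : linear (@comp_univ T M Y u).
Proof.
by move=> c f g; apply/ffunP => a; rewrite !ffunE comp_lfunDr -comp_lfunZr.
Qed.
HB.instance Definition _ T M Y u := GRing.isLinear.Build k _ _ _ _ (@comp_univ_linear T M Y u).

Lemma represents_dim T M (u : cochain T M) Y : represents u -> \dim (homs Y T) = ext_dim M Y.
Proof.
move=> [uD uE uI]; rewrite -dim_dext -(@limg_dim_eq _ _ _ (linfun (@comp_univ T M Y u))).
  congr (\dim _); apply/vspaceP => psi; apply/memv_imgP/idP => [[phi phiH ->]|pD].
    by rewrite lfunE /=; apply: dext_compr.
  have [phi phiH pE] := uE _ _ pD; exists phi => //.
  by rewrite lfunE /=; apply/ffunP => a; rewrite ffunE pE.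
apply/eqP; rewrite -subv0; apply/subvP => phi /memv_capP[phiH].
rewrite memv_ker lfunE /= memv0 => /eqP/ffunP p0; apply/eqP/uI => // a.
by have := p0 a; rewrite !ffunE.
Qed.

(** Since Ext^1(P, -) = 0, every family in [dext Y M] takes its values in the summand M'. So [tau M]
    also represents the functor of M', to which the results on modules without projective summands
    apply. *)
Lemma represents_summand T M (u : cochain T M) M' P (q : 'Hom(M, M')) (q0 : 'Hom(M, P))
    (j : 'Hom(M', M)) (j0 : 'Hom(P, M)) :
  represents u -> projective P -> is_hom q -> is_hom q0 -> is_hom j ->
  (q \o j = \1)%VF -> (forall v, v = j (q v) + j0 (q0 v)) ->
  represents ([ffun a => (q \o u a)%VF] : cochain T M').
Proof.
move=> [uD uE uI] PP qH q0H jH qj vE.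
have jq Y (theta : cochain Y M) a : theta \in dext Y M -> (j \o (q \o theta a))%VF = theta a.
  move=> tD; apply/lfunP => y; rewrite [RHS]vE !comp_lfunE.
  have := dext_eq0 (projective_ext0 Y PP) (dext_compl Y q0H tD) a; rewrite ffunE => /lfunP/(_ y).
  by rewrite comp_lfunE zero_lfunE => ->; rewrite linear0 addr0.
split; first exact: dext_compl.
  move=> Y psi pD; have [phi phiH pE] := uE _ _ (dext_compl Y jH pD); exists phi => // a.
  by rewrite ffunE -comp_lfunA pE ffunE comp_lfunA qj comp_lfun1l.
move=> Y phi phiH p0; apply: uI => // a; rewrite -(jq _ _ a uD) -comp_lfunA.
by have := p0 a; rewrite ffunE => ->; rewrite comp_lfun0r.
Qed.

Lemma euler_projective P X : projective P -> euler P X = (\dim (homs P X))%:Z.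
Proof. by move=> PP; rewrite /euler projective_ext0 // subr0. Qed.

Section NoProjectiveSummand.
Hypothesis Q_acyclic : acyclic Q.
Variables (T M : mod) (u : cochain T M).
Hypotheses (uR : represents u) (M_nps : no_projective_summand M).

Lemma euler_nps_projective P : projective P -> euler M P = - (ext_dim M P)%:Z.
Proof.
move=> PP; rewrite /euler; have -> : homs M P = 0%VS; last by rewrite dimv0 sub0r.
apply/eqP; rewrite -subv0; apply/subvP => f fH; rewrite memv0; apply/eqP.
exact: no_projective_summand_hom0.
Qed.

(* For projective Z both sides are dim Ext^1(M, Z), because Hom(M, Z) = 0; the general
   case follows from a projective resolution of length one. *)
Lemma euler_represents Z : euler Z T = - euler M Z.
Proof.
have [F [p [FP pH pS]]] := projective_cover Q_acyclic Z.
have KS := stable_lker pH.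
have KP := projective_sub (incl_hom KS) (incl_inj KS) FP.
have E P : projective P -> eform Q (dimvec P) (dimvec T) = - eform Q (dimvec M) (dimvec P).
  move=> PP; rewrite -!eulerE euler_projective // (represents_dim _ uR) euler_nps_projective //.
  by rewrite opprK.
have dE : dimvec Z = dimvec F - dimvec (sub_mod KS).
  by rewrite dimvec_sub (dimvec_surj pH pS) addrAC subrr add0r.
rewrite !eulerE dE eformDl eformDr eformNl eformNr !E // opprK opprD opprK.
by [].
Qed.

(** Every family in [dext Y M] factors through u, so z kills all of them and the obstruction to
    lifting z to a projective F -> Z vanishes. But M has no nonzero map to F. *)
Lemma represents_hom_inj Z (z : 'Hom(M, Z)) : is_hom z -> (forall a, (z \o u a)%VF = 0) -> z = 0.
Proof.
move=> zH z0; have [F [p [FP pH pS]]] := projective_cover Q_acyclic Z.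
have [g gH <-] : exists2 g : 'Hom(M, F), is_hom g & (p \o g)%VF = z.
  apply: lift_hom => // Y theta tD a; have [_ uE _] := uR; have [phi _ <-] := uE _ _ tD.
  by rewrite comp_lfunA z0 comp_lfun0l.
by rewrite (no_projective_summand_hom0 M_nps FP gH) comp_lfun0r.
Qed.

Lemma represents_hom_eq Z (z z' : 'Hom(M, Z)) : is_hom z -> is_hom z' ->
  (forall a, (z \o u a)%VF = (z' \o u a)%VF) -> z = z'.
Proof.
move=> zH z'H e; apply/eqP; rewrite -subr_eq0; apply/eqP/represents_hom_inj.
  by rewrite /is_hom memvB.
by move=> a; rewrite comp_lfunDl comp_lfunNl e subrr.
Qed.

(* By represents_hom_inj and a dimension count:
   dim Ext^1(Z, T) = dim Hom(Z, T) - <Z, T> = dim Ext^1(M, Z) + <M, Z>. *)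
Lemma represents_hom_surj Z (chi : cochain T Z) : chi \in dext T Z ->
  exists2 z : 'Hom(M, Z), is_hom z & forall a, (z \o u a)%VF = chi a.
Proof.
pose G (z : 'Hom(M, Z)) : cochain T Z := [ffun a => (z \o u a)%VF].
have GL : linear G by move=> c f g; apply/ffunP => a; rewrite !ffunE comp_lfunDl -comp_lfunZl.
have GE := linfun_ext GL; have [uD _ _] := uR.
have sG : (linfun G @: homs M Z <= dext T Z)%VS.
  by apply/subvP => _ /memv_imgP[z zH ->]; rewrite GE; apply: dext_compl.
suff <- : (linfun G @: homs M Z)%VS = dext T Z.
  by move=> /memv_imgP[z zH ->]; exists z => // a; rewrite GE ffunE.
apply/eqP; rewrite eqEdim sG dim_dext limg_dim_eq.
  have := euler_represents Z; rewrite /euler (represents_dim _ uR) opprB => /addrI/oppr_inj[->].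
  exact: leqnn.
apply/eqP; rewrite -subv0; apply/subvP => z /memv_capP[zH]; rewrite memv_ker GE memv0 => /eqP/ffunP z0.
by apply/eqP/represents_hom_inj => // a; have := z0 a; rewrite !ffunE.
Qed.
End NoProjectiveSummand.

(* tau^- applied to the sequence N -> T -> TA (+) I -> 0. *)
Lemma represents_cokernel (Q_acyclic : acyclic Q) T M (u : cochain T M) TA A (uA : cochain TA A)
    N I (g : 'Hom(N, T)) (h : 'Hom(T, dsum TA I)) :
  represents u -> no_projective_summand M -> represents uA -> no_projective_summand A ->
  injective_mod I -> is_hom g -> is_hom h -> limg h = fullv -> limg g = lker h ->
  exists z : 'Hom(M, A), [/\ is_hom z, limg z = fullv, (forall a, (z \o u a \o g)%VF = 0) &
    forall X (pi : 'Hom(M, X)), is_hom pi -> (forall a, (pi \o u a \o g)%VF = 0) ->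
      (lker z <= lker pi)%VS].
Proof.
move=> uR Mnps uAR Anps Iinj gH hH hS gh.
have [p1 p1H p1E] := dsum_fst TA I; have [j1 j1H j1E] := dsum_inl TA I.
have [j2 j2H j2E] := dsum_inr TA I.
have [uD _ _] := uR; have [uAD _ _] := uAR.
pose h1 := (p1 \o h)%VF; have h1H : is_hom h1 by apply: is_hom_comp.
have hg : (h \o g = 0)%VF.
  apply/lfunP => v; rewrite comp_lfunE zero_lfunE; apply/eqP.
  by rewrite -memv_ker -gh memv_img ?memvf.
have [z zH zE] := represents_hom_surj Q_acyclic uR Mnps (dext_compr h1H uAD).
have z_u a : (z \o u a = uA a \o h1)%VF by rewrite zE ffunE.
exists z; split=> //.
- have LS := stable_limg zH (stable_full M).
  pose c : 'Hom(A, quo_mod LS) := quo_proj _; have cH : is_hom c := quo_proj_hom LS.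
  (* The cokernel map c of z kills z o u = uA o h1, and h1 is surjective, so c kills uA. *)
  suff c0 : c = 0.
    by rewrite -(lker_quo_proj LS); apply/vspaceP => v; rewrite memvf memv_ker -/c c0 zero_lfunE eqxx.
  apply: (represents_hom_inj Q_acyclic uAR) => // a; apply/lfunP => t.
  have [s sE] := limg_fullP hS (t, 0).
  have -> : t = h1 s by rewrite comp_lfunE p1E -sE.
  rewrite comp_lfunE -[uA a _]comp_lfunE -z_u comp_lfunE zero_lfunE; apply/eqP.
  by rewrite -memv_ker /c (lker_quo_proj LS) memv_img ?memvf.
- by move=> a; rewrite z_u -!comp_lfunA hg !comp_lfun0r.
move=> X pi piH pi0.
(* The family pi o u vanishes on the image of g, which is the kernel of h, so it descends along h;
   the choice made by the linear inverse of h does not matter. *)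
pose chi : cochain (dsum TA I) X := [ffun a => (pi \o u a \o h^-1)%VF].
have chih a : (chi a \o h = pi \o u a)%VF.
  apply/lfunP => v; rewrite ffunE !comp_lfunE; apply/eqP; rewrite -subr_eq0 -!linearB.
  have : h^-1%VF (h v) - v \in lker h by rewrite memv_ker linearB /= limg_lfunVK ?memv_img ?memvf ?subrr.
  by rewrite -gh => /memv_imgP[w _ ->]; apply/eqP; have := pi0 a => /lfunP/(_ w); rewrite !comp_lfunE zero_lfunE.
have chiD : chi \in dext (dsum TA I) X.
  apply: (dmap_dextI (is_hom_id X) hH) => //; first by apply: lker0_eq => v; rewrite id_lfunE.
  suff -> : dmap \1%VF h chi = [ffun a => (pi \o u a)%VF] by apply: dext_compl.
  by apply/ffunP => a; rewrite [LHS]ffunE [RHS]ffunE comp_lfun1l chih.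
(* The component of chi on I lies in D Ext^1(X, I) = 0, so chi is determined on the summand TA and
   comes from a map A -> X. *)
have chi2 a v : chi a (0, v) = 0.
  have := dext_eq0 (injective_ext0 X Iinj) (dext_compr j2H chiD) a; rewrite ffunE => /lfunP/(_ v).
  by rewrite comp_lfunE j2E zero_lfunE.
have [xi xiH xiE] := represents_hom_surj Q_acyclic uAR Anps (dext_compr j1H chiD).
suff -> : pi = (xi \o z)%VF.
  by apply/subvP => v; rewrite !memv_ker comp_lfunE => /eqP ->; rewrite linear0.
apply: (represents_hom_eq Q_acyclic uR Mnps) => // [|a]; first exact: is_hom_comp.
rewrite -comp_lfunA z_u comp_lfunA xiE ffunE -chih.
apply/lfunP => t; rewrite !comp_lfunE j1E p1E.
have -> : h t = ((h t).1, 0) + (0, (h t).2) :> dsum TA I.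
  by rewrite [LHS]surjective_pairing; congr (_, _); rewrite ?addr0 ?add0r.
by rewrite linearD /= chi2 addr0 addr0.
Qed.
End RepresentingTheory.

(** * Fibers of quiver Grassmannians *)

Lemma card_subspace (k : finFieldType) (V : vectType k) (U : {vspace V}) :
  #|[set v : finvect_type V | (v : V) \in U]| = (#|k| ^ \dim U)%N.
Proof.
case: V U => T c U.
have <- := @card_vspace k (finvect_type (Vector.Pack c)) c U.
by apply: eq_card => v; rewrite inE.
Qed.

Section Fiber.
Variables (k : finFieldType) (m : nat) (Q : quiver m).
Variables (N E M : qmod k Q) (i : 'Hom(N, E)) (p : 'Hom(E, M)) (phi : cochain M N).
Hypotheses (ipE : short_exact i p) (ip_phi : extension_class i p phi).
Variables (V : {vspace N}) (U : {vspace M}) (VS : stable V) (US : stable U).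

Definition fiber : {set {vspace E}} :=
  [set Y | [&& stable Y, (i @^-1: Y)%VS == V & (p @: Y)%VS == U]].

Definition restr_class : cochain (sub_mod US) (quo_mod VS) :=
  [ffun a => (quo_proj V \o phi a \o incl US)%VF].

Local Notation HUV := 'Hom(sub_mod US, quo_mod VS).
Let pi : 'Hom(N, quo_mod VS) := quo_proj V.
Let phix (x : gen Q) (v : M) : N := if x is inr a then phi a v else 0.

(** A graded section splits E linearly as N (+) M. A subspace over (V, U) is then the set of
    elements whose M-part u lies in U and whose N-part is h(u) modulo V; [lifts h] is the condition
    for it to be a submodule. *)
Definition lifts (h : HUV) : Prop :=
  forall x u, h (act _ x u) = act _ x (h u) + pi (phix x (incl US u)).

Lemma lifts_coboundary h : lifts h -> h \in graded_maps _ _ /\ coboundary h = - restr_class.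
Proof.
move=> hL; split; first by apply/graded_mapsP => j u; rewrite hL /= linear0 addr0.
apply/ffunP => a; apply/lfunP => u; rewrite coboundaryE hL [in RHS]ffunE opp_lfunE ffunE !comp_lfunE.
by rewrite opprD addrA subrr add0r.
Qed.

Lemma coboundary_lifts h : h \in graded_maps _ _ -> coboundary h = - restr_class -> lifts h.
Proof.
move=> hG hc [j|a] u; first by rewrite /= linear0 addr0 (graded_mapsP _ hG).
have := congr1 (fun c : cochain (sub_mod US) (quo_mod VS) => c a u) hc.
rewrite coboundaryE [in RHS]ffunE opp_lfunE ffunE !comp_lfunE => /eqP.
by rewrite subr_eq addrC -subr_eq opprK => /eqP <-.
Qed.

(** The solutions form a coset of Hom(U, N/V) as soon as there is one, which happens exactly when
    the restricted class is a coboundary. *)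
Lemma card_lifts :
  #|[set h : finvect_type HUV | boolp.asbool (lifts h)]| =
  if restr_class \in coboundaries _ _ then (#|k| ^ \dim (homs (sub_mod US) (quo_mod VS)))%N else 0%N.
Proof.
case: ifP => [|/negP nC]; last first.
  apply: eq_card0 => h; rewrite inE; apply/negP => /boolp.asboolP/lifts_coboundary[hG hc].
  by apply: nC; rewrite -memvN -hc; apply/coboundariesP; exists h.
move=> /coboundariesP[h0 h0G h0c].
have h0L : lifts (- h0).
  by apply: coboundary_lifts; rewrite ?memvN // linearN h0c.
rewrite -card_subspace -[RHS](card_imset _ (addrI (- h0 : finvect_type HUV))).
apply: eq_card => h; rewrite [LHS]inE; apply/boolp.asboolP/imsetP => [hL|[f]].
  exists (h0 + h); last by rewrite addKr.
  rewrite inE; apply/is_homP => x u.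
  have h0E : h0 (act _ x u) = act _ x (h0 u) - pi (phix x (incl US u)).
    by have := h0L x u; rewrite !opp_lfunE linearN => /eqP; rewrite eqr_oppLR opprD opprK => /eqP.
  by rewrite !add_lfunE hL h0E linearD /= [in RHS]addrC addrACA addNr addr0 addrC.
rewrite inE => /is_homP fH -> x u; rewrite !add_lfunE h0L fH linearD /=.
by rewrite addrAC.
Qed.

Lemma card_fiber_lifts : #|fiber| = #|[set h : finvect_type HUV | boolp.asbool (lifts h)]|.
Proof.
have [/is_homP iH pH i0 ip pS] := ipE; have [s [sG ps sphi]] := ip_phi.
have iI := lker0_inj i0.
have psE v : p (s v) = v by rewrite -comp_lfunE ps id_lfunE.
have piE v : p (i v) = 0 by apply/eqP; rewrite -memv_ker -ip memv_img ?memvf.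
have sphiE a v : i (phi a v) = act E (inr a) (s v) - s (act M (inr a) v).
  by rewrite -comp_lfunE sphi add_lfunE opp_lfunE !comp_lfunE.
have sact x v : act E x (s v) = s (act M x v) + i (phix x v).
  case: x => [j|a] /=; first by rewrite linear0 addr0 (graded_mapsP _ sG).
  by rewrite sphiE [RHS]addrC subrK.
(* The linear retraction of E onto N that kills the image of s; it fails to be a homomorphism
   precisely by phi, see [rho_act]. *)
have [rho rhoE] : exists rho : 'Hom(E, N), forall e, i (rho e) = e - s (p e).
  exists (i^-1 \o (\1 - (s \o p)))%VF => e.
  rewrite !comp_lfunE add_lfunE opp_lfunE id_lfunE comp_lfunE limg_lfunVK // ip memv_ker.
  by rewrite linearB /= psE subrr.
have eE e : e = i (rho e) + s (p e) by rewrite rhoE subrK.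
have rho_i v : rho (i v) = v by apply: iI; rewrite rhoE piE linear0 subr0.
have rho_s v : rho (s v) = 0 by apply: iI; rewrite rhoE psE subrr linear0.
have rho_act x e : rho (act E x e) = act N x (rho e) + phix x (p e).
  rewrite {1}[e]eE linearD /= -iH sact addrCA -linearD /= linearD /= rho_s add0r rho_i.
  by [].
have UI u : u \in U -> exists u', incl US u' = u.
  by rewrite -{1}(limg_incl US) => /memv_imgP[u' _ ->]; exists u'.
have [ret retE] : exists ret : 'Hom(M, sub_mod US), forall u, ret (incl US u) = u.
  exists (corestr US \1%VF) => u; apply: (incl_injective (US := US)).
  by rewrite corestrE ?id_lfunE ?incl_mem.
pose Yof (h : finvect_type HUV) : {vspace E} := ((p @^-1: U) :&: lker ((pi \o rho)%VF - ((h : HUV) \o (ret \o p))%VF))%VS.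
have YofP h e : e \in Yof h <-> exists2 u, p e = incl US u & pi (rho e) = (h : HUV) u.
  rewrite memv_cap -memv_preim memv_ker add_lfunE opp_lfunE !comp_lfunE subr_eq0.
  split=> [/andP[/UI[u uE] /eqP E1]|[u uE E1]].
    by exists u => //; rewrite E1 -uE retE.
  by rewrite uE incl_mem E1 retE /=.
have YofE h e u : e \in Yof h -> p e = incl US u -> pi (rho e) = (h : HUV) u.
  by move=> /YofP[u1 pe1 ->]; rewrite pe1 => /incl_injective ->.
have pi_surj := limg_fullP (limg_quo_proj VS).
have pi0 v : (pi v == 0) = (v \in V) by rewrite -memv_ker (lker_quo_proj VS).
have pi_act x v : pi (act N x v) = act _ x (pi v) by rewrite (is_homP _ (quo_proj_hom VS)).
have Yof_elt h u : exists2 e, e \in Yof h & p e = incl US u.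
  have [v vE] := pi_surj ((h : HUV) u); exists (i v + s (incl US u)).
    apply/YofP; exists u; first by rewrite linearD /= piE add0r psE.
    by rewrite linearD /= rho_i rho_s addr0 -vE.
  by rewrite linearD /= piE add0r psE.
have Yof_inj : injective Yof.
  move=> h h' E1; apply/lfunP => u; have [e eY pe] := Yof_elt h u.
  by rewrite -(YofE h e u) // -(YofE h' e u) // -E1.
rewrite -(card_imset _ Yof_inj); apply: eq_card => Y; rewrite inE.
apply/and3P/imsetP => [[/stableP YS /eqP YV /eqP YU]|[h]].
  (* The value h(u) is the N-part modulo V of any element of Y over u. It is well defined because
     two such elements differ by an element of i(N) in Y, that is, of i(V). *)
  have [h hE] : exists h : HUV, forall u e, e \in Y -> p e = incl US u -> pi (rho e) = h u.
    pose pY := (p \o projv Y)%VF.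
    exists (pi \o (rho \o (projv Y \o (pY^-1 \o incl US))))%VF => u e eY pe.
    rewrite 4!comp_lfunE; set e' := projv Y _.
    have pe' : p e' = incl US u.
      rewrite -[p e']comp_lfunE -/pY limg_lfunVK // /pY limg_comp limg_proj YU; exact: incl_mem.
    apply/eqP; rewrite -subr_eq0 -!linearB pi0 -YV -memv_preim /= rhoE.
    by rewrite linearB /= pe pe' subrr linear0 subr0 memvB // memv_proj.
  have Y_elt u : exists2 e, e \in Y & p e = incl US u.
    have : incl US u \in (p @: Y)%VS by rewrite YU; apply: incl_mem.
    by move=> /memv_imgP[e eY ->]; exists e.
  exists (h : finvect_type HUV).
    rewrite inE; apply/boolp.asboolP => x u; have [e eY pe] := Y_elt u.
    rewrite -(hE _ (act E x e)) ?YS //; last by rewrite (is_homP _ pH) pe incl_act.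
    by rewrite rho_act linearD /= pi_act (hE u) // pe.
  apply/vspaceP => e; apply/idP/idP => [eY|/YofP[u pe he]].
    have : p e \in U by rewrite -YU memv_img.
    by move=> /UI[u ue]; apply/YofP; exists u => //; rewrite (hE u).
  have [e1 e1Y pe1] := Y_elt u; have := hE u e1 e1Y pe1; rewrite -he => /esym/eqP.
  rewrite -subr_eq0 -!linearB pi0 -YV -memv_preim /= rhoE linearB /= pe pe1 subrr linear0 subr0.
  by move=> /(memvD e1Y); rewrite addrC subrK.
rewrite inE => /boolp.asboolP hL ->; split.
- apply/stableP => x e /YofP[u pe he]; apply/YofP; exists (act _ x u).
    by rewrite (is_homP _ pH) pe incl_act.
  by rewrite rho_act linearD /= pi_act he hL pe.
- apply/eqP/vspaceP => v; rewrite -memv_preim -pi0; apply/idP/eqP => [ivY|v0].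
    by rewrite -(rho_i v) (YofE _ _ 0 ivY) ?linear0 // piE.
  by apply/YofP; exists 0; rewrite ?piE ?linear0 // rho_i.
apply/eqP/vspaceP => v; apply/memv_imgP/idP => [[e /YofP[u pe _] ->]|/UI[u <-]].
  by rewrite pe incl_mem.
by have [e eY pe] := Yof_elt h u; exists e.
Qed.

End Fiber.

Lemma pairingZ (k : finFieldType) m (Q : quiver m) (Y M : qmod k Q) c (theta : cochain Y M) phi :
  pairing (c *: theta) phi = c * pairing theta phi.
Proof. by rewrite -!pairmapE linearZ scale_lfunE. Qed.

(** * Restricting the extension class to a pair (V, U) *)

Section Restriction.
Variables (k : finFieldType) (m : nat) (Q : quiver m).
Variables (M N : qmod k Q).
Variables (V : {vspace N}) (U : {vspace M}) (VS : stable V) (US : stable U).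
Implicit Type phi : cochain M N.
Local Notation subU := (sub_mod US).
Local Notation quoV := (quo_mod VS).
Let q : 'Hom(N, quoV) := quo_proj V.
Let qH : is_hom q := quo_proj_hom VS.
Let qS : limg q = fullv := limg_quo_proj VS.
Let q0 v : (q v == 0) = (v \in V).
Proof. by rewrite -memv_ker (lker_quo_proj VS). Qed.
Let jH := incl_hom US.
Let j0 := incl_inj US.

Lemma restr_class_cocycle phi : phi \in cocycles M N -> restr_class phi VS US \in cocycles subU quoV.
Proof.
move=> pC; apply/cocyclesP/ffunP => a; apply/lfunP => v.
rewrite truncE [in LHS]ffunE [in RHS]ffunE !comp_lfunE -/q incl_act (cocycle_actr pC) eqxx.
by rewrite -(is_homP _ qH) (cocycle_actl pC) eqxx.
Qed.

Lemma pairing_restr_class phi (theta : cochain quoV subU) :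
  pairing theta (restr_class phi VS US) = pairing (dmap (incl US) q theta) phi.
Proof.
apply: eq_bigr => a _; rewrite !ffunE -/q -!comp_lfunA [RHS]lfun_traceC -!comp_lfunA.
by [].
Qed.

Section RankOne.
Variables (phi : cochain M N) (psi : cochain N M).
Hypotheses (phiC : phi \in cocycles M N) (phiB : phi \notin coboundaries M N).
Hypotheses (ext1 : ext_dim M N = 1%N) (psiD : psi \in dext N M) (psi0 : psi != 0).

Lemma dext_line theta : theta \in dext N M -> exists c, theta = c *: psi.
Proof.
move=> tD; suff : theta \in <[psi]>%VS by move=> /vlineP.
suff -> : <[psi]>%VS = dext N M by [].
by apply/eqP; rewrite eqEdim -memvE psiD dim_dext ext1 dim_vline psi0.
Qed.

(** The condition that psi factors as N -> N/V -> U -> M at every arrow, hence comes from [dext] of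
    N/V and U. *)
Definition linked : bool :=
  [forall a : arrow Q, (V <= lker (psi a))%VS && (limg (psi a) <= U)%VS].

(** The space [dext quoV subU] embeds into the line spanned by psi, so it is nonzero exactly when
    psi is in its image. *)
Lemma linkedP : linked = (ext_dim subU quoV != 0%N).
Proof.
rewrite -dim_dext dimv_eq0; apply/forallP/idP => [lk|]; last first.
  rewrite -subv0 => /subvPn[theta tD]; rewrite memv0 => t0.
  have [c cE] := dext_line (dmap_dext jH qH tD).
  have c0 : c != 0.
    apply: contraNneq t0 => c0; apply/eqP/(dmap_inj j0 qS).
    by rewrite cE c0 scale0r dmap0.
  have pE a v : psi a v = c^-1 *: incl US (theta a (q v)).
    by rewrite -dmapE cE ffunE scale_lfunE scalerA mulVf // scale1r.
  move=> a; apply/andP; split; apply/subvP => v.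
    move=> vV; rewrite memv_ker pE; have -> : q v = 0; last by rewrite !linear0.
    by apply/eqP; rewrite q0.
  by move=> /memv_imgP[w _ ->]; rewrite pE memvZ // incl_mem.
pose theta : cochain quoV subU := [ffun a => (corestr US (psi a) \o q^-1)%VF].
have tE : dmap (incl US) q theta = psi.
  apply/ffunP => a; apply/lfunP => v; have /andP[/subvP VK /subvP LU] := lk a.
  rewrite dmapE ffunE comp_lfunE corestrE; last by rewrite LU // memv_img ?memvf.
  apply/eqP; rewrite -subr_eq0 -linearB -memv_ker VK // -q0 linearB.
  by rewrite /= limg_lfunVK ?memv_img ?memvf // subrr.
have tD : theta \in dext quoV subU by apply: (dmap_dextI jH qH j0 qS); rewrite tE.
apply: contraNneq psi0 => d0; move: tD; rewrite d0 memv0 => /eqP t0.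
by rewrite -tE t0 dmap0.
Qed.

(** By adjunction, pairing theta with the restricted class is pairing the image of theta with phi.
    If theta is nonzero, its image spans [dext N M]; a restricted coboundary would then make phi
    orthogonal to all of it, so phi would be a coboundary. *)
Lemma restr_class_coboundary : (restr_class phi VS US \in coboundaries subU quoV) = ~~ linked.
Proof.
rewrite linkedP negbK; apply/idP/idP => [rB|/ext_dim0P e0].
  apply: contraT; rewrite -dim_dext dimv_eq0 -subv0 => /subvPn[theta tD]; rewrite memv0 => t0.
  case/negP: phiB; apply: coboundary_perp => // th thD.
  have [c cE] := dext_line thD; have [d dE] := dext_line (dmap_dext jH qH tD).
  have d0 : d != 0.
    apply: contraNneq t0 => d0; apply/eqP/(dmap_inj j0 qS).
    by rewrite dE d0 scale0r dmap0.
  have : pairing (dmap (incl US) q theta) phi = 0.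
    rewrite -pairing_restr_class; have /coboundariesP[h _ ->] := rB.
    exact: pairing_dext.
  by rewrite dE cE !pairingZ => /eqP; rewrite mulf_eq0 (negPf d0) /= => /eqP ->; rewrite mulr0.
apply: coboundary_perp; first exact: restr_class_cocycle.
by move=> theta; rewrite e0 memv0 => /eqP ->; rewrite -pairmapE linear0 zero_lfunE.
Qed.
End RankOne.
End Restriction.

(** * Socles *)

Section Socle.
Variables (k : finFieldType) (m : nat) (Q : quiver m).
Hypothesis Q_acyclic : acyclic Q.
Variable I : qmod k Q.
Implicit Types (U V : {vspace I}).

(* Following arrows out of a nonzero vector terminates in a vector killed by all
   arrows, because Q is acyclic. *)
Lemma stable_killed U : stable U -> U != 0%VS ->
  exists i v, [/\ v \in U, v != 0, act I (inl i) v = v & forall a, act I (inr a) v = 0].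
Proof.
move=> /stableP US; rewrite -subv0 => /subvPn[u uU]; rewrite memv0 => u0.
have [i iu] : exists i, act I (inl i) u != 0.
  apply/existsP; apply: contraNT u0; rewrite negb_exists => /forallP h.
  by rewrite -(act_sum u) big1 // => i _; apply/eqP; rewrite -[_ == _]negbK.
have gen n : forall i (w : seq (arrow Q)) (v : I), walk i w -> (size w + n = m)%N -> v \in U -> v != 0 ->
    act I (inl i) v = v ->
    exists i v, [/\ v \in U, v != 0, act I (inl i) v = v & forall a, act I (inr a) v = 0].
  elim: n => [|n IH] j w v wk sz vU v0 jv.
    by have := walk_size Q_acyclic wk; rewrite -[X in (_ < X)%N]sz addn0 ltnn.
  have [/forallP h|] := boolP [forall a, act I (inr a) v == 0].
    by exists j, v; split=> // a; apply/eqP.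
  rewrite negb_forall => /existsP[a av].
  have ja : j = tgt a.
    by apply/eqP; apply: contraNT av; rewrite -jv act_ar => /negPf ->.
  apply: (IH (src a) (a :: w) (act I (inr a) v)) => //; first by rewrite /= eqxx -ja.
    by rewrite addSn -addnS.
  exact: US.
  by rewrite act_la eqxx.
apply: (gen m i [::] (act I (inl i) u)) => //; first exact: US.
by rewrite act_ii eqxx.
Qed.

Lemma line_stable i v : act I (inl i) v = v -> (forall a, act I (inr a) v = 0) -> stable <[v]>%VS.
Proof.
move=> iv av; apply/stableP => x _ /vlineP[c ->]; rewrite linearZ memvZ //=.
case: x => [j|a]; last by rewrite av mem0v.
by rewrite -iv act_ii iv; case: eqP => [->|_]; rewrite ?mem0v // iv memv_line.
Qed.

Lemma soc_killed v a : v \in soc I -> act I (inr a) v = 0.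
Proof.
suff : (soc I <= lker (act I (inr a)))%VS by move=> /subvP sK /sK; rewrite memv_ker => /eqP.
apply/subv_sumP => U /and3P[US U0 /forallP Umin].
have [i [u [uU u0 iu au]]] := stable_killed US U0.
have := Umin <[u]>%VS; rewrite (line_stable iu au) -memvE uU /= => /orP[/eqP E|/eqP <-].
  by move: u0; rewrite -memv0 -E memv_line.
by rewrite -memvE memv_ker au.
Qed.

Lemma mem_soc i v : act I (inl i) v = v -> (forall a, act I (inr a) v = 0) -> v \in soc I.
Proof.
move=> iv av; have [->|v0] := eqVneq v 0; first exact: mem0v.
rewrite memvE; apply: (sumv_sup <[v]>%VS) => //; apply/and3P; split.
- exact: line_stable iv av.
- by rewrite -dimv_eq0 dim_vline v0.
apply/forallP => V; apply/implyP => /andP[_ Vv].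
have := dimvS Vv; rewrite dim_vline v0 leq_eqVlt ltnS leqn0 dimv_eq0 => /orP[dV|->] //.
by rewrite orbC eqEdim Vv dim_vline v0 (eqP dV).
Qed.

(** A homomorphism from a simple is determined by the image of 1, which can be any vector at vertex
    i killed by all arrows. For acyclic Q these vectors form the part of the socle at i. *)
Lemma dim_homs_simple i : \dim (homs (simple_mod k Q i) I) = dimv (soc_mod I) i.
Proof.
have -> : dimv (soc_mod I) i = \dim (act I (inl i) @: soc I)%VS.
  have /colP/(_ i) := dimvec_sub (soc_stable I); rewrite !mxE => -[].
  by [].
have [ev evE] : exists ev : 'Hom('Hom(simple_mod k Q i, I), I), forall f, ev f = f (1 : k^o).
  exists (linfun (fun f : 'Hom(simple_mod k Q i, I) => f (1 : k^o))) => f.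
  by rewrite linfun_ext // => c f1 f2; rewrite add_lfunE scale_lfunE.
have f1E (f : 'Hom(simple_mod k Q i, I)) (c : k^o) : f c = c *: f (1 : k^o).
  by rewrite -linearZ /=; congr (f _); rewrite /GRing.scale /= mulr1.
rewrite -(@limg_dim_eq _ _ _ ev); last first.
  apply/eqP; rewrite -subv0; apply/subvP => f /memv_capP[_].
  rewrite memv_ker memv0 evE => /eqP f0; apply/eqP/lfunP => c.
  by rewrite f1E f0 scaler0 zero_lfunE.
congr (\dim _); apply/vspaceP => v; apply/memv_imgP/memv_imgP => [[f /is_homP fH ->]|[u uS ->]].
  have e1 : act I (inl i) (f (1 : k^o)) = f (1 : k^o) by rewrite -fH /= eqxx id_lfunE.
  exists (f (1 : k^o)); last by rewrite evE e1.
  by apply: (mem_soc e1) => a; rewrite -fH /= zero_lfunE linear0.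
pose v' := act I (inl i) u.
exists (linfun (fun c : k^o => c *: v') : 'Hom(simple_mod k Q i, I)); last first.
  by rewrite evE linfun_ext ?scale1r // => c x y; rewrite scalerDl scalerA.
have LE (c : k^o) : linfun (fun c : k^o => c *: v') c = c *: v'.
  by rewrite linfun_ext // => b x y; rewrite scalerDl scalerA.
apply/is_homP => [[j|a]] c; rewrite /= !LE linearZ /= /v'.
  rewrite act_ii; case: eqP => [->|_]; first by rewrite id_lfunE.
  by rewrite zero_lfunE scale0r scaler0.
rewrite zero_lfunE scale0r act_ar; case: eqP => _; last by rewrite scaler0.
by rewrite soc_killed // scaler0.
Qed.

Lemma euler_simple_injective i : injective_mod I ->
  euler (simple_mod k Q i) I = (dimv (soc_mod I) i)%:Z.
Proof. by move=> Iinj; rewrite /euler injective_ext0 // subr0 dim_homs_simple. Qed.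
End Socle.

Lemma dimvec_simple (k : finFieldType) m (Q : quiver m) i :
  dimvec (simple_mod k Q i) = delta_mx i 0.
Proof.
apply/colP => j; rewrite !mxE eqxx andbT /dimv /=; case: eqP => _.
  by rewrite lim1g dimvf.
by rewrite lim0g dimv0.
Qed.

(** * Cluster characters *)

Section Characters.
Variables (k : finFieldType) (s : sqrt_card k) (m n : nat) (le_nm : (n <= m)%N).
Variables (Q : quiver m) (L : 'M[int]_m).
Local Notation mod := (qmod k Q).
Implicit Types M N P : mod.
Local Notation J := (Imx le_nm).
Local Notation R := (Rfull Q).

(** The m x n matrices of the statement are the first n columns of square ones, so for modules
    supported on Q all exponents can be computed in Z^m. *)
Definition Bfull : 'M[int]_m := R^T - R.

Lemma mulmx_Imx (A : 'M[int]_m) i j : (A *m J) i j = A i (vtx le_nm j).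
Proof.
rewrite mxE (bigD1 (vtx le_nm j)) //= mxE eqxx mulr1 big1 ?addr0 // => l lj.
by rewrite mxE (negPf lj) mulr0.
Qed.

Lemma Bmx_full : Bmx le_nm Q = Bfull *m J.
Proof. by apply/matrixP => i j; rewrite mulmx_Imx !mxE. Qed.

Lemma Rmx_full : Rmx k le_nm Q = R *m J.
Proof. by apply/matrixP => i j; rewrite mulmx_Imx !mxE ext_dim_simple. Qed.

Lemma vtx_inj : injective (vtx le_nm).
Proof. by move=> i j /(congr1 val) e; apply: val_inj. Qed.

Lemma Imx_supp (u : 'cV[int]_m) : (forall i : 'I_m, (n <= i)%N -> u i 0 = 0) ->
  J *m (\col_j u (vtx le_nm j) 0) = u.
Proof.
move=> u0; apply/colP => i; rewrite mxE; case: (ltnP i n) => [lt_in|ni].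
  have -> : i = vtx le_nm (Ordinal lt_in) by apply: val_inj.
  rewrite (bigD1 (Ordinal lt_in)) //= big1 ?addr0 => [|j ji]; rewrite !mxE ?eqxx ?mul1r //.
  by rewrite (inj_eq vtx_inj) eq_sym (negPf ji) mul0r.
rewrite u0 // big1 // => j _; rewrite !mxE -val_eqE /=; case: eqP => [ij|]; last by rewrite mul0r.
by have := ltn_ord j; rewrite -ij ltnNge ni.
Qed.

Lemma dimvec_supp M : supported n M -> J *m dimvecQ le_nm M = dimvec M.
Proof.
move=> Ms; rewrite -[RHS]Imx_supp => [|i ni]; last by rewrite mxE Ms.
by congr (_ *m _); apply/colP => j; rewrite !mxE.
Qed.

Definition dvsQ M (U : {vspace M}) : 'cV[int]_n :=
  \col_j (\dim (act M (inl (vtx le_nm j)) @: U))%:Z.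

Lemma dim_vertex_le M (U : {vspace M}) i : (\dim (act M (inl i) @: U) <= dimv M i)%N.
Proof. by apply/dimvS/limgS/subvf. Qed.

Lemma dvs_supp M (U : {vspace M}) : supported n M -> J *m dvsQ U = dvs U.
Proof.
move=> Ms; rewrite -[RHS]Imx_supp => [|i ni].
  by congr (_ *m _); apply/colP => j; rewrite !mxE.
by rewrite mxE; have := dim_vertex_le U i; rewrite Ms // leqn0 => /eqP ->.
Qed.

Lemma euler_form_full (u v : 'cV[int]_n) :
  euler_form k le_nm Q u v = eform Q (J *m u) (J *m v).
Proof.
pose S (l : 'I_m) := delta_mx l 0 : 'cV[int]_m.
have JE (w : 'cV[int]_n) : J *m w = \sum_i w i 0 *: S (vtx le_nm i).
  apply/colP => l; rewrite mxE summxE; apply: eq_bigr => i _.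
  by rewrite !mxE eqxx andbT mulrC.
have eZl c x y : eform Q (c *: x) y = c * eform Q x y.
  by rewrite /eform /Lform linearZ /= -!scalemxAl mxE.
have eZr c x y : eform Q x (c *: y) = c * eform Q x y.
  by rewrite /eform /Lform -scalemxAr mxE.
rewrite !JE (big_morph (eform Q ^~ _) (fun x y => eformDl Q x y _) (eform0l Q _)).
apply: eq_bigr => i _.
rewrite (big_morph (eform Q _) (eformDr Q _) (eform0r Q _)); apply: eq_bigr => j _.
by rewrite eZl eZr mulrA eulerE !dimvec_simple.
Qed.

(** The coefficient |Gr_e M| is unfolded into a sum over the submodules themselves, so that products
    and direct sums can be compared submodule by submodule. *)
Lemma CC_stable M P : supported n M ->
  CC s le_nm L M P = \sum_(U : {vspace M} | stable U)
    qpow s (- eform Q (dvs U) (dimvec M - dvs U)) *: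
      Xpow s L (Bfull *m dvs U - (1%:M - R) *m dimvec M + dimvec (top_mod P)).
Proof.
(* The default value of [inord] never occurs, because the dimension at a vertex is bounded by that
   of M. *)
move=> Ms; pose dU (U : {vspace M}) : {dffun forall j : 'I_n, 'I_(dimv M (vtx le_nm j)).+1} :=
  finfun (fun j => inord (\dim (act M (inl (vtx le_nm j)) @: U))).
rewrite (partition_big dU xpredT) //=; apply: eq_bigr => d _.
set e := \col_j _.
have eE U : (dU U == d) = [forall j : 'I_n, (\dim (act M (inl (vtx le_nm j)) @: U))%:Z == e j 0].
  apply/eqP/forallP => [E j|h].
    by rewrite mxE -E ffunE inordK // ltnS dim_vertex_le.
  apply/ffunP => j; rewrite ffunE; apply: val_inj => /=; have /eqP := h j; rewrite mxE => -[->].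
  by rewrite inordK // -ltnS ltn_ord.
have dE U : dU U == d -> dvsQ U = e.
  by rewrite eE => /forallP h; apply/colP => j; have /eqP := h j; rewrite [in RHS]mxE mxE => ->; rewrite mxE.
rewrite [RHS](eq_bigr (fun=> qpow s (- euler_form k le_nm Q e (dimvecQ le_nm M - e)) *:
      Xpow s L (Bmx le_nm Q *m e - (J - Rmx k le_nm Q) *m dimvecQ le_nm M + dimvec (top_mod P)))).
  rewrite sumr_const -scaler_nat scalerA.
  suff -> : #|(fun U => stable U && (dU U == d)) : pred {vspace M}| = #|Gr le_nm M e| by [].
  by apply: eq_card => U; rewrite !inE [in LHS]unfold_in eE.
move=> U /andP[_ /dE <-].
have e1 : Bmx le_nm Q *m dvsQ U = Bfull *m dvs U by rewrite Bmx_full -mulmxA (dvs_supp _ Ms).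
have e2 : (J - Rmx k le_nm Q) *m dimvecQ le_nm M = (1%:M - R) *m dimvec M.
  by rewrite Rmx_full mulmxBl -mulmxA (dimvec_supp Ms) mulmxBl mul1mx.
have e3 : euler_form k le_nm Q (dvsQ U) (dimvecQ le_nm M - dvsQ U) = eform Q (dvs U) (dimvec M - dvs U).
  by rewrite euler_form_full mulmxBr (dvs_supp _ Ms) (dimvec_supp Ms).
by rewrite e1 e2 e3.
Qed.
End Characters.

Lemma qpow_card (k : finFieldType) (s : sqrt_card k) (d : nat) :
  qpow s (2 * d%:Z) = (#|k| ^ d)%N%:R.
Proof.
apply: val_inj; rewrite rmorph_nat /= natrX -(sqrt_valP s) -exprM.
by rewrite -PoszM.
Qed.

(** * Multiplying monomials under the compatibility condition *)

Section Product.
Variables (k : finFieldType) (s : sqrt_card k) (m n : nat) (le_nm : (n <= m)%N).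
Variables (Q : quiver m) (L : 'M[int]_m).
Hypotheses (L_anti : L^T = - L) (L_compat : L *m (- Bmx le_nm Q) = Imx le_nm).
Local Notation mod := (qmod k Q).
Local Notation K := (1%:M - Rfull Q).
Local Notation e := (eform Q).

(** Compatibility says that Lambda inverts - B on the first n columns, so u has to be supported on
    the unfrozen vertices. *)
Lemma Lform_compat_r (x u : 'cV[int]_m) (u' : 'cV[int]_n) : u = Imx le_nm *m u' ->
  Lform L x (Bfull Q *m u) = - (x^T *m u) 0 0.
Proof.
move=> uE; rewrite /Lform.
have -> : x^T *m L *m (Bfull Q *m u) = - (x^T *m u).
  rewrite -mulmxA -mulmxN; congr (_ *m _).
  by rewrite {1}uE !mulmxA -[L *m _ *m _]mulmxA -Bmx_full -[in LHS](opprK (Bmx _ _)) mulmxN L_compat mulNmx -uE.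
by rewrite mxE.
Qed.

Lemma LformC x y : Lform L x y = - Lform L y x.
Proof.
rewrite /Lform -[in LHS](trmxK (x^T *m L *m y)) [LHS]mxE !trmx_mul trmxK L_anti.
by rewrite mulNmx mulmxN mxE mulmxA.
Qed.

Lemma LformNl x y : Lform L (- x) y = - Lform L x y.
Proof. by rewrite /Lform linearN /= !mulNmx mxE. Qed.
Lemma LformNr x y : Lform L x (- y) = - Lform L x y.
Proof. by rewrite /Lform mulmxN mxE. Qed.

Lemma col_dotC (x y : 'cV[int]_m) : (x^T *m y) 0 0 = (y^T *m x) 0 0.
Proof. by rewrite -[in LHS](trmxK (x^T *m y)) [LHS]mxE trmx_mul trmxK. Qed.

Lemma eform_Kr x y : e x y = (x^T *m (K *m y)) 0 0.
Proof. by rewrite /eform /Lform mulmxA. Qed.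

Lemma dot_Bfull x y : (x^T *m (Bfull Q *m y)) 0 0 = e x y - e y x.
Proof.
have BE : Bfull Q = K - K^T.
  by rewrite /Bfull linearB /= trmx1 opprB [RHS]addrC addrA addrNK.
rewrite BE mulmxBl mulmxBr mxE [X in _ + X]mxE -eform_Kr; congr (_ - _).
by rewrite mulmxA -trmx_mul col_dotC eform_Kr.
Qed.

Lemma Lform_exponents nn mm v u (v' u' : 'cV[int]_n) : v = Imx le_nm *m v' -> u = Imx le_nm *m u' ->
  Lform L (Bfull Q *m v - K *m nn) (Bfull Q *m u - K *m mm) =
  Lform L (K *m nn) (K *m mm) + e v u - e u v - e v mm + e u nn.
Proof.
move=> vE uE; rewrite !LformDl !LformDr !LformNl !LformNr (LformC _ (K *m mm)).
rewrite !(Lform_compat_r _ uE) (Lform_compat_r _ vE).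
rewrite [((Bfull Q *m v)^T *m u) 0 0]col_dotC dot_Bfull.
rewrite [(_^T *m v) 0 0]col_dotC [((K *m nn)^T *m u) 0 0]col_dotC -!eform_Kr.
lia.
Qed.

Lemma scale_Xpow (a : coef s) x : a *: Xpow s L x = << a *g x >>.
Proof.
apply/malgP => y; have -> : (a *: Xpow s L x)@_y = a * << x >>@_y by apply: mcoeffZ.
rewrite [in LHS]mcoeffU [RHS]mcoeffU mulrnAr mulr1; reflexivity.
Qed.

Lemma scale_Xpow_eq (a b : int) (x y : 'cV[int]_m) : a = b -> x = y ->
  qpow s a *: Xpow s L x = qpow s b *: Xpow s L y.
Proof. by move=> -> ->. Qed.

Lemma scale_XpowM (a b : coef s) x y : (a *: Xpow s L x) * (b *: Xpow s L y) =
  (a * b * qpow s (Lform L x y)) *: Xpow s L (x + y).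
Proof. by rewrite !scale_Xpow; apply: qt_mulUU. Qed.

(** Apart from the factor q^<U, N/V>, the product depends on V and U only through [dvs V + dvs U],
    in the way a term of X_E depends on the dimension vector of its submodule. The 2 appears because
    [qpow] counts half powers of q. *)
Lemma CC_mul (M N : mod) (V : {vspace N}) (U : {vspace M}) : supported n M -> supported n N ->
  (qpow s (- e (dvs V) (dimvec N - dvs V)) *: Xpow s L (Bfull Q *m dvs V - K *m dimvec N)) *
  (qpow s (- e (dvs U) (dimvec M - dvs U)) *: Xpow s L (Bfull Q *m dvs U - K *m dimvec M)) =
  qpow s (2 * e (dvs U) (dimvec N - dvs V)) *:
   (qpow s (Lform L (K *m dimvec N) (K *m dimvec M)
       - e (dvs V + dvs U) (dimvec N + dimvec M - (dvs V + dvs U))) *: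
    Xpow s L (Bfull Q *m (dvs V + dvs U) - K *m (dimvec N + dimvec M))).
Proof.
move=> Ms Ns.
rewrite scale_XpowM scalerA -!qpowD; apply: scale_Xpow_eq.
  rewrite (Lform_exponents _ _ (esym (dvs_supp le_nm V Ns)) (esym (dvs_supp le_nm U Ms))).
  rewrite !eformDl !eformDr !eformNr !eformDr; lia.
by rewrite !mulmxDr opprD addrACA.
Qed.
End Product.

(** * Sums over submodules along exact sequences *)

Section Sums.
Variables (k : finFieldType) (m : nat) (Q : quiver m).
Local Notation mod := (qmod k Q).

Section Exact.
Variables (N E M : mod) (i : 'Hom(N, E)) (p : 'Hom(E, M)).
Hypothesis ipE : short_exact i p.

Lemma dvs_exact (Y : {vspace E}) : stable Y -> dvs Y = dvs (i @^-1: Y)%VS + dvs (p @: Y)%VS.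
Proof.
move=> YS; have [iH pH i0 ip pS] := ipE; rewrite (dvs_limg pH YS); congr (_ + _).
rewrite -(dvs_inj iH) //; last exact: stable_preim.
congr dvs; apply/vspaceP => v; rewrite memv_cap -ip; apply/andP/memv_imgP => [[vY /memv_imgP[u _ uE]]|[u]].
  by exists u => //; rewrite -memv_preim -uE.
by rewrite -memv_preim => uY ->; rewrite memv_img ?memvf.
Qed.

Lemma dimvec_exact : dimvec E = dimvec N + dimvec M.
Proof.
have [iH pH i0 ip pS] := ipE; rewrite (dimvec_surj pH pS) -ip; congr (_ + _).
by rewrite (dvs_inj iH) ?stable_full.
Qed.

Lemma sum_stable_exact (W : zmodType) (T : 'cV[int]_m -> W) :
  \sum_(Y : {vspace E} | stable Y) T (dvs Y) =
  \sum_(V : {vspace N} | stable V) \sum_(U : {vspace M} | stable U)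
     T (dvs V + dvs U) *+ #|fiber i p V U|.
Proof.
have [iH pH _ _ _] := ipE.
rewrite (partition_big (fun Y : {vspace E} => i @^-1: Y)%VS (@stable _ _ _ N)) /=; last first.
  by move=> Y; apply: stable_preim.
apply: eq_bigr => V _.
rewrite (partition_big (fun Y : {vspace E} => p @: Y)%VS (@stable _ _ _ M)) /=; last first.
  by move=> Y /andP[YS _]; apply: stable_limg.
apply: eq_bigr => U _; rewrite -sumr_const; apply: eq_big => Y.
  by rewrite inE andbA.
by move=> /andP[/andP[YS /eqP <-] /eqP <-]; rewrite dvs_exact.
Qed.
End Exact.

Lemma sum_stable_inj (D N : mod) (f : 'Hom(D, N)) (W : zmodType) (T : {vspace N} -> W) :
  is_hom f -> lker f = 0%VS ->
  \sum_(V : {vspace N} | stable V && (V <= limg f)%VS) T V =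
  \sum_(V : {vspace D} | stable V) T (f @: V)%VS.
Proof.
move=> fH f0; rewrite (reindex_onto (fun V : {vspace D} => f @: V)%VS (fun V => f @^-1: V)%VS) /=; last first.
  by move=> V /andP[_ Vf]; apply: lpreimK.
apply: eq_bigl => V; have -> : (f @^-1: (f @: V) == V)%VS.
  apply/eqP/vspaceP => v; rewrite -memv_preim; apply/memv_imgP/idP => [[u uV /(lker0_inj f0) ->]|vV] //.
  by exists v.
rewrite andbT limgS ?subvf // andbT; apply/idP/idP => [fS|VS]; last exact: stable_limg.
apply/stableP => x v vV; have := stableP _ fS x (f v) (memv_img f vV).
by rewrite -(is_homP _ fH) => /memv_imgP[u uV /(lker0_inj f0) ->].
Qed.

Lemma sum_stable_surj (M C : mod) (z : 'Hom(M, C)) (W : zmodType) (T : {vspace M} -> W) :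
  is_hom z -> limg z = fullv ->
  \sum_(U : {vspace M} | stable U && (lker z <= U)%VS) T U =
  \sum_(U : {vspace C} | stable U) T (z @^-1: U)%VS.
Proof.
move=> zH zS; rewrite (reindex_onto (fun U : {vspace C} => z @^-1: U)%VS (fun U => z @: U)%VS) /=; last first.
  move=> U /andP[_ kU]; apply/vspaceP => v; rewrite -memv_preim; apply/memv_imgP/idP => [[u uU vu]|vU].
    rewrite -(subrK u v) memvD //; apply: (subvP kU).
    by rewrite memv_ker linearB /= vu subrr.
  by exists v.
apply: eq_bigl => U; rewrite lpreimK ?zS ?subvf // eqxx andbT.
have -> : (lker z <= z @^-1: U)%VS by rewrite -lpreim0 lpreimS ?sub0v.
rewrite andbT; apply/idP/idP => [pS|]; last exact: stable_preim.
by rewrite -[U](lpreimK (f := z)) ?zS ?subvf // stable_limg.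
Qed.

Lemma dvs_preim (M C : mod) (z : 'Hom(M, C)) (U : {vspace C}) : is_hom z -> limg z = fullv ->
  stable U -> dvs (z @^-1: U)%VS = dvs (lker z) + dvs U.
Proof.
move=> zH zS US; rewrite (dvs_limg zH) ?stable_preim // lpreimK ?zS ?subvf //.
by congr (dvs _ + _); apply/capv_idPr; rewrite -lpreim0 lpreimS ?sub0v.
Qed.

Lemma isomorphic_dsum (M M' P : mod) : isomorphic M (dsum M' P) ->
  exists (q : 'Hom(M, M')) (q0 : 'Hom(M, P)) (j : 'Hom(M', M)) (j0 : 'Hom(P, M)),
  [/\ [/\ is_hom q, is_hom q0, is_hom j & is_hom j0],
      (q \o j = \1)%VF, [/\ (q \o j0 = 0)%VF, (q0 \o j = 0)%VF & (q0 \o j0 = \1)%VF] &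
      forall v, v = j (q v) + j0 (q0 v)].
Proof.
case=> F [FH F0 FS].
have [G GH GF] : exists2 G : 'Hom(dsum M' P, M), is_hom G & (G \o F = \1)%VF.
  by apply: factor_surj => //; [apply: is_hom_id | rewrite F0 sub0v].
have GFE v : G (F v) = v by rewrite -comp_lfunE GF id_lfunE.
have FGE w : F (G w) = w by have [v ->] := limg_fullP FS w; rewrite GFE.
have [p1 p1H p1E] := dsum_fst M' P; have [p2 p2H p2E] := dsum_snd M' P.
have [j1 j1H j1E] := dsum_inl M' P; have [j2 j2H j2E] := dsum_inr M' P.
exists (p1 \o F)%VF, (p2 \o F)%VF, (G \o j1)%VF, (G \o j2)%VF; split.
- by split; apply: is_hom_comp.
- by apply/lfunP => v; rewrite !comp_lfunE FGE p1E j1E id_lfunE.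
- by split; apply/lfunP => v; rewrite !comp_lfunE FGE ?p1E ?p2E ?j1E ?j2E ?id_lfunE ?zero_lfunE.
move=> v; rewrite !comp_lfunE -linearD -[LHS]GFE; congr (G _).
rewrite j1E j2E p1E p2E [LHS]surjective_pairing; congr (_, _); rewrite ?addr0 ?add0r //.
Qed.

End Sums.

Section FiberCount.
Variables (k : finFieldType) (s : sqrt_card k) (m : nat) (Q : quiver m).
Local Notation e := (eform Q).
Variables (N E M : qmod k Q) (i : 'Hom(N, E)) (p : 'Hom(E, M)) (phi : cochain M N).
Hypotheses (ipE : short_exact i p) (ip_phi : extension_class i p phi) (phiC : phi \in cocycles M N).
Variables (V : {vspace N}) (U : {vspace M}) (VS : stable V) (US : stable U).

Lemma card_fiber_ext0 : ext_dim (sub_mod US) (quo_mod VS) = 0%N ->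
  #|fiber i p V U|%:R = qpow s (2 * e (dvs U) (dimvec N - dvs V)).
Proof.
move=> e0; rewrite (card_fiber_lifts ipE ip_phi VS US) card_lifts.
have -> : restr_class phi VS US \in coboundaries (sub_mod US) (quo_mod VS).
  apply: coboundary_perp; first exact: restr_class_cocycle.
  by move/eqP/ext_dim0P: e0 => -> theta; rewrite memv0 => /eqP ->; rewrite -pairmapE linear0 zero_lfunE.
rewrite -(qpow_card s) -(dimvec_sub US) -(dimvec_quo VS) -eulerE /euler e0 subr0.
by [].
Qed.

(** Each pair contributes its full weight exactly once: through the fiber when it is not linked,
    through the correction term when it is linked and the fiber is empty. *)
Lemma card_fiber_linked psi : phi \notin coboundaries M N -> ext_dim M N = 1%N ->
  psi \in dext N M -> psi != 0 ->
  qpow s (2 * e (dvs U) (dimvec N - dvs V)) =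
  #|fiber i p V U|%:R + (if linked V U psi then qpow s (2 * e (dvs U) (dimvec N - dvs V)) else 0).
Proof.
move=> phiB ext1 psiD psi0; have lkE := linkedP VS US ext1 psiD psi0.
case: ifP => lk; last first.
  rewrite addr0 card_fiber_ext0 //; apply/eqP.
  by rewrite lk in lkE; rewrite -[_ == _]negbK -lkE.
rewrite (card_fiber_lifts ipE ip_phi VS US) card_lifts.
by rewrite (restr_class_coboundary VS US phiC phiB ext1 psiD psi0) lk add0r.
Qed.
End FiberCount.

(** * Vanishing against I, the socle exponent and the multiplication formula *)

Section Main.
Variables (k : finFieldType) (m : nat) (Q : quiver m).
Local Notation mod := (qmod k Q).
Local Notation e := (eform Q).

Lemma homs0P (X Y : mod) : homs X Y = 0%VS -> forall f : 'Hom(X, Y), is_hom f -> f = 0.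
Proof. by move=> h f; rewrite /is_hom h memv0 => /eqP. Qed.

(** A map from a submodule to I extends to X by injectivity, so Hom(W, I) vanishes along with Hom(X,
    I). *)
Lemma eform_sub_injective (X I : mod) (W : {vspace X}) : injective_mod I -> homs X I = 0%VS ->
  stable W -> e (dvs W) (dimvec I) = 0.
Proof.
move=> Iinj h0 WS; rewrite -(dimvec_sub WS) -eulerE /euler injective_ext0 // subr0.
suff -> : homs (sub_mod WS) I = 0%VS by rewrite dimv0.
apply/eqP; rewrite -subv0; apply/subvP => f fH; rewrite memv0.
have [f' f'H <-] := Iinj _ _ _ f (incl_hom WS) (incl_inj WS) fH.
by rewrite (homs0P h0 f'H) comp_lfun0l.
Qed.

Lemma homs_dsum_eq0 (X Y Z : mod) : homs X (dsum Y Z) = 0%VS -> homs X Y = 0%VS /\ homs X Z = 0%VS.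
Proof.
move=> h0; have [j jH jE] := dsum_inl Y Z; have [j' j'H j'E] := dsum_inr Y Z.
split; apply/eqP; rewrite -subv0; apply/subvP => f fH; rewrite memv0; apply/eqP/lfunP => v.
  have /lfunP/(_ v) := homs0P h0 (is_hom_comp jH fH).
  by rewrite comp_lfunE !zero_lfunE jE => -[].
have /lfunP/(_ v) := homs0P h0 (is_hom_comp j'H fH).
by rewrite comp_lfunE !zero_lfunE j'E => -[].
Qed.

Lemma dsum_split (X Y : mod) : exists (i : 'Hom(X, dsum X Y)) (p : 'Hom(dsum X Y, Y)),
  short_exact i p /\ extension_class i p (0 : cochain Y X).
Proof.
have [i iH iE] := dsum_inl X Y; have [p pH pE] := dsum_snd X Y.
have [s sH sE] := dsum_inr X Y; exists i, p; split.
  split=> //; [by apply: lker0_eq => v; rewrite iE => -[] | | by apply: limg_full => v; exists (0, v); rewrite pE].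
  apply/vspaceP => v; rewrite memv_ker pE; apply/memv_imgP/eqP => [[u _ ->]|v0]; first by rewrite iE.
  by exists v.1; rewrite ?memvf // iE -v0; case: (v).
exists s; split; first exact: is_hom_graded.
  by apply/lfunP => v; rewrite comp_lfunE pE sE id_lfunE.
move=> a; apply/lfunP => v; rewrite ffunE comp_lfun0r add_lfunE opp_lfunE !comp_lfunE zero_lfunE.
by rewrite (is_homP _ sH) subrr.
Qed.

(** The left side equals - (K^T beta + K gamma), with K = 1 - R. Its coordinate at l is the
    hypothesis tested on S_l, where <S_l, I> is the multiplicity of S_l in the socle of I. *)
Lemma socle_exponent (Q_acyclic : acyclic Q) (I : mod) (beta gamma : 'cV[int]_m) : injective_mod I ->
  (forall X : mod, e beta (dimvec X) + e (dimvec X) gamma = - e (dimvec X) (dimvec I)) ->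
  Bfull Q *m beta - (1%:M - Rfull Q) *m (beta + gamma) = dimvec (soc_mod I).
Proof.
move=> Iinj key; apply/colP => l; set K := 1%:M - Rfull Q.
have BE : Bfull Q = K - K^T.
  by rewrite /Bfull linearB /= trmx1 opprB [RHS]addrC addrA addrNK.
have dl (x : 'cV[int]_m) : ((delta_mx l 0 : 'cV[int]_m)^T *m x) 0 0 = x l 0.
  rewrite mxE (bigD1 l) //= big1 ?addr0 => [|l' ll]; rewrite !mxE !eqxx ?mul1r //.
  by rewrite (negPf ll) mul0r.
have := key (simple_mod k Q l); rewrite -!eulerE !eulerE -[in RHS]eulerE euler_simple_injective //.
rewrite dimvec_simple [e (delta_mx l 0) gamma]eform_Kr dl.
have -> : e beta (delta_mx l 0 : 'cV[int]_m) = (K^T *m beta) l 0.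
  by rewrite eform_Kr col_dotC trmx_mul -mulmxA dl.
move=> h; have -> : Bfull Q *m beta - K *m (beta + gamma) = - (K^T *m beta + K *m gamma).
  by rewrite BE mulmxBl mulmxDr !opprD addrACA subrr add0r.
by rewrite [LHS]mxE [X in - X]mxE h opprK [RHS]mxE.
Qed.
End Main.

Lemma dvs_zero_mod (k : finFieldType) m (Q : quiver m) (U : {vspace zero_mod k Q}) : dvs U = 0.
Proof. by apply/colP => i; rewrite !mxE lim0g dimv0. Qed.

Lemma CC0_stable (k : finFieldType) (s : sqrt_card k) (m n : nat) (le_nm : (n <= m)%N)
    (Q : quiver m) (L : 'M[int]_m) (M : qmod k Q) : supported n M ->
  CC0 s le_nm L M = \sum_(U : {vspace M} | stable U)
    qpow s (- eform Q (dvs U) (dimvec M - dvs U)) *: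
      Xpow s L (Bfull Q *m dvs U - (1%:M - Rfull Q) *m dimvec M).
Proof.
move=> Ms; rewrite /CC0 (CC_stable s le_nm L _ Ms); apply: eq_bigr => U _.
have -> : dimvec (top_mod (zero_mod k Q)) = 0; last by rewrite addr0.
by rewrite /top_mod dimvec_quo -dvs_full !dvs_zero_mod subrr.
Qed.

(* The first summand collects the pairs (V, U) whose fiber in Gr(E) has the expected
   size; the linked pairs, on which it is empty, give the second summand. *)
Lemma CC0_mul (k : finFieldType) (s : sqrt_card k) (m n : nat) (le_nm : (n <= m)%N)
    (Q : quiver m) (L : 'M[int]_m) (N E M : qmod k Q) (i : 'Hom(N, E)) (p : 'Hom(E, M))
    (phi : cochain M N) (psi : cochain N M) :
  L^T = - L -> L *m (- Bmx le_nm Q) = Imx le_nm ->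
  supported n M -> supported n N -> short_exact i p -> extension_class i p phi ->
  phi \in cocycles M N -> phi \notin coboundaries M N -> ext_dim M N = 1%N ->
  psi \in dext N M -> psi != 0 ->
  let K := 1%:M - Rfull Q in
  let c := Lform L (K *m dimvec N) (K *m dimvec M) in
  let nm := dimvec N + dimvec M in
  CC0 s le_nm L N * CC0 s le_nm L M = qpow s c *: CC0 s le_nm L E +
    \sum_(V : {vspace N} | stable V) \sum_(U : {vspace M} | stable U && linked V U psi)
      qpow s (2 * eform Q (dvs U) (dimvec N - dvs V) + c
              - eform Q (dvs V + dvs U) (nm - (dvs V + dvs U))) *:
      Xpow s L (Bfull Q *m (dvs V + dvs U) - K *m nm).
Proof.
move=> L_anti L_compat Ms Ns ipE ip_phi phiC phiB ext1 psiD psi0 K c nm.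
have Es : supported n E.
  move=> l nl; have /colP/(_ l) := dimvec_exact ipE; rewrite !mxE Ms // Ns //; lia.
rewrite (CC0_stable s le_nm L Ns) (CC0_stable s le_nm L Ms) (CC0_stable s le_nm L Es) big_distrlr.
pose G w := qpow s (c - eform Q w (nm - w)) *: Xpow s L (Bfull Q *m w - K *m nm).
rewrite scaler_sumr (eq_bigr (fun Y : {vspace E} => G (dvs Y))); last first.
  by move=> Y _; rewrite scalerA -qpowD (dimvec_exact ipE).
rewrite (sum_stable_exact ipE) -big_split; apply: eq_bigr => V VS /=.
rewrite [X in _ = _ + X]big_mkcondr -big_split; apply: eq_bigr => U US /=.
rewrite (CC_mul s L_anti L_compat _ _ Ms Ns) -/c -/nm -/K -/(G _).
rewrite (card_fiber_linked s ipE ip_phi phiC VS US phiB ext1 psiD psi0) scalerDl scaler_nat.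
congr (_ + _); case: ifP => _; last by rewrite scale0r.
by rewrite scalerA -qpowD addrA.
Qed.

Lemma ext_dim0_sub_quo (k : finFieldType) m (Q : quiver m) (M N : qmod k Q)
    (V : {vspace N}) (U : {vspace M}) (VS : stable V) (US : stable U) :
  ext_dim M N = 0%N -> ext_dim (sub_mod US) (quo_mod VS) = 0%N.
Proof.
move=> e0; apply/eqP; rewrite -leqn0 -e0.
exact: ext_dim_leq (incl_hom US) (quo_proj_hom VS) (incl_inj US) (limg_quo_proj VS).
Qed.

Lemma CC_dsum (k : finFieldType) (s : sqrt_card k) (m n : nat) (le_nm : (n <= m)%N)
    (Q : quiver m) (L : 'M[int]_m) (D A P : qmod k Q) :
  supported n D -> supported n A -> ext_dim A D = 0%N ->
  let da := dimvec D + dimvec A in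
  CC s le_nm L (dsum D A) P =
    \sum_(V : {vspace D} | stable V) \sum_(U : {vspace A} | stable U)
      qpow s (2 * eform Q (dvs U) (dimvec D - dvs V)
              - eform Q (dvs V + dvs U) (da - (dvs V + dvs U))) *:
      Xpow s L (Bfull Q *m (dvs V + dvs U) - (1%:M - Rfull Q) *m da + dimvec (top_mod P)).
Proof.
move=> Ds As e0 da; have [i [p [ipE ip0]]] := dsum_split D A.
have dE : dimvec (dsum D A) = da by apply: dimvec_dsum.
have Xs : supported n (dsum D A).
  by move=> l nl; have /colP/(_ l) := dE; rewrite !mxE Ds // As //; lia.
rewrite (CC_stable s le_nm L P Xs) dE.
rewrite (sum_stable_exact ipE (fun w => qpow s (- eform Q w (da - w)) *:
  Xpow s L (Bfull Q *m w - (1%:M - Rfull Q) *m da + dimvec (top_mod P)))).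
apply: eq_bigr => V VS; apply: eq_bigr => U US.
have z0 : (0 : cochain A D) \in cocycles A D by apply: mem0v.
rewrite -scaler_nat (card_fiber_ext0 s ipE ip0 z0 (ext_dim0_sub_quo VS US e0)) scalerA -qpowD.
by [].
Qed.

Theorem theorem3p5 (k : finFieldType) (s : sqrt_card k) (m n : nat)
  (n_gt0 : (0 < n)%N) (le_nm : (n <= m)%N)
  (Q : quiver m) (Q_acyclic : acyclic Q)
  (L : 'M[int]_m) (L_anti : L^T = - L)
  (L_compat : L *m (- Bmx le_nm Q) = Imx le_nm)
  (M N : qmod k Q) (M_supp : supported n M) (N_supp : supported n N)
  (ext_MN : ext_dim M N = 1%N)
  (hom_NtM : \dim (homs N (tau M)) = 1%N)
  (E : qmod k Q) (i : 'Hom(N, E)) (p : 'Hom(E, M))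
  (NEM_exact : short_exact i p)
  (NEM_basis : exists2 phi, extension_class i p phi & ext_basis phi)
  (D0 A I : qmod k Q) (I_inj : injective_mod I) (A_noproj : no_projective_summand A)
  (f : 'Hom(D0, N)) (g : 'Hom(N, tau M)) (h : 'Hom(tau M, dsum (tau A) I))
  (fgh_exact : exact4 f g h)
  (g_basis : basis_of (homs N (tau M)) [:: g])
  (M' P0 : qmod k Q) (M_dec : isomorphic M (dsum M' P0))
  (P0_proj : projective P0) (M'_noproj : no_projective_summand M')
  (hom_D0 : homs D0 (dsum (tau (dsum A P0)) I) = 0%VS)
  (hom_A0 : homs (dsum A P0) I = 0%VS)
  (P : qmod k Q) (P_proj : projective P)
  (P_I : isomorphic (soc_mod I) (top_mod P)) :
  let A0 := dsum A P0 in
  let m_ := dimvecQ le_nm M in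
  let n_ := dimvecQ le_nm N in
  let IR := Imx le_nm - Rmx k le_nm Q in
  let c := Lform L (IR *m n_) (IR *m m_) in
  CC0 s le_nm L N * CC0 s le_nm L M =
    qpow s c *: CC0 s le_nm L E
    + qpow s (c + euler M N - euler A0 D0) *: CC s le_nm L (dsum D0 A0) P.
Proof.
move=> A0 m_ n_ IR c.
have [phi ip_phi /and3P[phiC phiB _]] := NEM_basis.
have [q [q0 [j [j0 [[qH q0H jH j0H] qj [qj0 q0j q0j0] vE]]]]] := isomorphic_dsum M_dec.
have uR := tau_represents Q_acyclic M; set u := tau_univ M in uR.
(* Although [tau M] is built from M, it is used as the module representing the functor of M', which
   has no projective summand. *)
have u'R := represents_summand uR P0_proj qH q0H jH qj vE.
have uAR := tau_represents Q_acyclic A.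
have [[fH gH hH] [f0 fg gh hS]] := fgh_exact.
have [z [zH zS zu zmin]] :=
  represents_cokernel Q_acyclic u'R M'_noproj uAR A_noproj I_inj gH hH hS gh.
have [uD _ u_inj] := uR.
pose psi : cochain N M := [ffun a => (u a \o g)%VF].
have psiE a v : psi a v = u a (g v) by rewrite ffunE comp_lfunE.
have psiD : psi \in dext N M by apply: dext_compr.
have psi0 : psi != 0.
  have g0 : g != 0 by apply: (basis_not0 g_basis); rewrite mem_head.
  apply: contraNneq g0 => p0; apply/eqP/u_inj => // a.
  by have /ffunP/(_ a) := p0; rewrite !ffunE.
(* The component of psi in P0 lies in D Ext^1(P0, N) = 0, so psi takes its values in M'. *)
have q0psi a v : q0 (psi a v) = 0.
  have := dext_eq0 (projective_ext0 N P0_proj) (dext_compl N q0H psiD) a.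
  by rewrite ffunE => /lfunP/(_ v); rewrite comp_lfunE zero_lfunE.
(* Under M = M' (+) P0 the map Z is z on M' and the identity on P0, which puts the projective
   summand back into A0. *)
have [Z ZH ZE] := dsum_pair (is_hom_comp zH qH) q0H.
have ZS : limg Z = fullv.
  apply: limg_full => -[x y]; have [v ->] := limg_fullP zS x.
  exists (j v + j0 y); rewrite ZE comp_lfunE !linearD /=.
  have -> : q (j v) = v by rewrite -comp_lfunE qj id_lfunE.
  have -> : q (j0 y) = 0 by rewrite -comp_lfunE qj0 zero_lfunE.
  have -> : q0 (j v) = 0 by rewrite -comp_lfunE q0j zero_lfunE.
  have -> : q0 (j0 y) = y by rewrite -comp_lfunE q0j0 id_lfunE.
  by rewrite linear0 addr0 add0r.
have Zpsi a v : Z (psi a v) = 0.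
  rewrite ZE q0psi comp_lfunE psiE; have /lfunP/(_ v) := zu a.
  by rewrite ffunE !comp_lfunE zero_lfunE => ->.
(* This makes the kernel of Z the submodule generated by the values of psi: apply it to the
   projection from M onto the quotient by any submodule containing them. *)
have Zmin (X : qmod k Q) (pi : 'Hom(M, X)) : is_hom pi -> (forall a v, pi (psi a v) = 0) ->
    (lker Z <= lker pi)%VS.
  move=> piH pi0; have zj : (lker z <= lker (pi \o j))%VS.
    apply: zmin => [|a]; first exact: is_hom_comp.
    apply/lfunP => w; rewrite ffunE !comp_lfunE zero_lfunE -psiE.
    by have := pi0 a w; rewrite {1}[psi a w]vE q0psi linear0 addr0 => ->.
  apply/subvP => v; rewrite !memv_ker ZE => /eqP[zqv q0v].
  have zq : q v \in lker z by rewrite memv_ker -comp_lfunE; apply/eqP.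
  have := subvP zj _ zq; rewrite memv_ker comp_lfunE.
  by rewrite [in X in _ -> X](vE v) q0v linear0 addr0.
have linkE (V : {vspace N}) (U : {vspace M}) : stable V -> stable U ->
    linked V U psi = (V <= limg f)%VS && (lker Z <= U)%VS.
  move=> VS US; rewrite fg; apply/forallP/andP => [lk|[/subvP Vg /subvP ZU] a]; last first.
    apply/andP; split; apply/subvP => v.
      by move=> /Vg; rewrite !memv_ker psiE => /eqP ->; rewrite linear0.
    by move=> /memv_imgP[w _ ->]; apply: ZU; rewrite memv_ker Zpsi.
  split.
    (* A homomorphism to [tau M] that u kills is zero, so psi vanishing on the submodule V forces g
       to vanish there. *)
    have gi0 : (g \o incl VS)%VF = 0.
      apply: u_inj => [|a]; first exact: is_hom_comp gH (incl_hom VS).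
      apply/lfunP => v; rewrite !comp_lfunE -psiE zero_lfunE; apply/eqP; rewrite -memv_ker.
      by have /andP[/subvP VK _] := lk a; apply: VK; apply: incl_mem.
    apply/subvP => v; rewrite -{1}(limg_incl VS) => /memv_imgP[w _ ->].
    by rewrite memv_ker -comp_lfunE gi0 zero_lfunE.
  rewrite -[X in (_ <= X)%VS](lker_quo_proj US); apply: Zmin => [|a v].
    exact: quo_proj_hom.
  have /andP[_ /subvP LU] := lk a.
  by apply/eqP; rewrite -memv_ker (lker_quo_proj US) LU // memv_img ?memvf.
pose beta := dvs (lker Z); pose gamma := dvs (limg g).
have dM : dimvec M = beta + dimvec A0 by apply: dimvec_surj.
have dN : dimvec N = dimvec D0 + gamma.
  rewrite -dvs_full (dvs_limg gH (stable_full N)) capfv -fg; congr (_ + _).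
  by rewrite (dvs_inj fH) // stable_full.
(* In dimension vectors M' = beta + A and tau M = gamma + tau A + I. Substitute these into <X, tau
   M> = - <M', X> and <X, tau A> = - <A, X>. *)
have key (X : qmod k Q) : eform Q beta (dimvec X) + eform Q (dimvec X) gamma =
    - eform Q (dimvec X) (dimvec I).
  have r1 := euler_represents Q_acyclic u'R M'_noproj X.
  have r2 := euler_represents Q_acyclic uAR A_noproj X.
  have dT : dimvec (tau M) = gamma + (dimvec (tau A) + dimvec I).
    by rewrite (dimvec_surj hH hS) -gh dimvec_dsum.
  have := congr1 ((eform Q)^~ (dimvec X)) dM.
  rewrite (dimvec_iso M_dec) !dimvec_dsum !eformDl.
  move: r1 r2; rewrite !eulerE dT !eformDr. clear; lia.
have sigma : Bfull Q *m beta - (1%:M - Rfull Q) *m (beta + gamma) = dimvec (top_mod P).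
  by rewrite (socle_exponent Q_acyclic I_inj key) (dimvec_iso P_I).
have [hom_D0t hom_D0I] := homs_dsum_eq0 hom_D0.
(* The Auslander-Reiten formula for A0, whose projective summand P0 does no harm here. *)
have ext_A0D0 : ext_dim A0 D0 = 0%N.
  by rewrite -(represents_dim _ (tau_represents Q_acyclic A0)) hom_D0t dimv0.
have A0_supp : supported n A0.
  by move=> l nl; have /colP/(_ l) := dM; rewrite !mxE M_supp //; clear; lia.
have D0_supp : supported n D0.
  by move=> l nl; have /colP/(_ l) := dN; rewrite !mxE N_supp //; clear; lia.
have cE : c = Lform L ((1%:M - Rfull Q) *m dimvec N) ((1%:M - Rfull Q) *m dimvec M).
  have IRE (X : qmod k Q) : supported n X ->
      IR *m dimvecQ le_nm X = (1%:M - Rfull Q) *m dimvec X.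
    by move=> Xs; rewrite /IR Rmx_full mulmxBl -mulmxA (dimvec_supp le_nm Xs) mulmxBl mul1mx.
  by rewrite /c !IRE.
rewrite (CC0_mul s L_anti L_compat M_supp N_supp NEM_exact ip_phi phiC phiB ext_MN psiD psi0).
rewrite -cE; congr (_ + _).
rewrite (CC_dsum s le_nm L P D0_supp A0_supp ext_A0D0) scaler_sumr.
transitivity (\sum_(V : {vspace N} | stable V && (V <= limg f)%VS)
    \sum_(U : {vspace M} | stable U && (lker Z <= U)%VS)
      qpow s (2 * eform Q (dvs U) (dimvec N - dvs V) + c
              - eform Q (dvs V + dvs U) (dimvec N + dimvec M - (dvs V + dvs U))) *:
      Xpow s L (Bfull Q *m (dvs V + dvs U) - (1%:M - Rfull Q) *m (dimvec N + dimvec M))).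
  rewrite [RHS]big_mkcondr; apply: eq_bigr => V VS.
  case: ifP => Vf; last first.
    by rewrite big_pred0 // => U; case: (boolP (stable U)) => //= US; rewrite linkE // Vf.
  by apply: eq_bigl => U; case: (boolP (stable U)) => //= US; rewrite linkE // Vf.
rewrite (sum_stable_inj _ fH f0); apply: eq_bigr => V VS.
rewrite (sum_stable_surj _ ZH ZS) scaler_sumr; apply: eq_bigr => U US.
rewrite (dvs_preim ZH ZS US) (dvs_inj fH VS f0) scalerA -qpowD -/beta.
apply: scale_Xpow_eq; last first.
  rewrite -sigma dM dN !mulmxDr.
  set x1 := _ *m dvs V; set x2 := _ *m beta; set x3 := _ *m dvs U.
  set y1 := _ *m dimvec D0; set y2 := _ *m gamma; set y3 := _ *m beta; set y4 := _ *m dimvec A0.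
  apply/colP => l; rewrite !mxE; clear; lia.
(* By [key] at V, U and A0, the two exponents of q^{1/2} differ by <V, I> - <U, I> + <A0, I>, and
   each of these terms is zero. *)
have iV := eform_sub_injective I_inj hom_D0I VS.
have iU := eform_sub_injective I_inj hom_A0 US.
have := eform_sub_injective I_inj hom_A0 (stable_full A0); rewrite dvs_full => iA.
have := key A0; have := key (sub_mod VS); have := key (sub_mod US).
rewrite !dimvec_sub iV iU iA !eulerE dM dN.
rewrite !(eformDl, eformDr, eformNl, eformNr, opprD).
subst A0; clear; lia.
Qed.
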